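(* Assume hypotheses (S0), (S1) and (V). Let $\rho_j^0\in (L^1\cap BV)(\mathbb{R};[0,R/M])$, $j=1,\ldots,M$, and for $\tau>0$ let $\boldsymbol{\rho}^\tau=(\rho^\tau_1,\ldots,\rho^\tau_M)$ be the corresponding entropy weak solution of $$\begin{cases} \partial_t \rho_j + \partial_x F(\rho_j) = \frac{1}{\tau}\left(S_{j-1} (\rho_{j-1},\rho_j) - S_{j} (\rho_{j},\rho_{j+1})\right),\\ \rho_j(0,x) = \rho^0_j(x), \end{cases}\qquad x\in\mathbb{R},\ t\ge0,\ j=1,\ldots,M.$$ Then, for each $t>0$ and each $j=1,\ldots,M$, $$\rho^\tau_j (t,\cdot) \longrightarrow \frac{r(t,\cdot)}{M} \qquad\text{in } L^1_{loc}(\mathbb{R};\mathbb{R})\quad\text{as }\tau\searrow 0,$$ where $r\in C^0(\mathbb{R}^+;L^1(\mathbb{R};[0,R]))$ is the entropy weak solution of the scalar Cauchy problem $$\begin{cases}\partial_t r+\partial_x f(r)=0, & t>0,\ x\in\mathbb{R},\\ r(0,x)=\sum_{j=1}^M\rho_j^0(x), & x\in\mathbb{R},\end{cases}\qquad f(r):=M\,F(r/M).$$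
   Context: $M$ is the number of lanes. By convention $S_0=S_M=0$. (V): all lanes have the same maximal density $R_j=R/M$ and the same speed $v_j=v:[0,R/M]\to[0,V]$, strictly decreasing, with $v(0)=V$, $v(R/M)=0$; the common flux $F(\rho)=\rho v(\rho)$ is Lipschitz continuous and concave. (S0): the functions $S_j:\mathbb{R}_+^2\to\mathbb{R}$, $j=1,\ldots,M-1$, are Lipschitz continuous in both variables with Lipschitz constant $\mathcal{S}$, $S_j(0,0)=S_j(R_j,R_{j+1})=0$, and $\partial_1 S_j(a,b)\geq 0$, $\partial_2 S_j(a,b)\leq 0$ for all $a\in[0,R_j]$, $b\in[0,R_{j+1}]$. (S1): for $j=1,\ldots,M-1$, if $S_j(a,b)=0$ then $a=b$ (for $a\in[0,R_j]$, $b\in[0,R_{j+1}]$). Entropy weak solution of the system: $\boldsymbol{\rho}^\tau\in C^0([0,+\infty[;L^1(\mathbb{R};[0,R/M]^M))$ such that for every $j$, every $\kappa\in\mathbb{R}$ and every $\varphi\in C_c^1(\mathbb{R}^2;\mathbb{R}^+)$, $$\int_{\mathbb{R}^+}\!\int_{\mathbb{R}}\left(|\rho_j^\tau-\kappa|\partial_t\varphi+\mathrm{sgn}(\rho_j^\tau-\kappa)(F(\rho_j^\tau)-F(\kappa))\partial_x\varphi\right)dx\,dt+\int_{\mathbb{R}}|\rho_j^0-\kappa|\varphi(0,x)\,dx$$ $$+\frac1\tau\int_{\mathbb{R}^+}\!\int_{\mathbb{R}}\mathrm{sgn}(\rho_j^\tau-\kappa)\left(S_{j-1}(\rho_{j-1}^\tau,\rho_j^\tau)-S_j(\rho_j^\tau,\rho_{j+1}^\tau)\right)\varphi\,dx\,dt\ge0$$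 (the value assigned to $F(\kappa)$ for $\kappa\notin[0,R/M]$ is irrelevant). Such a solution exists and is unique. The entropy weak solution of the scalar problem is the usual Kruzhkov one. *)

(* Defs.v *)
From HB Require Import structures.
From mathcomp Require Import all_boot all_order all_algebra.
From mathcomp Require Import all_classical all_reals all_analysis.

Set Implicit Arguments.
Unset Strict Implicit.
Unset Printing Implicit Defensive.

Import Order.TTheory GRing.Theory Num.Theory.
Import numFieldNormedType.Exports.

Local Open Scope classical_set_scope.
Local Open Scope ring_scope.

(* Lanes are numbered 1, ..., M by natural numbers; values of lane-indexed
   families outside that range are irrelevant. All lanes have the same maximal
   density L = Rmax / M. *)

Section Hypotheses.
Context {R : realType}.

Definition flux (v : R -> R) (x : R) : R := x * v x.

Record hypV (L V : R) (v : R -> R) : Prop := HypV {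
  hypV_range : forall x, x \in `[0, L] -> v x \in `[0, V] ;
  hypV_decr : {in `[0, L] &, forall x y, x < y -> v y < v x} ;
  hypV_0 : v 0 = V ;
  hypV_L : v L = 0 ;
  hypV_lipschitz : [lipschitz (flux v x : R^o) | x in (`[0, L] : set R^o)] ;
  hypV_concave :
    convex_function (E := R^o) `[0, L]%classic (fun x => - flux v x) }.

(* A Lipschitz function of one variable is differentiable only almost
   everywhere, so the sign conditions on the partial derivatives are imposed at
   all points where these derivatives exist. *)
Record hypS0 (M : nat) (L lip : R) (S : nat -> R -> R -> R) : Prop := HypS0 {
  hypS0_lipschitz : forall j, (1 <= j < M)%N -> forall a b a' b',
    0 <= a -> 0 <= b -> 0 <= a' -> 0 <= b' ->
    `|S j a b - S j a' b'| <= lip * (`|a - a'| + `|b - b'|) ;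
  hypS0_00 : forall j, (1 <= j < M)%N -> S j 0 0 = 0 ;
  hypS0_LL : forall j, (1 <= j < M)%N -> S j L L = 0 ;
  hypS0_d1 : forall j, (1 <= j < M)%N ->
    forall a b, a \in `[0, L] -> b \in `[0, L] ->
    derivable (S j ^~ b) a 1 -> 0 <= derive1 (S j ^~ b) a ;
  hypS0_d2 : forall j, (1 <= j < M)%N ->
    forall a b, a \in `[0, L] -> b \in `[0, L] ->
    derivable (S j a) b 1 -> derive1 (S j a) b <= 0 }.

Definition hypS1 (M : nat) (L : R) (S : nat -> R -> R -> R) : Prop :=
  forall j, (1 <= j < M)%N -> forall a b, a \in `[0, L] -> b \in `[0, L] ->
  S j a b = 0 -> a = b.

(* S with the convention S_0 = S_M = 0 *)
Definition exchange (M : nat) (S : nat -> R -> R -> R) (j : nat) (a b : R) : R :=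
  if (1 <= j < M)%N then S j a b else 0.

End Hypotheses.

Section FunctionSpaces.
Context {R : realType}.
Local Notation mu := (@lebesgue_measure R).

(* Elements of L^1 are given by representatives, so BV is the existence of an
   a.e. equal function whose total variation over the whole line is finite. *)
Definition BVline (u : R -> R) : Prop :=
  exists2 w : R -> R, {ae mu, forall x, u x = w x} &
  exists C : R, forall a b, a <= b -> (total_variation a b w <= C%:E)%E.

Record L1BV (B : R) (u : R -> R) : Prop := HasL1BV {
  L1BV_range : forall x, u x \in `[0, B] ;
  L1BV_integrable : mu.-integrable setT (EFin \o u) ;
  L1BV_bv : BVline u }.

(* C^0([0, +oo[; L^1(R; [0, B])). Every such curve has a jointly measurable
   representative with values in [0, B], and u denotes one. *)
Record C0L1 (B : R) (u : R -> R -> R) : Prop := IsC0L1 {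
  C0L1_measurable : measurable_fun
    [set p : measurableTypeR R * measurableTypeR R | 0 <= p.1]
    (fun p => u p.1 p.2) ;
  C0L1_range : forall t x, 0 <= t -> u t x \in `[0, B] ;
  C0L1_integrable : forall t, 0 <= t -> mu.-integrable setT (EFin \o u t) ;
  C0L1_continuous : forall t, 0 <= t ->
    \int[mu]_x `|u s x - u t x| @[s --> within `[0, +oo[%classic (nbhs t)]
      --> (0 : R) }.

(* C^1_c(R^2; R_+); the first coordinate is time *)
Record test_function (phi : R * R -> R) : Prop := IsTestFunction {
  test_ge0 : forall p, 0 <= phi p ;
  test_derivable_t : forall p, derivable phi p (1, 0) ;
  test_derivable_x : forall p, derivable phi p (0, 1) ;
  test_continuous_t : continuous ('D_(1, 0) phi) ;
  test_continuous_x : continuous ('D_(0, 1) phi) ;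
  test_compact_support : compact (closure [set p | phi p != 0]) }.

End FunctionSpaces.

Section EntropySolutions.
Context {R : realType}.
Local Notation mu := (@lebesgue_measure R).

(* Kruzhkov entropy inequalities for
     d_t u + d_x F(u) = g(t, x),  u(0, x) = u0(x). *)
Definition entropy_inequality (F : R -> R) (g : R -> R -> R) (u0 : R -> R)
    (u : R -> R -> R) : Prop :=
  forall (kappa : R) (phi : R * R -> R), test_function phi ->
  0 <= \int[mu]_(t in `[0, +oo[) \int[mu]_x
         (`|u t x - kappa| * 'D_(1, 0) phi (t, x) +
          Num.sg (u t x - kappa) * (F (u t x) - F kappa) *
            'D_(0, 1) phi (t, x))
     + \int[mu]_x (`|u0 x - kappa| * phi (0, x))
     + \int[mu]_(t in `[0, +oo[) \int[mu]_x
         (Num.sg (u t x - kappa) * g t x * phi (t, x)).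

Definition system_entropy_solution (M : nat) (L : R) (F : R -> R)
    (S : nat -> R -> R -> R) (tau : R) (rho0 : nat -> R -> R)
    (rho : nat -> R -> R -> R) : Prop :=
  forall j, (1 <= j <= M)%N ->
  C0L1 L (rho j) /\
  entropy_inequality F
    (fun t x => tau^-1 *
       (exchange M S j.-1 (rho j.-1 t x) (rho j t x) -
        exchange M S j (rho j t x) (rho j.+1 t x)))
    (rho0 j) (rho j).

Definition scalar_entropy_solution (B : R) (f : R -> R) (r0 : R -> R)
    (r : R -> R -> R) : Prop :=
  C0L1 B r /\ entropy_inequality f (fun _ _ => 0) r0 r.

End EntropySolutions.

Definition cvg_L1loc {R : realType} (u : R -> R -> R) (l : R -> R) : Prop :=
  forall K : set R, compact K ->
  \int[@lebesgue_measure R]_(x in K) `|u tau x - l x| @[tau --> 0^'+]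
    --> (0 : R).

(* Main.v *)
(** Since [S_j] vanishes on the diagonal, the scalar solution shared equally
    between the lanes, [w = r / M] in each of them, solves the system for every
    [tau]; so the theorem is a quantitative comparison of two solutions of the
    same system.  The source is conservative and quasi-monotone, hence
    dissipative for the sum over the lanes of [|rho_j - w|].  Doubling only the
    time variable and keeping a mollifier of fixed width [e] in space, one finds
    that [sum_j \int\int |rho_j(t,x) - w(t,y)| bump((x-y)/e) dx dy] does not
    increase in time, uniformly in [tau]; it differs from the [L^1] distance by
    the oscillation at scale [e] of the initial data.  It remains to exhibit a
    small time [s] at which [rho(s)] and [w(s)] are close.  The entropy
    inequalities for constants [k] bound the integral of
    [|S_j| |sg(rho_j - k) - sg(rho_{j+1} - k)|] by [C tau]; by (S1) finitely many
    [k] control [|rho_j - rho_{j+1}|], so for small [tau] the lanes are nearly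
    equal at some [s < h].  The total density satisfies a conservation law with
    bounded flux, hence its mollification at time [s] is within [O(h)] of that
    of the initial data, and conservation of mass handles the tails. *)

(* The obstacle is the factor [1 / tau]: each solution is continuous in time, but its modulus may
   degenerate as [tau] tends to 0, since data that differ between lanes relax in an initial layer.
   Hence the order of limits: time mollifiers are removed at fixed [tau], where constants depending
   on [tau] are harmless, and only what survives is used for small [tau]. The width [e] stays
   positive because the monotonicity, applied to a solution paired with itself, bounds its
   oscillation at scale [e] at all times by that of its data, and the latter is small by continuity
   of translations in L^1. The constants 0 and [L] are the ends of the range of densities; for them
   Kruzhkov's inequalities become linear and opposite, which is how the conservation law of the
   total density is obtained. Tails are controlled by [|a - b| = (a - b) + 2 (b - a)^+]: summed over
   the lanes, the signed part integrates to zero by conservation of mass, and far away the positive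
   part is at most [w], which does not depend on [tau]. *)
Require Import Defs.
From HB Require Import structures.
From mathcomp Require Import all_boot all_order all_algebra.
From mathcomp Require Import all_classical all_reals all_analysis.
From mathcomp Require Import measurable_realfun.
From mathcomp Require Import ring lra.
Set Implicit Arguments.
Unset Strict Implicit.
Unset Printing Implicit Defensive.
Import Order.TTheory GRing.Theory Num.Theory.
Import numFieldNormedType.Exports.
Local Open Scope classical_set_scope.
Local Open Scope ring_scope.

(** * Monotonicity of a Lipschitz function from the sign of its derivative *)

Section LipschitzMonotone.
Context {R : realType}.
Local Notation mu := (@lebesgue_measure R).

Lemma stieltjes_itv (G : cumulative R R) (a b : R) : a < b ->
  lebesgue_stieltjes_measure G `]a, b]%classic = (G b - G a)%:E.
Proof.
move=> ab; rewrite /lebesgue_stieltjes_measure /measure_extension.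
rewrite measurable_mu_extE/=; last exact: is_ocitv.
by rewrite wlength_itv/= lte_fin ab EFinB.
Qed.

(* Up to a factor, [k x + f x] and [k x - f x] are the distribution functions of
   two measures whose sum is Lebesgue measure; the Radon-Nikodym density of the
   first one is, up to the same factor, [k + f'] almost everywhere. *)
Lemma nondecreasing_of_derive_ge0_lipschitz (f : R -> R) (K a b : R) :
  (forall x y, `|f x - f y| <= K * `|x - y|) -> a < b ->
  (forall x, x \in `]a, b[ -> derivable f x 1 -> 0 <= derive1 f x) ->
  f a <= f b.
Proof.
move=> fK0 ab f'ge0.
have [k k0 fK] : exists2 k, 0 < k & forall x y, `|f x - f y| <= k * `|x - y|.
  exists (`|K| + 1); first by rewrite ltr_wpDl.
  move=> x y; apply: (le_trans (fK0 x y)).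
  by rewrite ler_wpM2r// (le_trans (ler_norm _))// lerDl.
have fcont : continuous f.
  move=> x; apply/cvgrPdist_le => /= e e0.
  near=> y.
  rewrite (le_trans (fK _ _))// -ler_pdivlMl//.
  near: y; exists (k^-1 * e); first by rewrite /= mulr_gt0 ?invr_gt0.
  by move=> y /= /ltW.
have k2 : 0 < 2 * k by rewrite mulr_gt0.
(* With this normalisation [GG 1 + GG (-1)] is the identity, so the two Stieltjes measures add up to
   Lebesgue measure. *)
pose GG (s : R) (x : R) := (k * x + s * f x) / (2 * k).
have GGnd s : `|s| = 1 -> nondecreasing (GG s).
  move=> s1 x y xy; rewrite /GG ler_pM2r ?invr_gt0//.
  rewrite -subr_ge0.
  have -> : k * y + s * f y - (k * x + s * f x) = k * (y - x) - s * (f x - f y) by ring.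
  rewrite subr_ge0 (le_trans (ler_norm _))// normrM s1 mul1r (le_trans (fK _ _))//.
  by rewrite distrC ger0_norm// subr_ge0.
have GGrc s : right_continuous (GG s).
  apply: right_continuousW => x; apply: cvgM; last exact: cvg_cst.
  by apply: cvgD; apply: cvgM; [exact: cvg_cst|exact: cvg_id|exact: cvg_cst|exact: fcont].
have n1 : `|1 : R| = 1 by rewrite normr1.
have nN1 : `|-1 : R| = 1 by rewrite normrN1.
pose G : cumulative R R := HB.pack (GG 1) (isCumulative.Build R _ R (GG 1) (GGnd _ n1) (GGrc 1)).
pose H : cumulative R R := HB.pack (GG (-1)) (isCumulative.Build R _ R (GG (-1)) (GGnd _ nN1) (GGrc (-1))).
pose nG := lebesgue_stieltjes_measure G.
pose nH := lebesgue_stieltjes_measure H.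
have muE (A : set (measurableTypeR R)) : measurable A -> mu A = (nG A + nH A)%E.
  move=> mA; rewrite -measure_addE.
  apply: (lebesgue_stieltjes_measure_unique (f := idfun)) => // X /ocitvP[->|[x x12 ->]].
    by rewrite !measure0.
  transitivity (nG `]x.1, x.2]%classic + nH `]x.1, x.2]%classic)%E; last first.
    by rewrite -measure_addE.
  rewrite /nG /nH !stieltjes_itv// -EFinD; congr EFin; rewrite /= /GG.
  by field; rewrite lt0r_neq0.
have nGdom (A : set (measurableTypeR R)) : measurable A -> (nG A <= mu A)%E.
  by move=> mA; rewrite muE// leeDl.
have mab : measurable (`]a, b]%classic : set (measurableTypeR R)) by exact: measurable_itv.
have nGfin : (nG `]a, b]%classic < +oo)%E by rewrite /nG stieltjes_itv// ltry.
pose nu : {charge set (measurableTypeR R) -> \bar R} := charge_of_finite_measure (mfrestr mab nGfin).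
have numu : nu `<< mu.
  apply/null_content_dominatesP => A mA A0.
  apply/eqP; rewrite eq_le measure_ge0 andbT -A0.
  rewrite /nu/= /charge_of_finite_measure/= /mfrestr /mrestr.
  apply: (@le_trans _ _ (nG A)); last exact: nGdom.
  by apply: le_measure; rewrite ?inE//; exact: measurableI.
have hint := Radon_Nikodym_integrable numu.
have hfin := fun x => Radon_Nikodym_fin_num x numu.
pose h (x : R) := fine ((Radon_Nikodym nu mu : R -> \bar R) x).
have hE x : (h x)%:E = (Radon_Nikodym nu mu : R -> \bar R) x by rewrite fineK.
have ih : mu.-integrable setT (EFin \o h).
  by apply: eq_integrable hint => // x _; rewrite /= hE.
have Gint x : a < x -> x <= b -> \int[mu]_(t in `]a, x]) h t = G x - G a.
  move=> ax xb; rewrite /Rintegral.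
  rewrite (_ : (\int[mu]_(t in `]a, x]) (h t)%:E)%E = (G x - G a)%:E)//.
  rewrite -stieltjes_itv//.
  under eq_integral do rewrite hE.
  rewrite -Radon_Nikodym_integral//.
  transitivity (nG (`]a, x]%classic `&` `]a, b]%classic)); first by [].
  rewrite setIidl//.
  by move=> y /=; rewrite !in_itv/= => /andP[-> /le_trans ->].
have ihc y : mu.-integrable [set` Interval (BRight a) (BRight y)] (EFin \o h).
  by apply: integrableS ih.
have locih : locally_integrable [set: R] h.
  have := integrable_locally measurableT ih.
  by rewrite patch_setT.
(* At almost every [x] the primitive of [h] has derivative [h x]. There [f], a combination of that
   primitive and of the identity, has derivative [2 * k * h x - k], so differentiability of [f]
   comes for free and the hypothesis applies. *)
have aeh : {ae mu, forall x, x \in `]a, b] -> 1 / 2 <= h x}.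
  have := FTC1 ihc locih.
  have : {ae mu, forall x, x != b}.
    exists [set b]; split; [exact: measurable_set1|exact: lebesgue_measure_set1|].
    by move=> x /= /negP; rewrite negbK => /eqP.
  apply: filterS2; first exact: (ae_filter_ringOfSetsType mu).
  move=> x xb /= Hx; rewrite in_itv/= => /andP[ax xb'].
  have {xb xb'}xb : x < b by rewrite lt_neqAle xb.
  have [dF F'] := Hx ax.
  set F := (fun x0 : R => _) in dF F'.
  have nF : \near x, f x = 2 * k * (F x + G a) - k * x.
    near=> y.
    rewrite /F Gint; last 2 first.
    - by near: y; exact: lt_nbhsr.
    - by apply/ltW; near: y; exact: lt_nbhsl.
    rewrite /= /GG subrK; field.
    by rewrite lt0r_neq0.
  have idF : is_derive x 1 (fun y => 2 * k * (F y + G a) - k * y) (2 * k * h x - k).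
    rewrite -F' derive1E.
    have dF' : is_derive x 1 F ('D_1 F x) by exact: DeriveDef.
    apply: is_derive_eq.
    by rewrite /GRing.scale/= !mulr1 addr0.
  have idf : is_derive x 1 f (2 * k * h x - k).
    apply: near_eq_is_derive idF.
    by apply: filterS nF => y ->.
  have /f'ge0 : x \in `]a, b[ by rewrite in_itv/= ax.
  move=> /(_ (@ex_derive _ _ _ _ _ _ _ idf)).
  rewrite derive1E derive_val subr_ge0 => kh.
  rewrite ler_pdivrMr// -(ler_pM2l k0); lra.
(* The right-hand side is [G b - G a = (b - a) / 2 + (f b - f a) / (2 * k)], so this inequality is
   the claim. *)
have : (b - a) / 2 <= \int[mu]_(t in `]a, b]) h t.
  rewrite -lee_fin.
  have -> : ((b - a) / 2)%:E = (\int[mu]_(t in `]a, b]) (1 / 2)%:E)%E.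
    rewrite integral_cst//= lebesgue_measure_itv/= lte_fin ab -EFinD -EFinM.
    by congr EFin; ring.
  rewrite fineK; last by apply: integrable_fin_num => //; exact: ihc.
  have mh : measurable_fun setT h by case/integrableP : ih => /measurable_EFinP.
  (* Replacing [h] by its maximum with [1 / 2], to which it is almost everywhere equal on the
     interval, makes the lower bound pointwise. *)
  rewrite (@ae_eq_integral _ _ _ mu _ (fun t => (Num.max (h t) (1/2))%:E) (EFin \o h)) //.
  - apply: ge0_le_integral => //.
    + apply/measurable_EFinP/measurable_funTS; apply: measurable_maxr => //.
    + by move=> x _; rewrite lee_fin le_max lexx orbT.
  - exact/measurable_EFinP/measurable_funTS.
  - apply/measurable_EFinP/measurable_funTS; apply: measurable_maxr => //.
  - apply: filterS aeh; first exact: (ae_filter_ringOfSetsType mu).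
    by move=> x /= + xab => /(_ xab) /max_idPl ->.
rewrite Gint// /= /GG -mulrBl !mul1r ler_pdivlMr//.
nra.
Unshelve. all: by end_near. Qed.

End LipschitzMonotone.

(** * Cut-off functions and integration *)

Section Bumps.
Context {R : realType}.

Lemma is_derive_posr_sqr (x : R) :
  is_derive x 1 (fun y : R => Num.max y 0 ^+ 2) (2 * Num.max x 0).
Proof.
have [x0|x0|->] := ltrgt0P x.
- have h : is_derive x 1 (fun y : R => y ^+ 2) (2 * x).
    apply: is_derive_eq; rewrite /GRing.scale/=; ring.
  apply: near_eq_is_derive h; near=> y.
  suff -> : Num.max y 0 = y by [].
  by apply/max_idPl/ltW; near: y; exact: lt_nbhsr.
- have h : is_derive x 1 (fun _ : R => 0 : R) 0 by exact: is_derive_cst.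
  rewrite mulr0; apply: near_eq_is_derive h; near=> y.
  suff -> : Num.max y 0 = 0 by rewrite expr0n.
  by apply/max_idPr/ltW; near: y; exact: lt_nbhsl.
- rewrite mulr0.
  have h : h^-1 *: (Num.max (h *: (1 : R) + 0) 0 ^+ 2 - Num.max (0 : R) 0 ^+ 2)
     @[h --> (0 : R)^'] --> (0 : R).
    apply/cvgrPdist_le => e e0; near=> h.
    rewrite maxxx expr0n/= subr0 addr0 sub0r normrN normrM normfV normrX.
    rewrite [h *: _]mulr1.
    have hn0 : h != 0 by near: h; exact: nbhs_dnbhs_neq.
    have hp : 0 < `|h| by rewrite normr_gt0.
    rewrite ler_pdivrMl//.
    have he : `|h| <= e.
      near: h; apply: dnbhs0_le => //.
    rewrite expr2 ler_pM//.
    + by case: (lerP h 0) => h0; [rewrite normr0|].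
    + case: (lerP h 0) => h0; rewrite ?normr0 ?(ltW e0)//.
  apply: DeriveDef; first by apply/cvg_ex; exists 0; exact: h.
  by apply/cvg_lim => //; exact: h.
Unshelve. all: by end_near. Qed.

(** The derivative is carried as an explicit function, so that products of two such pairs are test
    functions whose partial derivatives are known in closed form. *)
Record C1c (A : R) (f f' : R -> R) : Prop := IsC1c {
  C1c_ge0 : forall x, 0 <= f x ;
  C1c_derive : forall x : R, is_derive x 1 f (f' x) ;
  C1c_continuous : continuous f' ;
  C1c_support : forall x : R, A <= `|x| -> f x = 0 /\ f' x = 0 }.

(** Squaring the positive part gives exactly the C^1 regularity asked of test functions. The kernel
    is not normalised: it stays between 0 and 1, and its integral [mass e] is carried through the
    estimates. *)
Definition bump (e z : R) : R := Num.max (1 - (z / e) ^+ 2) 0 ^+ 2.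
Definition dbump (e z : R) : R :=
  - (4 * z / e ^+ 2) * Num.max (1 - (z / e) ^+ 2) 0.

Lemma bump_ge0 (e z : R) : 0 <= bump e z. Proof. exact: sqr_ge0. Qed.

Lemma posr_1sqr (y : R) : 0 <= Num.max (1 - y ^+ 2) 0 <= 1.
Proof.
by rewrite le_max lexx orbT ge_max ler01 andbT lerBlDr lerDl sqr_ge0.
Qed.

Lemma bump_le1 (e z : R) : bump e z <= 1.
Proof. by have /andP[? ?] := posr_1sqr (z / e); rewrite expr_le1. Qed.

Lemma bumpN (e z : R) : bump e (- z) = bump e z.
Proof. by rewrite /bump mulNr sqrrN. Qed.

Lemma bump_supp (e z : R) : 0 < e -> e <= `|z| -> bump e z = 0 /\ dbump e z = 0.
Proof.
move=> e0 ez; rewrite /bump /dbump.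
have -> : Num.max (1 - (z / e) ^+ 2) 0 = 0.
  apply/max_idPr; rewrite subr_le0 -(real_normK (num_real _)) expr_ge1//.
  by rewrite normrM normfV (gtr0_norm e0) ler_pdivlMr// mul1r.
by rewrite expr0n mulr0.
Qed.

Lemma bump_ge (e z : R) : 0 < e -> `|z| <= e / 2 -> 1 / 4 <= bump e z.
Proof.
move=> e0 ez; rewrite /bump.
have ze : `|z / e| <= 1 / 2.
  by rewrite normrM normfV (gtr0_norm e0) ler_pdivrMr//; lra.
have ze2 : (z / e) ^+ 2 <= (1 / 2) ^+ 2.
  by rewrite -(real_normK (num_real _)) ler_pXn2r// ?nnegrE//; lra.
have : 1 / 2 <= Num.max (1 - (z / e) ^+ 2) 0.
  by rewrite le_max; apply/orP; left; move: ze2; rewrite !expr2; lra.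
move: (Num.max _ _) => x; rewrite expr2; nra.
Qed.

Lemma is_derive_bump (e z : R) : is_derive z 1 (bump e) (dbump e z).
Proof.
have h1 : is_derive z 1 (fun y : R => 1 - (y / e) ^+ 2) (- (2 * z / e ^+ 2)).
  apply: is_derive_eq.
  by rewrite /GRing.scale/= expr2 invfM; ring.
have h2 := is_derive_posr_sqr (1 - (z / e) ^+ 2).
have := @is_derive1_comp _ (fun y : R => Num.max y 0 ^+ 2) (fun y : R => 1 - (y / e) ^+ 2) z _ _ h2 h1.
move=> /is_derive_eq; apply.
by rewrite /dbump /GRing.scale/=; ring.
Qed.

Lemma continuous_posr : continuous (fun y : R => Num.max y 0).
Proof.
move=> y; rewrite /continuous_at.
have -> : (fun y : R => Num.max y 0) = (fun y => (y + `|y|) / 2).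
  apply/funext => x; case: (lerP 0 x) => x0.
    by rewrite ger0_norm//; field.
  by rewrite ltr0_norm//; field.
have -> : Num.max y 0 = (y + `|y|) / 2.
  case: (lerP 0 y) => x0.
    by rewrite ger0_norm//; field.
  by rewrite ltr0_norm//; field.
apply: cvgM; last exact: cvg_cst.
by apply: cvgD; [exact: cvg_id|exact: norm_continuous].
Qed.

Lemma continuous_dbump (e : R) : continuous (dbump e).
Proof.
move=> z; apply: cvgM.
  apply: cvgN; apply: cvgM; last exact: cvg_cst.
  by apply: cvgM; [exact: cvg_cst|exact: cvg_id].
apply: (cvg_comp (fun z => 1 - (z / e) ^+ 2) (fun y => Num.max y 0)); last exact: continuous_posr.
apply: cvgB; first exact: cvg_cst.
by apply: cvgM; apply: cvgM; by [exact: cvg_id|exact: cvg_cst].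
Qed.

Lemma continuous_bump (e : R) : continuous (bump e).
Proof.
move=> z; apply/differentiable_continuous/derivable1_diffP.
exact: (@ex_derive _ _ _ _ _ _ _ (is_derive_bump e z)).
Qed.

Lemma dbump_le (e z : R) : 0 < e -> `|dbump e z| <= 4 / e.
Proof.
move=> e0; have [ze|ze] := leP e `|z|.
  by rewrite (bump_supp e0 ze).2 normr0 divr_ge0// ltW.
have /andP[p0 p1] := posr_1sqr (z / e).
rewrite /dbump normrM (ger0_norm p0) normrN !normrM normfV normrX (gtr0_norm e0).
rewrite -[leRHS]mulr1 ler_pM//.
  by rewrite mulr_ge0// invr_ge0 exprn_ge0// ltW.
rewrite normr_nat -mulrA ler_pM2l// expr2 invfM mulrA ler_piMl// ?invr_ge0 ?(ltW e0)//.
by rewrite ler_pdivrMr// mul1r ltW.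
Qed.

Lemma C1c_bump (e a A : R) : 0 < e -> `|a| + e <= A ->
  C1c A (fun x => bump e (x - a)) (fun x => dbump e (x - a)).
Proof.
move=> e0 aA; split.
- by move=> x; exact: bump_ge0.
- move=> x.
  have h : is_derive x 1 (fun y : R => y - a) 1.
    by apply: is_derive_eq; rewrite subr0.
  have := @is_derive1_comp _ (bump e) (fun y : R => y - a) x _ _ (is_derive_bump e (x - a)) h.
  by move=> /is_derive_eq; apply; rewrite /GRing.scale/= mulr1.
- move=> x; apply: (@continuous_comp _ _ _ (fun x => x - a)).
    by apply: cvgB; [exact: cvg_id|exact: cvg_cst].
  exact: continuous_dbump.
- move=> x Ax; apply: bump_supp => //.
  have := ler_normD (x - a) a; rewrite subrK; lra.
Qed.

End Bumps.

Section Integrability.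
Context d (T : measurableType d) (R : realType) (m : {measure set T -> \bar R}).

Definition L1 (f : T -> R) := m.-integrable setT (EFin \o f).

Lemma L1_measurable f : L1 f -> measurable_fun setT f.
Proof. by case/integrableP => /measurable_EFinP. Qed.

Lemma L1_dom (f g : T -> R) : measurable_fun setT f ->
  L1 g -> (forall x, `|f x| <= g x) -> L1 f.
Proof.
move=> mf ig fg; apply: le_integrable ig => //; first exact/measurable_EFinP.
by move=> x _ /=; rewrite lee_fin (le_trans (fg x))// ler_norm.
Qed.

Lemma L1D f g : L1 f -> L1 g -> L1 (fun x => f x + g x).
Proof. by move=> lf lg; exact: (integrableD measurableT lf lg). Qed.

Lemma L1B f g : L1 f -> L1 g -> L1 (fun x => f x - g x).
Proof. by move=> lf lg; exact: (integrableB measurableT lf lg). Qed.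

Lemma L1Z r f : L1 f -> L1 (fun x => r * f x).
Proof. by move=> lf; exact: (integrableZl measurableT r lf). Qed.

Lemma L1_norm f : L1 f -> L1 (fun x => `|f x|).
Proof. by move=> lf; exact: (integrable_norm lf). Qed.

Lemma L10 : L1 (fun=> 0).
Proof. exact: integrable0. Qed.

Lemma L1_sum I (s : seq I) (P : pred I) (f : I -> T -> R) :
  (forall i, P i -> L1 (f i)) -> L1 (fun x => \sum_(i <- s | P i) f i x).
Proof.
move=> lf.
apply: (eq_integrable measurableT (fun x => (\sum_(i <- s | P i) (f i x)%:E)%E)).
  by move=> x _; rewrite /= sumEFin.
exact: (integrable_sum measurableT).
Qed.

Lemma L1_eq f g : (forall x, f x = g x) -> L1 f -> L1 g.
Proof. by move=> /funext ->. Qed.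

Lemma IntD f g : L1 f -> L1 g ->
  \int[m]_x (f x + g x) = \int[m]_x f x + \int[m]_x g x.
Proof. exact: RintegralD. Qed.

Lemma IntB f g : L1 f -> L1 g ->
  \int[m]_x (f x - g x) = \int[m]_x f x - \int[m]_x g x.
Proof. exact: RintegralB. Qed.

Lemma IntZ r f : L1 f -> \int[m]_x (r * f x) = r * \int[m]_x f x.
Proof. exact: RintegralZl. Qed.

Lemma Int0 : \int[m]_x 0 = 0 :> R.
Proof. by rewrite /Rintegral integral0. Qed.

Lemma IntN f : L1 f -> \int[m]_x (- f x) = - \int[m]_x f x.
Proof.
move=> lf; rewrite -[RHS]mulN1r -IntZ//.
by congr Rintegral; apply/funext => x; rewrite mulN1r.
Qed.

Lemma Int_eq f g : (forall x, f x = g x) -> \int[m]_x f x = \int[m]_x g x.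
Proof. by move=> /funext ->. Qed.

Lemma Int_sum I (s : seq I) (P : pred I) (f : I -> T -> R) :
  (forall i, P i -> L1 (f i)) ->
  \int[m]_x (\sum_(i <- s | P i) f i x) = \sum_(i <- s | P i) \int[m]_x f i x.
Proof.
move=> lf; elim: s => [|i s IH].
  by rewrite [RHS]big_nil -[RHS]Int0; apply: Int_eq => x; rewrite big_nil.
rewrite [RHS]big_cons -IH; case: ifPn => Pi.
  rewrite -IntD; [|exact: lf|exact: L1_sum].
  by apply: Int_eq => x; rewrite big_cons Pi.
by apply: Int_eq => x; rewrite big_cons (negbTE Pi).
Qed.

Lemma Int_le f g : L1 f -> L1 g -> (forall x, f x <= g x) ->
  \int[m]_x f x <= \int[m]_x g x.
Proof. by move=> lf lg fg; apply: le_Rintegral. Qed.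

Lemma Int_ge0 f : (forall x, 0 <= f x) -> 0 <= \int[m]_x f x.
Proof. by move=> f0; apply: Rintegral_ge0. Qed.

Lemma Int_norm f : L1 f -> `|\int[m]_x f x| <= \int[m]_x `|f x|.
Proof. by move=> lf; apply: le_normr_Rintegral. Qed.

End Integrability.

Section Fubini.
Context d1 d2 (T1 : measurableType d1) (T2 : measurableType d2) (R : realType).
Context (m1 : {sigma_finite_measure set T1 -> \bar R}).
Context (m2 : {sigma_finite_measure set T2 -> \bar R}).
Local Notation m12 := (m1 \x m2)%E.

Lemma EFin_Int d (T : measurableType d) (m : {measure set T -> \bar R}) f :
  L1 m f -> (\int[m]_x f x)%:E = (\int[m]_x (f x)%:E)%E.
Proof. by move=> lf; rewrite /Rintegral fineK//; exact: integrable_fin_num. Qed.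

(** By Tonelli it suffices to dominate the L^1 norms of the slices by an integrable function. Slices
    are integrable at every point, not only almost everywhere, so that iterated real-valued
    integrals make sense. *)
Lemma L1_prod (f : T1 * T2 -> R) (H : T1 -> R) :
  measurable_fun setT f -> L1 m1 H ->
  (forall x, L1 m2 (fun y => f (x, y))) ->
  (forall x, \int[m2]_y `|f (x, y)| <= H x) -> L1 m12 f.
Proof.
move=> mf lH sf fH; apply/(integrable12ltyP _ _ _).2; first exact/measurable_EFinP.
have H0 x : 0 <= H x by rewrite (le_trans _ (fH x))// Int_ge0.
apply: (@le_lt_trans _ _ (\int[m1]_x (H x)%:E)%E); last first.
  by rewrite -EFin_Int// ltry.
apply: ge0_le_integral => //.
- by move=> x _; apply: integral_ge0.
- apply: (measurable_fun_fubini_tonelli_F (fun z => `|(EFin \o f) z|%E)) => //.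
  by apply: measurableT_comp => //; exact/measurable_EFinP.
- by apply/measurable_EFinP; exact: L1_measurable lH.
- move=> x _; have := fH x; rewrite -lee_fin EFin_Int//.
  exact: L1_norm.
Qed.

Lemma L1_Int_prod (f : T1 * T2 -> R) : L1 m12 f ->
  (forall x, L1 m2 (fun y => f (x, y))) ->
  L1 m1 (fun x => \int[m2]_y f (x, y)).
Proof.
move=> lf sf; have h := integrable_fubini_F lf.
by apply: eq_integrable h => // x _; rewrite /fubini_F /= EFin_Int.
Qed.

Lemma Int_prod (f : T1 * T2 -> R) : L1 m12 f ->
  (forall x, L1 m2 (fun y => f (x, y))) ->
  \int[m12]_z f z = \int[m1]_x \int[m2]_y f (x, y).
Proof.
move=> lf sf; rewrite /Rintegral -integral12_prod_meas1//; congr fine.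
by apply: eq_integral => x _; rewrite /fubini_F /fubini_G -EFin_Int.
Qed.

Lemma Int_prod_swap (f : T1 * T2 -> R) : L1 m12 f ->
  (forall y, L1 m1 (fun x => f (x, y))) ->
  \int[m12]_z f z = \int[m2]_y \int[m1]_x f (x, y).
Proof.
move=> lf sf; rewrite /Rintegral -integral21_prod_meas1//; congr fine.
by apply: eq_integral => x _; rewrite /fubini_F /fubini_G -EFin_Int.
Qed.
End Fubini.

Section Kernels.
Context {R : realType}.
Local Notation mu := (@lebesgue_measure R).

Lemma L1_compact_support (f : R -> R) (A C : R) :
  measurable_fun setT f -> (forall x, `|f x| <= C) ->
  (forall x, A < `|x| -> f x = 0) -> L1 mu f.
Proof.
move=> mf fC fA.
have iA : L1 mu (fun x => C * \1_(`[-A, A]%classic : set R) x).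
  by apply: L1Z; exact: integrable_indic_itv.
apply: L1_dom iA _ => // x; rewrite indicE.
have [xA|xA] := leP `|x| A.
  by rewrite mem_set ?mulr1//= in_itv/= -ler_norml.
by rewrite fA// normr0 mulr_ge0// (le_trans _ (fC 0)).
Qed.

Lemma C1c_continuousf A (f f' : R -> R) : C1c A f f' -> continuous f.
Proof.
move=> h z; apply/differentiable_continuous/derivable1_diffP.
exact: (@ex_derive _ _ _ _ _ _ _ (C1c_derive h z)).
Qed.

Lemma measurable_bump (e : R) : measurable_fun setT (bump e).
Proof. by apply: continuous_measurable_fun; exact: continuous_bump. Qed.

Lemma measurable_dbump (e : R) : measurable_fun setT (dbump e).
Proof. by apply: continuous_measurable_fun; exact: continuous_dbump. Qed.

Lemma norm_bump (e z : R) : `|bump e z| <= 1.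
Proof. by rewrite ger0_norm ?bump_le1// bump_ge0. Qed.

Lemma L1_bump (e : R) : 0 < e -> L1 mu (bump e).
Proof.
move=> e0; apply: (@L1_compact_support _ e 1).
- exact: measurable_bump.
- exact: norm_bump.
- by move=> x xe; rewrite (bump_supp e0 (ltW xe)).1.
Qed.

Lemma Int_shift (f : R -> R) (a : R) : continuous f -> (forall x, 0 <= f x) ->
  \int[mu]_x f (x - a) = \int[mu]_x f x.
Proof.
move=> cf f0; rewrite /Rintegral.
have dF (x : R) : is_derive x 1 (fun y : R => y - a) 1.
  by apply: is_derive_eq; rewrite subr0.
have F'E : derive1 (fun y : R => y - a) = cst 1.
  by apply/funext => x; rewrite derive1E (@derive_val _ _ _ _ _ _ _ (dF x)).
rewrite [in RHS](@increasing_ge0_integration_by_substitutionT _ (fun y => y - a) f) ?F'E//.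
- by congr fine; apply: eq_integral => x _ /=; rewrite mulr1.
- by move=> x y xy; rewrite ltrD2r.
- by move=> x; exact: cst_continuous.
- exact: is_cvg_cst.
- exact: is_cvg_cst.
- by apply: cvg_addrr_Ny.
- by apply: cvg_addrr.
Qed.

Definition mass (e : R) := \int[mu]_x bump e x.

Lemma Int_bump_shift (e a : R) : 0 < e -> \int[mu]_x bump e (x - a) = mass e.
Proof.
by move=> e0; apply: Int_shift; [exact: continuous_bump|move=> x; exact: bump_ge0].
Qed.

Lemma Int_bump_shiftN (e a : R) : 0 < e -> \int[mu]_x bump e (a - x) = mass e.
Proof.
move=> e0; rewrite -(Int_bump_shift a e0).
by apply: Int_eq => x; rewrite -bumpN opprB.
Qed.

Lemma Int_itv_cst (a b c : R) : a <= b ->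
  \int[mu]_x (c * \1_(`[a, b]%classic : set R) x) = c * (b - a).
Proof.
move=> ab; rewrite IntZ; last exact: integrable_indic_itv.
congr (_ * _); rewrite /Rintegral integral_indic//= setIT.
rewrite lebesgue_measure_itv/= lte_fin.
by move: ab; rewrite le_eqVlt => /predU1P[->|->]//; rewrite ltxx subrr.
Qed.

Lemma mass_le (e : R) : 0 < e -> mass e <= 2 * e.
Proof.
move=> e0; have -> : 2 * e = 1 * (e - (- e)) by ring.
rewrite -Int_itv_cst; last lra.
apply: Int_le; [exact: L1_bump|by apply: L1Z; exact: integrable_indic_itv|].
move=> x; rewrite indicE mul1r; case: (leP e `|x|) => xe.
  by rewrite (bump_supp e0 xe).1.
rewrite mem_set ?bump_le1//= in_itv/=; move: xe; rewrite ltr_norml => /andP[? ?].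
lra.
Qed.

Lemma mass_ge (e : R) : 0 < e -> e / 4 <= mass e.
Proof.
move=> e0; have -> : e / 4 = 1 / 4 * (e / 2 - (- (e / 2))) by field.
rewrite -Int_itv_cst; last lra.
apply: Int_le; [by apply: L1Z; exact: integrable_indic_itv|exact: L1_bump|].
move=> x; rewrite indicE; case: (leP `|x| (e / 2)) => xe.
  rewrite mem_set; first by rewrite mulr1 bump_ge.
  by rewrite /= in_itv/= -ler_norml.
rewrite memNset ?mulr0 ?bump_ge0//= in_itv/= -ler_norml.
by apply/negP; rewrite -ltNge.
Qed.

Lemma mass_gt0 (e : R) : 0 < e -> 0 < mass e.
Proof. by move=> e0; rewrite (lt_le_trans _ (mass_ge e0))// divr_gt0. Qed.

Definition prim (e t : R) := \int[mu]_(x in `]-oo, t]) bump e x.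

Lemma is_derive_prim (e t : R) : 0 < e -> is_derive t 1 (prim e) (bump e t).
Proof.
move=> e0.
have [] := @continuous_FTC1 R (bump e) -oo%O t (t + 1).
- by rewrite ltrDl.
- by apply: integrableS (L1_bump e0).
- by rewrite ltNyr.
- exact: continuous_bump.
move=> d <-; rewrite derive1E; exact: DeriveDef.
Qed.

Lemma primE (e t : R) : 0 < e -> prim e t = \int[mu]_x (bump e x * \1_(`]-oo, t]%classic : set R) x).
Proof.
move=> e0; rewrite /prim Rintegral_mkcond; apply: Int_eq => x.
by rewrite patchE indicE; case: ifP; rewrite ?mulr1 ?mulr0.
Qed.

Lemma L1_prim (e t : R) : 0 < e -> L1 mu (fun x => bump e x * \1_(`]-oo, t]%classic : set R) x).
Proof.
move=> e0; apply: (L1_dom _ (L1_bump e0)).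
  by apply: measurable_funM; [exact: measurable_bump|exact: measurable_indic].
move=> x; rewrite indicE; case: (x \in _); rewrite ?mulr1 ?mulr0 ?normr0 ?bump_ge0//.
by rewrite ger0_norm// bump_ge0.
Qed.

Lemma prim_homo (e s t : R) : 0 < e -> s <= t -> prim e s <= prim e t.
Proof.
move=> e0 st; rewrite !primE//; apply: Int_le; [exact: L1_prim|exact: L1_prim|].
move=> x; rewrite !indicE ler_wpM2l ?bump_ge0// ler_nat !mem_setE !in_itv/=.
by case: (leP x s) => // /le_trans ->.
Qed.

Lemma prim0 (e t : R) : 0 < e -> t <= - e -> prim e t = 0.
Proof.
move=> e0 te; rewrite primE// -[RHS](@Int0 _ _ _ mu); apply: Int_eq => x.
rewrite indicE mem_setE in_itv/=; case: (leP x t) => xt; last by rewrite mulr0.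
rewrite (bump_supp e0 _).1 ?mul0r// ler0_norm; lra.
Qed.

Lemma prim_mass (e t : R) : 0 < e -> e <= t -> prim e t = mass e.
Proof.
move=> e0 te; rewrite primE//; apply: Int_eq => x.
rewrite indicE mem_setE in_itv/=; case: (leP x t) => xt; first by rewrite mulr1.
rewrite (bump_supp e0 _).1 ?mul0r// ger0_norm; lra.
Qed.

Lemma prim_ge0 (e t : R) : 0 <= prim e t.
Proof. by apply: Rintegral_ge0 => x _; exact: bump_ge0. Qed.

Lemma prim_le (e t : R) : 0 < e -> prim e t <= mass e.
Proof.
move=> e0; rewrite -(prim_mass e0 (lexx e)).
have [te|/ltW te] := leP t e; first exact: prim_homo.
by rewrite (prim_mass e0 te) (prim_mass e0 (lexx e)).
Qed.

Lemma is_derive_subr (f f' : R -> R) (a : R) (x : R) :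
  (forall y : R, is_derive y 1 f (f' y)) -> is_derive x 1 (fun y => f (y - a)) (f' (x - a)).
Proof.
move=> ff'; have h : is_derive x 1 (fun y : R => y - a) 1.
  by apply: is_derive_eq; rewrite subr0.
have := @is_derive1_comp _ f (fun y : R => y - a) x _ _ (ff' (x - a)) h.
by move=> /is_derive_eq; apply; rewrite /GRing.scale/= mulr1.
Qed.

(** A smoothed indicator of the interval from [a] to [b], of height [mass e]. Its derivative is a
    bump at [a] minus a bump at [b], which turns an entropy inequality into a comparison between two
    times. *)
Definition window (e a b t : R) := prim e (t - a) - prim e (t - b).
Definition dwindow (e a b t : R) := bump e (t - a) - bump e (t - b).

Lemma C1c_window (e a b A : R) : 0 < e -> a <= b -> `|a| + e <= A -> `|b| + e <= A ->
  C1c A (window e a b) (dwindow e a b).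
Proof.
move=> e0 ab aA bA; split.
- by move=> x; rewrite subr_ge0 prim_homo// lerD2l lerN2.
- move=> x; have h c : is_derive x 1 (fun y => prim e (y - c)) (bump e (x - c)).
    by apply: is_derive_subr => y; exact: is_derive_prim.
  exact: is_deriveB.
- have h c : continuous (fun t => bump e (t - c)).
    exact: (C1c_continuousf (C1c_bump e0 (lexx (`|c| + e)))).
  by move=> x; apply: cvgB; exact: h.
- move=> x; rewrite /window /dwindow.
  have := ler_norm a; have := ler_norm b.
  have := ler_norm (- a); have := ler_norm (- b); rewrite !normrN => ? ? ? ?.
  case: (ger0P x) => x0 Ax.
    have xa : e <= x - a by lra.
    have xb : e <= x - b by lra.
    rewrite !prim_mass//.
    by rewrite !(bump_supp e0 _).1 ?subrr// ger0_norm//; lra.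
  have xa : x - a <= - e by lra.
  have xb : x - b <= - e by lra.
  rewrite !prim0//.
  by rewrite !(bump_supp e0 _).1 ?subrr// ler0_norm//; lra.
Qed.

Lemma C1cM A (f f' g g' : R -> R) : C1c A f f' -> C1c A g g' ->
  C1c A (fun x => f x * g x) (fun x => f' x * g x + f x * g' x).
Proof.
move=> hf hg; split.
- by move=> x; rewrite mulr_ge0 ?(C1c_ge0 hf) ?(C1c_ge0 hg).
- move=> x; have df := C1c_derive hf x; have dg := C1c_derive hg x.
  by apply: is_derive_eq; rewrite /GRing.scale/=; ring.
- move=> x; apply: cvgD; apply: cvgM.
  + exact: (C1c_continuous hf).
  + exact: (C1c_continuousf hg).
  + exact: (C1c_continuousf hf).
  + exact: (C1c_continuous hg).
- by move=> x /(C1c_support hf)[-> ->]; rewrite !mul0r addr0.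
Qed.

Lemma C1c_widen A B (f f' : R -> R) : A <= B -> C1c A f f' -> C1c B f f'.
Proof.
move=> AB hf; split; [exact: C1c_ge0 hf|exact: C1c_derive hf|exact: C1c_continuous hf|].
by move=> x /(le_trans AB) /(C1c_support hf).
Qed.

Section Product.
Context (A : R) (f f' g g' : R -> R) (hf : C1c A f f') (hg : C1c A g g').

Let phi (p : R * R) := f p.1 * g p.2.

Lemma is_derive_prod_t p : is_derive p ((1, 0) : R * R) phi (f' p.1 * g p.2).
Proof.
have [/cvg_ex[l /= hl] fE] := C1c_derive hf p.1.
have lE : l = f' p.1 by rewrite -fE; apply/esym/cvg_lim.
rewrite {}lE in hl.
have h : h^-1 *: (phi (h *: ((1, 0) : R * R) + p) - phi p) @[h --> (0 : R)^'] --> f' p.1 * g p.2.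
  have -> : (fun h : R => h^-1 *: (phi (h *: ((1, 0) : R * R) + p) - phi p)) =
      (fun h => (h^-1 *: (f (h *: (1 : R) + p.1) - f p.1)) * g p.2).
    apply/funext => h; rewrite /phi /= scaler0 add0r.
    by rewrite -scalerAl; congr (_ *: _); rewrite mulrBl.
  by apply: cvgM => //; exact: cvg_cst.
apply: DeriveDef; first by apply/cvg_ex; exists (f' p.1 * g p.2).
by apply/cvg_lim.
Qed.

Lemma is_derive_prod_x p : is_derive p ((0, 1) : R * R) phi (f p.1 * g' p.2).
Proof.
have [/cvg_ex[l /= hl] gE] := C1c_derive hg p.2.
have lE : l = g' p.2 by rewrite -gE; apply/esym/cvg_lim.
rewrite {}lE in hl.
have h : h^-1 *: (phi (h *: ((0, 1) : R * R) + p) - phi p) @[h --> (0 : R)^'] --> f p.1 * g' p.2.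
  have -> : (fun h : R => h^-1 *: (phi (h *: ((0, 1) : R * R) + p) - phi p)) =
      (fun h => f p.1 * (h^-1 *: (g (h *: (1 : R) + p.2) - g p.2))).
    apply/funext => h; rewrite /phi /= scaler0 add0r.
    by rewrite -scalerAr; congr (_ *: _); rewrite mulrBr.
  by apply: cvgM => //; exact: cvg_cst.
apply: DeriveDef; first by apply/cvg_ex; exists (f p.1 * g' p.2).
by apply/cvg_lim.
Qed.

Lemma test_function_prod : test_function phi.
Proof.
have cM (a b : R -> R) : continuous a -> continuous b -> continuous (fun p : R * R => a p.1 * b p.2).
  move=> ca cb p; apply: cvgM.
    by apply: (cvg_comp fst a); [exact: cvg_fst|exact: ca].
  by apply: (cvg_comp snd b); [exact: cvg_snd|exact: cb].
split.
- by move=> p; rewrite /phi mulr_ge0 ?(C1c_ge0 hf) ?(C1c_ge0 hg).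
- by move=> p; have [] := is_derive_prod_t p.
- by move=> p; have [] := is_derive_prod_x p.
- have -> : 'D_((1, 0) : R * R) phi = (fun p => f' p.1 * g p.2).
    by apply/funext => p; exact: (@derive_val _ _ _ _ _ _ _ (is_derive_prod_t p)).
  by apply: cM; [exact: C1c_continuous hf|exact: C1c_continuousf hg].
- have -> : 'D_((0, 1) : R * R) phi = (fun p => f p.1 * g' p.2).
    by apply/funext => p; exact: (@derive_val _ _ _ _ _ _ _ (is_derive_prod_x p)).
  by apply: cM; [exact: C1c_continuousf hf|exact: C1c_continuous hg].
- have cAA : compact (`[-A, A]%classic `*` `[-A, A]%classic : set (R * R)).
    by apply: compact_setX; exact: segment_compact.
  apply: (subclosed_compact _ cAA); first exact: closed_closure.
  have /closure_id -> : closed (`[-A, A]%classic `*` `[-A, A]%classic : set (R * R)).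
    exact: (compact_closed (@norm_hausdorff _ _) cAA).
  apply: closure_subset => -[x y] /=; rewrite /phi /= mulf_eq0 negb_or => /andP[fx gy].
  split; rewrite /= in_itv/= -ler_norml leNgt; apply/negP => /ltW.
    by move=> /(C1c_support hf)[fx0 _]; rewrite fx0 eqxx in fx.
  by move=> /(C1c_support hg)[fx0 _]; rewrite fx0 eqxx in gy.
Qed.

End Product.
End Kernels.

Section Plane.
Context {R : realType}.
Local Notation mu := (@lebesgue_measure R).

(* A constant of its own, because HB resolves the sigma-finiteness of a product
   of measures through probability measures only. *)
Definition plane := (mu \x mu)%E.

HB.instance Definition _ := Measure.on plane.

Lemma sigma_finite_plane : sigma_finite setT plane.
Proof.
exists (fun n => `[-n%:R, n%:R]%classic `*` `[-n%:R, n%:R]%classic).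
  apply/esym; rewrite -subTset => -[x y] _ /=.
  exists (Num.bound (`|x| + `|y|)) => //=.
  have h : `|x| + `|y| < (Num.bound (`|x| + `|y|))%:R by rewrite archi_boundP// addr_ge0.
  rewrite !in_itv/= -!ler_norml; split; apply: ltW; apply: le_lt_trans h.
    by rewrite lerDl.
  by rewrite lerDr.
move=> n; split; first by apply: measurableX; exact: measurable_itv.
have fin : (mu [set` `[- (n%:R : R), n%:R]%R] < +oo)%E.
  by rewrite lebesgue_measure_itv/=; case: ifP => _; rewrite ?ltry// -EFinB ltry.
by rewrite /plane product_measure1E ?lte_mul_pinfty// ge0_fin_numE.
Qed.

HB.instance Definition _ := Measure_isSigmaFinite.Build _ _ _ plane sigma_finite_plane.

End Plane.

(** * The exchange terms *)

Section Sources.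
Context {R : realType}.
Variables (M : nat) (L lip : R) (S : nat -> R -> R -> R).
Hypotheses (hL : 0 < L) (hS0 : hypS0 M L lip S) (hS1 : hypS1 M L S).

(** The hypotheses speak of densities in [[0, L]] only; composition with this projection gives
    functions that are Lipschitz on the whole line. *)
Definition clip (x : R) : R := Num.max 0 (Num.min x L).

Lemma clip_itv x : clip x \in `[0, L].
Proof. by rewrite in_itv/= /clip le_max lexx/= ge_max ltW//= ge_min lexx orbT. Qed.

Lemma clipE x : x \in `[0, L] -> clip x = x.
Proof.
by rewrite in_itv/= /clip => /andP[x0 xL]; rewrite (min_idPl xL) (max_idPr x0).
Qed.

Lemma clip_lip x y : `|clip x - clip y| <= `|x - y|.
Proof.
wlog xy : x y / x <= y.
  by case: (leP x y) => xy h; [|rewrite distrC (distrC x)]; apply: h => //; exact: ltW.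
have c : clip x <= clip y by rewrite /clip /Num.max /Num.min; repeat case: ifPn; lra.
rewrite distrC (distrC x) !ger0_norm ?subr_ge0//.
by move: hL; rewrite /clip /Num.max /Num.min; repeat case: ifPn; lra.
Qed.

Lemma S_mono1 j a a' b : (1 <= j < M)%N -> a \in `[0, L] -> a' \in `[0, L] ->
  b \in `[0, L] -> a <= a' -> S j a b <= S j a' b.
Proof.
move=> jM ha ha' hb; rewrite le_eqVlt => /predU1P[->//|aa'].
rewrite -{1}(clipE ha) -(clipE ha').
apply: (@nondecreasing_of_derive_ge0_lipschitz _ (fun x => S j (clip x) b) `|lip| a a') => //.
  move=> x y.
  have /andP[cx _] := clip_itv x; have /andP[cy _] := clip_itv y.
  have /andP[b0 _] := hb.
  rewrite (le_trans (hypS0_lipschitz hS0 jM _ _ _ _))//.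
  rewrite subrr normr0 addr0; apply: (@le_trans _ _ (`|lip| * `|clip x - clip y|)).
    by rewrite ler_wpM2r// ler_norm.
  by rewrite ler_wpM2l// clip_lip.
move=> x; rewrite in_itv/= => /andP[ax xa'].
have xL : x \in `[0, L].
  move: ha ha'; rewrite !in_itv/= => /andP[? ?] /andP[? ?]; lra.
(* Near an interior point the projection is the identity, so the derivative there is the partial
   derivative of [S j]. *)
have nE : \near x, S j (clip x) b = S j x b.
  near=> y; rewrite clipE//.
  have ay : a < y by near: y; exact: lt_nbhsr.
  have ya' : y < a' by near: y; exact: lt_nbhsl.
  move: ha ha'; rewrite !in_itv/= => /andP[? ?] /andP[? ?]; lra.
move=> d1; rewrite derive1E (near_eq_derive _ nE) -derive1E.
apply: (hypS0_d1 hS0 jM xL hb).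
exact: near_eq_derivable nE d1.
Unshelve. all: by end_near. Qed.

Lemma S_mono2 j a b b' : (1 <= j < M)%N -> a \in `[0, L] -> b \in `[0, L] ->
  b' \in `[0, L] -> b <= b' -> S j a b' <= S j a b.
Proof.
move=> jM ha hb hb'; rewrite le_eqVlt => /predU1P[->//|bb'].
rewrite -{1}(clipE hb') -(clipE hb) -lerN2.
apply: (@nondecreasing_of_derive_ge0_lipschitz _ (fun x => - S j a (clip x)) `|lip| b b') => //.
  move=> x y.
  have /andP[cx _] := clip_itv x; have /andP[cy _] := clip_itv y.
  have /andP[a0 _] := ha.
  rewrite -opprD normrN (le_trans (hypS0_lipschitz hS0 jM _ _ _ _))//.
  rewrite subrr normr0 add0r; apply: (@le_trans _ _ (`|lip| * `|clip x - clip y|)).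
    by rewrite ler_wpM2r// ler_norm.
  by rewrite ler_wpM2l// clip_lip.
move=> x; rewrite in_itv/= => /andP[bx xb'].
have xL : x \in `[0, L].
  move: hb hb'; rewrite !in_itv/= => /andP[? ?] /andP[? ?]; lra.
have nE : \near x, - S j a (clip x) = - S j a x.
  near=> y; rewrite clipE//.
  have ay : b < y by near: y; exact: lt_nbhsr.
  have ya' : y < b' by near: y; exact: lt_nbhsl.
  move: hb hb'; rewrite !in_itv/= => /andP[? ?] /andP[? ?]; lra.
move=> d1; rewrite derive1E (near_eq_derive _ nE) -derive1E.
have d2 : derivable (fun x => - S j a x) x 1 by exact: near_eq_derivable nE d1.
have d3 : derivable (S j a) x 1.
  have -> : S j a = (fun x => - - S j a x) by apply/funext => z; rewrite opprK.
  exact: derivableN d2.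
rewrite derive1E deriveN// oppr_ge0 -derive1E.
exact: (hypS0_d2 hS0 jM ha xL).
Unshelve. all: by end_near. Qed.

(** By monotonicity [S j a 0 >= S j 0 0 = 0] and [S j a L <= S j L L = 0], so [S j a] has a zero in
    [[0, L]], and (S1) identifies that zero as [a]. *)
Lemma S_diag j a : (1 <= j < M)%N -> a \in `[0, L] -> S j a a = 0.
Proof.
move=> jM ha.
have h0 : (0 : R) \in `[0, L] by rewrite in_itv/= lexx ltW.
have hLL : L \in `[0, L] by rewrite in_itv/= lexx ltW.
have /andP[a0 aL] := ha; move: a0 aL; rewrite !bnd_simp => a0 aL.
have Sa0 : 0 <= S j a 0 by rewrite -[X in X <= _](hypS0_00 hS0 jM) S_mono1.
have SaL : S j a L <= 0 by rewrite -[X in _ <= X](hypS0_LL hS0 jM) S_mono1.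
have cS : {within `[0, L], continuous (fun b => S j a (clip b))}.
  apply: continuous_subspaceT => x; apply/cvgrPdist_le => /= e e0; near=> y.
  have /andP[cx _] := clip_itv x; have /andP[cy _] := clip_itv y.
  rewrite (le_trans (hypS0_lipschitz hS0 jM _ _ _ _))//.
  rewrite subrr normr0 add0r; apply: (@le_trans _ _ ((`|lip| + 1) * `|x - y|)).
    apply: (@le_trans _ _ (`|lip| * `|clip x - clip y|)).
      by rewrite ler_wpM2r// ler_norm.
    by rewrite ler_pM// ?clip_lip// lerDl.
  rewrite -ler_pdivlMl ?ltr_wpDl//.
  near: y; exists ((`|lip| + 1)^-1 * e).
    by rewrite /= mulr_gt0 ?invr_gt0 ?ltr_wpDl.
  by move=> y /= /ltW.
have [] := @IVT R (fun b => S j a (clip b)) 0 L 0 (ltW hL) cS.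
  by rewrite !clipE// ge_min SaL orbT le_max Sa0.
by move=> c cL; rewrite clipE// => Sac; rewrite {2}(hS1 jM ha cL Sac).
Unshelve. all: by end_near. Qed.

Lemma S_gt0 j a b : (1 <= j < M)%N -> a \in `[0, L] -> b \in `[0, L] ->
  b < a -> 0 < S j a b.
Proof.
move=> jM ha hb ba; rewrite lt_neqAle -[X in _ && (X <= _)](S_diag jM hb) S_mono1 ?(ltW ba)// andbT.
by apply/negP => /eqP/esym/(hS1 jM ha hb) E; rewrite E ltxx in ba.
Qed.

Lemma S_lt0 j a b : (1 <= j < M)%N -> a \in `[0, L] -> b \in `[0, L] ->
  a < b -> S j a b < 0.
Proof.
move=> jM ha hb ab; rewrite lt_neqAle -[X in _ && (_ <= X)](S_diag jM hb) S_mono1 ?(ltW ab)// andbT.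
by apply/negP => /eqP/(hS1 jM ha hb) E; rewrite E ltxx in ab.
Qed.

Lemma exchange_diag j a : a \in `[0, L] -> exchange M S j a a = 0.
Proof. by move=> ha; rewrite /exchange; case: ifPn => // jM; rewrite S_diag. Qed.

Lemma exchange0 a b : exchange M S 0 a b = 0. Proof. by []. Qed.

Lemma exchangeM a b : exchange M S M a b = 0.
Proof. by rewrite /exchange ltnn andbF. Qed.

Lemma exchange_le j a b : (1 <= j < M)%N -> a \in `[0, L] -> b \in `[0, L] ->
  `|exchange M S j a b| <= `|lip| * (a + b).
Proof.
move=> jM; rewrite !in_itv/= => /andP[a0 _] /andP[b0 _]; rewrite /exchange jM.
rewrite -[S j a b]subr0 -[X in _ - X](hypS0_00 hS0 jM).
rewrite (le_trans (hypS0_lipschitz hS0 jM _ _ _ _))// !subr0 (ger0_norm a0) (ger0_norm b0).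
by rewrite ler_wpM2r ?addr_ge0// ler_norm.
Qed.

Definition rhs (a : nat -> R) (j : nat) : R :=
  exchange M S j.-1 (a j.-1) (a j) - exchange M S j (a j) (a j.+1).

(** Summation by parts; the convention on [S_0] and [S_M] is what removes the boundary terms in the
    applications. *)
Lemma abel (s d : nat -> R) : (0 < M)%N -> d 0%N = 0 -> d M = 0 ->
  \sum_(1 <= j < M.+1) s j * (d j.-1 - d j) =
  \sum_(1 <= j < M) (s j.+1 - s j) * d j.
Proof.
move=> M0 d0 dM.
under eq_bigr do rewrite mulrBr.
under [RHS]eq_bigr do rewrite mulrBl.
rewrite !sumrB; congr (_ - _).
  rewrite big_add1/= big_ltn// d0 mulr0 add0r.
  by [].
by rewrite big_nat_recr//= dM mulr0 addr0.
Qed.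

(** After summation by parts, the interface between lanes [j] and [j + 1] contributes a difference
    of signs times a difference of exchanges. If the two signs differ, the monotonicity of [S j] in
    each variable gives the second factor the opposite sign. *)
Lemma rhs_dissip (a b : nat -> R) : (0 < M)%N ->
  (forall j, (1 <= j <= M)%N -> a j \in `[0, L]) ->
  (forall j, (1 <= j <= M)%N -> b j \in `[0, L]) ->
  \sum_(1 <= j < M.+1) Num.sg (a j - b j) * (rhs a j - rhs b j) <= 0.
Proof.
move=> M0 ha hb.
pose d j := exchange M S j (a j) (a j.+1) - exchange M S j (b j) (b j.+1).
pose s j := Num.sg (a j - b j).
have d0 : d 0%N = 0 by rewrite /d !exchange0 subrr.
have dM : d M = 0 by rewrite /d !exchangeM subrr.
rewrite (_ : \sum_(1 <= j < M.+1) _ = \sum_(1 <= j < M.+1) s j * (d j.-1 - d j)); last first.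
  rewrite [LHS]big_nat_cond [RHS]big_nat_cond; apply: eq_bigr => j.
  rewrite andbT => /andP[j1 _]; rewrite /rhs /d /s prednK//.
  by congr (_ * _); ring.
rewrite abel// -oppr_ge0 -sumrN big_nat_cond; apply: sumr_ge0 => j.
rewrite andbT => jM; have /andP[j1 jM'] := jM.
have haj : a j \in `[0, L] by apply: ha; rewrite j1 ltnW.
have hbj : b j \in `[0, L] by apply: hb; rewrite j1 ltnW.
have haj1 : a j.+1 \in `[0, L] by exact: ha.
have hbj1 : b j.+1 \in `[0, L] by exact: hb.
rewrite oppr_ge0 /s /d /exchange jM.
have up : a j <= b j -> b j.+1 <= a j.+1 ->
    S j (a j) (a j.+1) - S j (b j) (b j.+1) <= 0.
  move=> h1 h2; rewrite subr_le0 (le_trans (S_mono1 jM haj hbj haj1 h1))//.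
  exact: S_mono2.
have dn : b j <= a j -> a j.+1 <= b j.+1 ->
    0 <= S j (a j) (a j.+1) - S j (b j) (b j.+1).
  move=> h1 h2; rewrite subr_ge0 (le_trans (S_mono1 jM hbj haj hbj1 h1))//.
  exact: S_mono2.
move: up dn; move: (S j _ _ - _) => D up dn.
case: (sgrP (a j - b j)) => h1; case: (sgrP (a j.+1 - b j.+1)) => h2;
  rewrite ?subrr ?mul0r//;
  (have D0 : D <= 0 by apply: up; lra) || (have D0 : 0 <= D by apply: dn; lra); lra.
Qed.

(** Against a common constant the dissipation is an exact sum of one sign: [S j a b] has the sign of
    [a - b], and [Num.sg (x - k)] is monotone in [x]. *)
Lemma rhs_relax (a : nat -> R) (k : R) : (0 < M)%N -> k \in `[0, L] ->
  (forall j, (1 <= j <= M)%N -> a j \in `[0, L]) ->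
  \sum_(1 <= j < M.+1) Num.sg (a j - k) * rhs a j =
  - \sum_(1 <= j < M) `|S j (a j) (a j.+1)| *
      `|Num.sg (a j - k) - Num.sg (a j.+1 - k)|.
Proof.
move=> M0 hk ha.
pose d j := exchange M S j (a j) (a j.+1).
pose s j := Num.sg (a j - k).
have d0 : d 0%N = 0 by rewrite /d !exchange0.
have dM : d M = 0 by rewrite /d !exchangeM.
rewrite (_ : \sum_(1 <= j < M.+1) _ = \sum_(1 <= j < M.+1) s j * (d j.-1 - d j)); last first.
  rewrite [LHS]big_nat_cond [RHS]big_nat_cond; apply: eq_bigr => j.
  by rewrite andbT => /andP[j1 _]; rewrite /rhs /d /s prednK.
rewrite abel// -sumrN [LHS]big_nat_cond [RHS]big_nat_cond; apply: eq_bigr => j.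
rewrite andbT => jM; have /andP[j1 jM'] := jM.
have haj : a j \in `[0, L] by apply: ha; rewrite j1 ltnW.
have haj1 : a j.+1 \in `[0, L] by exact: ha.
rewrite /s /d /exchange jM.
have hsg (x y : R) : x <= y -> Num.sg (x - k) <= Num.sg (y - k).
  move=> xy; case: (sgrP (x - k)) => ?; case: (sgrP (y - k)) => ?; lra.
have [h|h|h] := ltgtP (a j) (a j.+1).
- have := S_lt0 jM haj haj1 h; have := hsg _ _ (ltW h) => h1 h2.
  by rewrite (ltr0_norm h2) ler0_norm ?subr_le0//; ring.
- have := S_gt0 jM haj haj1 h; have := hsg _ _ (ltW h) => h1 h2.
  by rewrite (gtr0_norm h2) ger0_norm ?subr_ge0//; ring.
- by rewrite h subrr normr0 mulr0 mul0r oppr0.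
Qed.

Lemma finite_lower_bound (f : nat -> R) n : (forall i, (i < n)%N -> 0 < f i) ->
  exists2 d : R, 0 < d & forall i, (i < n)%N -> d <= f i.
Proof.
elim: n => [|n IH] fp; first by exists 1.
have [d d0 hd] := IH (fun i ni => fp i (ltnW ni)).
exists (Num.min d (f n)); first by rewrite lt_min d0 fp.
move=> i; rewrite ltnS leq_eqVlt => /predU1P[->|ni]; first by rewrite ge_min lexx orbT.
by rewrite ge_min hd.
Qed.

(* If [b + e <= a], two neighbouring grid points lie between [b] and [a]: the
   signs differ at one of them, and by monotonicity [S_j a b] is at least the
   value of [S_j] at these two points, which is positive by (S1). *)
Lemma relax_pointwise (e : R) : 0 < e -> exists (n : nat) (K : R), 0 <= K /\
  (forall i, (i <= n)%N -> L / n%:R * i%:R \in `[0, L]) /\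
  forall j a b, (1 <= j < M)%N -> a \in `[0, L] -> b \in `[0, L] ->
  `|a - b| <= e + K * \sum_(0 <= i < n.+1)
     `|S j a b| * `|Num.sg (a - L / n%:R * i%:R) - Num.sg (b - L / n%:R * i%:R)|.
Proof.
move=> e0.
(* The mesh [h = L / n] then satisfies [2 * h <= e], so that a segment of length [e] contains two
   neighbouring grid points. *)
pose n := (Num.trunc (2 * L / e)).+1.
pose h : R := L / n%:R.
have n0 : 0 < n%:R :> R by rewrite ltr0n.
have h0 : 0 < h by rewrite divr_gt0.
have he : 2 * h <= e.
  have : 2 * L / e < n%:R by rewrite /n truncnS_gt.
  rewrite ltr_pdivrMr// => hn; rewrite /h mulrA ler_pdivrMr//.
  by rewrite (mulrC e) ltW.
have gridL i : (i <= n)%N -> h * i%:R \in `[0, L].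
  move=> ni; rewrite in_itv/= mulr_ge0 ?(ltW h0)//=.
  by rewrite /h mulrAC ler_pdivrMr// ler_pM2l// ler_nat.
have grid_lt i : h * i%:R < h * i.+1%:R by rewrite ltr_pM2l// ltr_nat.
have [d d0 hd] : exists2 d : R, 0 < d & forall j, (1 <= j < M)%N -> forall i, (i < n)%N ->
    d <= S j (h * i.+1%:R) (h * i%:R) /\ d <= - S j (h * i%:R) (h * i.+1%:R).
  (* The value 1 at [j = 0] is a positive filler, so that one minimum can be taken over all
     [j < M]. *)
  pose f j i := if (1 <= j)%N then
    Num.min (S j (h * i.+1%:R) (h * i%:R)) (- S j (h * i%:R) (h * i.+1%:R)) else 1.
  have fp j i : (j < M)%N -> (i < n)%N -> 0 < f j i.
    move=> jM ni; rewrite /f; case: ifPn => // j1.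
    have jM' : (1 <= j < M)%N by rewrite j1.
    have g1 := gridL i (ltnW ni); have g2 := gridL i.+1 ni.
    by rewrite lt_min oppr_gt0 S_gt0// S_lt0.
  have dj j : exists2 d : R, 0 < d & (j < M)%N -> forall i, (i < n)%N -> d <= f j i.
    have [jM|] := boolP (j < M)%N; last by exists 1.
    by have [d d0 hd] := @finite_lower_bound (f j) n (fun i => fp j i jM); exists d.
  pose dd j := xget 1 [set d : R | 0 < d /\ ((j < M)%N -> forall i, (i < n)%N -> d <= f j i)].
  have ddP j : 0 < dd j /\ ((j < M)%N -> forall i, (i < n)%N -> dd j <= f j i).
    rewrite /dd; case: xgetP => [d _ //|]; have [d d0 hd] := dj j.
    by move=> /(_ d); case.
  have [d d0 hd] := @finite_lower_bound dd M (fun j _ => (ddP j).1).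
  exists d => // j /andP[j1 jM] i ni.
  have := le_trans (hd j jM) ((ddP j).2 jM i ni).
  by rewrite /f j1 le_min => /andP[].
(* If the signs differ at a suitable grid point, that term of the sum is at least [d]; since
   [|a - b| <= L], the factor [L / d] suffices. *)
exists n, (L / d); split; first by rewrite divr_ge0 ?ltW.
split; first exact: gridL.
move=> j a b jM ha hb; rewrite -/h.
have main (x y : R) : x \in `[0, L] -> y \in `[0, L] -> y + e <= x ->
    exists i, [/\ (i < n)%N, y < h * i.+1%:R, h * i.+1%:R <= x & y <= h * i%:R].
  move=> hx hy yx; have /andP[y0 _] := hy; move: y0; rewrite bnd_simp => y0.
  have /andP[_ xL] := hx; move: xL; rewrite bnd_simp => xL.
  (* The first grid point above [y] has index [k + 1], and the next one is at most [y + 2 * h <= x].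
     The upper point separates [y] from [x], and the pair bounds [S j] from below by
     monotonicity. *)
  pose k := Num.trunc (y / h).
  have yh0 : 0 <= y / h by rewrite divr_ge0// ltW.
  have /andP[k1 k2] := truncn_itv yh0; rewrite -/k in k1 k2.
  rewrite ler_pdivlMr// in k1; rewrite ltr_pdivrMr// in k2.
  have k3 : h * k.+2%:R <= x.
    rewrite -natr1 -natr1 !mulrDr mulr1.
    by move: k1 he yx; rewrite mulrC; lra.
  exists k.+1; split.
  - have : h * k.+2%:R <= L by rewrite (le_trans k3).
    by rewrite /h mulrAC ler_pdivrMr// ler_pM2l// ler_nat.
  - by rewrite mulrC in k2; rewrite (lt_trans k2).
  - exact: k3.
  - by rewrite mulrC ltW.
have sum_ge i (F : nat -> R) : (i < n)%N -> (forall i, 0 <= F i) ->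
    F i.+1 <= \sum_(0 <= i < n.+1) F i.
  move=> ni F0; rewrite big_mkord (bigD1 (Ordinal (ni : (i.+1 < n.+1)%N)))//=.
  by rewrite lerDl sumr_ge0.
have tail (x y : R) i s : x \in `[0, L] -> y \in `[0, L] -> (i < n)%N -> y < h * i.+1%:R ->
   h * i.+1%:R <= x -> d <= s ->
   x - y <= e + L / d * (s * `|Num.sg (x - h * i.+1%:R) - Num.sg (y - h * i.+1%:R)|).
  move=> hx hy ni yi ix ds.
  have sy : Num.sg (y - h * i.+1%:R) = -1 by apply: ltr0_sg; rewrite subr_lt0.
  have sx : 0 <= Num.sg (x - h * i.+1%:R) by rewrite sgr_ge0 subr_ge0.
  have : 1 <= `|Num.sg (x - h * i.+1%:R) - Num.sg (y - h * i.+1%:R)|.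
    by rewrite sy opprK ger0_norm; lra.
  move: (`|Num.sg _ - _|) => t t1.
  have : L <= L / d * (s * t).
    rewrite mulrAC ler_pdivlMr// ler_pM2l// -[d]mulr1 ler_pM// ltW//.
  move: hx hy; rewrite !in_itv/= => /andP[? ?] /andP[? ?]; lra.
have SK i : 0 <= `|S j a b| * `|Num.sg (a - h * i%:R) - Num.sg (b - h * i%:R)|.
  by rewrite mulr_ge0.
have Ld : 0 <= L / d by rewrite divr_ge0 ?ltW.
have [ab|ab] := leP `|a - b| e.
  by rewrite (le_trans ab)// lerDl mulr_ge0// sumr_ge0.
have [ba|ba|ba] := ltgtP a b.
- have [i [ni ia ib ai]] : exists i, [/\ (i < n)%N, a < h * i.+1%:R, h * i.+1%:R <= b & a <= h * i%:R].
    apply: main => //; move: ab; rewrite ler0_norm; lra.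
  have g1 := gridL i (ltnW ni); have g2 := gridL i.+1 ni.
  have ds : d <= `|S j a b|.
    rewrite ltr0_norm ?S_lt0//.
    apply: (le_trans (hd j jM i ni).2); rewrite lerN2.
    by apply: (le_trans (S_mono1 jM ha g1 hb ai)); exact: S_mono2.
  rewrite distrC (@ger0_norm _ (b - a)) ?subr_ge0 ?(ltW ba)//.
  apply: (le_trans (tail b a i _ hb ha ni ia ib ds)).
  rewrite lerD2l ler_wpM2l// distrC.
  exact: (@sum_ge i (fun i => `|S j a b| * `|Num.sg (a - h * i%:R) - Num.sg (b - h * i%:R)|)).
- have [i [ni ia ib ai]] : exists i, [/\ (i < n)%N, b < h * i.+1%:R, h * i.+1%:R <= a & b <= h * i%:R].
    apply: main => //; move: ab; rewrite ger0_norm; lra.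
  have g1 := gridL i (ltnW ni); have g2 := gridL i.+1 ni.
  have ds : d <= `|S j a b|.
    rewrite gtr0_norm ?S_gt0//.
    apply: (le_trans (hd j jM i ni).1).
    by apply: (le_trans (S_mono1 jM g2 ha g1 ib)); exact: S_mono2.
  rewrite (@ger0_norm _ (a - b)) ?subr_ge0 ?(ltW ba)//.
  apply: (le_trans (tail a b i _ ha hb ni ia ib ds)).
  rewrite lerD2l ler_wpM2l//.
  exact: (@sum_ge i (fun i => `|S j a b| * `|Num.sg (a - h * i%:R) - Num.sg (b - h * i%:R)|)).
- by move: ab; rewrite ba subrr normr0 ltNge ltW.
Qed.

End Sources.

(** * Measurability and pointwise bounds for the flux and the exchange terms *)

Section LipschitzMeasurable.
Context d (T : measurableType d) (R : realType).

(** The value exceeds [c] exactly when, at some point with rational coordinates, the lower bound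
    given by the Lipschitz condition exceeds [c]. The superlevel set is thus a countable union of
    measurable sets. *)
Lemma measurable_lipschitz2 (Phi : R -> R -> R) (K : R) (f g : T -> R) :
  (forall a b a' b', `|Phi a b - Phi a' b'| <= K * (`|a - a'| + `|b - b'|)) ->
  measurable_fun setT f -> measurable_fun setT g ->
  measurable_fun setT (fun x => Phi (f x) (g x)).
Proof.
move=> PhiK0 mf mg.
have [k k0 PhiK] : exists2 k, 0 < k & forall a b a' b',
    `|Phi a b - Phi a' b'| <= k * (`|a - a'| + `|b - b'|).
  exists (`|K| + 1); first by rewrite ltr_wpDl.
  move=> a b a' b'; apply: (le_trans (PhiK0 a b a' b')).
  by rewrite ler_wpM2r ?addr_ge0// (le_trans (ler_norm _))// lerDl.
apply: (measurability _ (RGenOInfty.measurableE R)) => //= _ [_ [c ->] <-].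
rewrite setTI.
have -> : (fun x => Phi (f x) (g x)) @^-1` `]c, +oo[ =
    \bigcup_(qr in [set: rat * rat]) [set x |
      c < Phi (ratr qr.1) (ratr qr.2) - k * (`|f x - ratr qr.1| + `|g x - ratr qr.2|)].
  apply/seteqP; split => x /=.
    rewrite in_itv/= andbT => cP.
    (* The Lipschitz error is paid twice, once to move to the rational point and once in the lower
       bound, and each time over two coordinates; hence the 4. *)
    pose e := (Phi (f x) (g x) - c) / (4 * k).
    have e0 : 0 < e by rewrite divr_gt0 ?mulr_gt0 ?subr_gt0.
    have [q /andP[q1 q2]] : exists q : rat, f x - e < ratr q < f x + e.
      have le1 : f x - e < f x + e by lra.
      by have [q] := rat_in_itvoo le1; rewrite in_itv/=; exists q.
    have [r /andP[r1 r2]] : exists q : rat, g x - e < ratr q < g x + e.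
      have le1 : g x - e < g x + e by lra.
      by have [r] := rat_in_itvoo le1; rewrite in_itv/=; exists r.
    exists (q, r) => //=.
    have h1 : `|f x - ratr q| < e by rewrite ltr_norml; lra.
    have h2 : `|g x - ratr r| < e by rewrite ltr_norml; lra.
    have h3 := PhiK (f x) (g x) (ratr q) (ratr r).
    have h4 : k * (`|f x - ratr q| + `|g x - ratr r|) < (Phi (f x) (g x) - c) / 2.
      have -> : (Phi (f x) (g x) - c) / 2 = k * (e + e).
        by rewrite /e; field; rewrite lt0r_neq0.
      by rewrite ltr_pM2l// ltrD.
    have := ler_norm (Phi (f x) (g x) - Phi (ratr q) (ratr r)).
    lra.
  move=> [[q r] _ /=] cP; rewrite in_itv/= andbT (lt_le_trans cP)//.
  have h3 := PhiK (f x) (g x) (ratr q) (ratr r).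
  have := ler_norm (Phi (ratr q) (ratr r) - Phi (f x) (g x)); rewrite distrC in h3.
  lra.
apply: countable_bigcupT_measurable => [|[q r]] /=; first exact: countableP.
pose H x := Phi (ratr q) (ratr r) - k * (`|f x - ratr q| + `|g x - ratr r|).
have mH : measurable_fun setT H.
  apply: measurable_funB; first exact: measurable_cst.
  apply: measurable_funM; first exact: measurable_cst.
  by apply: measurable_funD; apply: measurableT_comp => //; apply: measurable_funB => //;
    exact: measurable_cst.
rewrite [X in measurable X](_ : _ = setT `&` H @^-1` `]c, +oo[); first exact: mH.
by rewrite setTI; apply/seteqP; split => x /=; rewrite in_itv/= andbT.
Qed.

Lemma measurable_sgr (f : T -> R) : measurable_fun setT f ->
  measurable_fun setT (fun x => Num.sg (f x)).
Proof.
move=> mf.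
have -> : (fun x => Num.sg (f x)) = (fun x => (0 < f x)%R%:R - (f x < 0)%R%:R).
  by apply/funext => x; case: sgrP => h; rewrite /= ?subr0 ?sub0r.
have mb (b : T -> bool) : measurable_fun setT b -> measurable_fun setT (fun x => (b x)%:R : R).
  move=> mb; have -> : (fun x => (b x)%:R : R) = (fun x => if b x then 1 else 0).
    by apply/funext => x; case: (b x).
  by apply: measurable_fun_ifT => //; exact: measurable_cst.
by apply: measurable_funB; apply: mb; apply: measurable_fun_ltr => //; exact: measurable_cst.
Qed.

End LipschitzMeasurable.

Section Flux.
Context {R : realType}.
Variables (L V : R) (v : R -> R).
Hypotheses (hL : 0 < L) (hV : hypV L V v).

Lemma V_ge0 : 0 <= V.
Proof.
have : (0 : R) \in `[0, L] by rewrite in_itv/= lexx ltW.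
by move=> /(hypV_range hV); rewrite (hypV_0 hV) in_itv/= => /andP[].
Qed.

Lemma flux_ge0 x : x \in `[0, L] -> 0 <= flux v x.
Proof.
move=> xL; have /andP[v0 _] := hypV_range hV xL; have /andP[x0 _] := xL.
by rewrite /flux mulr_ge0.
Qed.

Lemma flux_le x : x \in `[0, L] -> flux v x <= V * x.
Proof.
move=> xL; have /andP[_ v1] := hypV_range hV xL; have /andP[x0 _] := xL.
by rewrite /flux mulrC ler_wpM2r.
Qed.

Lemma flux_norm x : x \in `[0, L] -> `|flux v x| <= V * x.
Proof. by move=> xL; rewrite ger0_norm ?flux_ge0// flux_le. Qed.

Lemma flux_clip_lipschitz : exists K, forall x y,
  `|flux v (clip L x) - flux v (clip L y)| <= K * `|x - y|.
Proof.
have /pinfty_ex_gt0[k k0 /= hk] := hypV_lipschitz hV.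
exists k => x y.
apply: (@le_trans _ _ (k * `|clip L x - clip L y|)).
  by apply: (hk (clip L x, clip L y)); split; exact: clip_itv.
by rewrite ler_pM2l// clip_lip.
Qed.

Lemma measurable_flux d (T : measurableType d) (f : T -> R) :
  measurable_fun setT f -> (forall x, f x \in `[0, L]) ->
  measurable_fun setT (fun x => flux v (f x)).
Proof.
move=> mf fL; have [K hK] := flux_clip_lipschitz.
have -> : (fun x => flux v (f x)) = (fun x => flux v (clip L (f x))).
  by apply/funext => x; rewrite clipE.
apply: (@measurable_lipschitz2 _ _ _ (fun a _ => flux v (clip L a)) `|K| f f) => //.
move=> a b a' b'; rewrite (le_trans (hK a a'))//.
rewrite mulrDr ler_wpDr ?mulr_ge0// ler_wpM2r//.
exact: ler_norm.
Qed.

End Flux.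

Section ExchangeMeasurable.
Context {R : realType} d (T : measurableType d).
Variables (M : nat) (L lip : R) (S : nat -> R -> R -> R).
Hypotheses (hL : 0 < L) (hS0 : hypS0 M L lip S).

Lemma measurable_S j (f g : T -> R) : (1 <= j < M)%N ->
  measurable_fun setT f -> measurable_fun setT g ->
  (forall x, f x \in `[0, L]) -> (forall x, g x \in `[0, L]) ->
  measurable_fun setT (fun x => S j (f x) (g x)).
Proof.
move=> jM mf mg fL gL.
have -> : (fun x => S j (f x) (g x)) = (fun x => S j (clip L (f x)) (clip L (g x))).
  by apply/funext => x; rewrite !clipE.
apply: (@measurable_lipschitz2 _ _ _ (fun a b => S j (clip L a) (clip L b)) `|lip| f g) => //.
move=> a b a' b'.
have c x : 0 <= clip L x by have /andP[] := clip_itv hL x.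
rewrite (le_trans (hypS0_lipschitz hS0 jM (c _) (c _) (c _) (c _)))//.
apply: (@le_trans _ _ (`|lip| * (`|clip L a - clip L a'| + `|clip L b - clip L b'|))).
  by rewrite ler_wpM2r ?addr_ge0// ler_norm.
by rewrite ler_wpM2l// lerD// clip_lip.
Qed.

Lemma measurable_exchange j (a : nat -> T -> R) :
  (forall j, (1 <= j <= M)%N -> measurable_fun setT (a j)) ->
  (forall j, (1 <= j <= M)%N -> forall x, a j x \in `[0, L]) ->
  measurable_fun setT (fun x => exchange M S j (a j x) (a j.+1 x)).
Proof.
move=> ma aL; have [jM|jM] := boolP (1 <= j < M)%N; last first.
  have -> : (fun x => exchange M S j (a j x) (a j.+1 x)) = cst 0.
    by apply/funext => x; rewrite /exchange (negbTE jM).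
  exact: measurable_cst.
have -> : (fun x => exchange M S j (a j x) (a j.+1 x)) = (fun x => S j (a j x) (a j.+1 x)).
  by apply/funext => x; rewrite /exchange jM.
have /andP[j1 jM'] := jM.
by apply: measurable_S => //; [apply: ma|apply: ma|apply: aL|apply: aL]; rewrite ?j1 ?(ltnW jM').
Qed.

Lemma measurable_rhs j (a : nat -> T -> R) : (1 <= j <= M)%N ->
  (forall j, (1 <= j <= M)%N -> measurable_fun setT (a j)) ->
  (forall j, (1 <= j <= M)%N -> forall x, a j x \in `[0, L]) ->
  measurable_fun setT (fun x => rhs M S (fun i => a i x) j).
Proof.
move=> /andP[j1 jM] ma aL; rewrite /rhs; apply: measurable_funB.
  by have := @measurable_exchange j.-1 a ma aL; rewrite prednK.
exact: measurable_exchange.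
Qed.

(** Since [S j 0 0 = 0], the source is bounded by the total density and not merely by a constant;
    this makes it integrable in space. *)
Lemma rhs_norm (a : nat -> R) j : (1 <= j <= M)%N ->
  (forall j, (1 <= j <= M)%N -> a j \in `[0, L]) ->
  `|rhs M S a j| <= 2 * `|lip| * \sum_(1 <= i < M.+1) a i.
Proof.
move=> /andP[j1 jM] aL.
have ge0 i : (1 <= i <= M)%N -> 0 <= a i by move=> /aL; rewrite in_itv/= => /andP[].
have ex i : `|exchange M S i (a i) (a i.+1)| <= `|lip| * \sum_(1 <= i < M.+1) a i.
  have s0 : 0 <= \sum_(1 <= i < M.+1) a i.
    by rewrite big_nat_cond; apply: sumr_ge0 => k; rewrite andbT ltnS => /ge0.
  have [iM|iM] := boolP (1 <= i < M)%N; last first.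
    by rewrite /exchange (negbTE iM) normr0 mulr_ge0.
  have /andP[i1 iM'] := iM.
  apply: (le_trans (exchange_le hS0 iM _ _)); [by apply: aL; rewrite i1 ltnW|exact: aL|].
  rewrite ler_wpM2l//.
  rewrite (bigD1_seq i) ?iota_uniq//=; last by rewrite mem_index_iota i1 ltnS ltnW.
  rewrite lerD2l -big_filter (bigD1_seq i.+1) ?filter_uniq ?iota_uniq//=; last first.
    by rewrite mem_filter mem_index_iota !ltnS (gtn_eqF (ltnSn i)) iM'.
  rewrite lerDl big_seq_cond; apply: sumr_ge0 => k.
  rewrite mem_filter mem_index_iota => /andP[/and3P[_ k1 kM] _].
  by apply: ge0; rewrite k1 -ltnS.
rewrite /rhs (le_trans (ler_normB _ _))// -mulrA mulrDl mul1r lerD//.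
by have := ex j.-1; rewrite prednK.
Qed.

End ExchangeMeasurable.

Section Box.
Context {R : realType}.
Local Notation mu := (@lebesgue_measure R).
Local Notation RT := (measurableTypeR R).
Local Notation mu2 := (@plane R).

Lemma L1_box (f : RT * RT -> R) (A C : R) : measurable_fun setT f ->
  (forall p, `|f p| <= C) ->
  (forall p, A < `|p.1| \/ A < `|p.2| -> f p = 0) ->
  L1 mu2 f /\ forall t, L1 mu (fun x => f (t, x)).
Proof.
move=> mf fC fA.
have C0 : 0 <= C by rewrite (le_trans _ (fC (0, 0))).
have sl t : L1 mu (fun x => f (t, x)).
  apply: (@L1_compact_support _ _ A C) => //.
    exact: measurableT_comp mf (pair1_measurable t).
  by move=> x xA; apply: fA; right.
split => //.
have [A0|A0] := ltP A 0.
  have -> : f = (fun=> 0) by apply/funext => p; apply: fA; left; rewrite (lt_le_trans A0).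
  exact: L10.
apply: (@L1_prod _ _ _ _ _ mu mu f (fun t => (C * (A - - A)) * \1_(`[-A, A]%classic : set R) t)) => //.
  by apply: L1Z; exact: integrable_indic_itv.
move=> t; rewrite indicE mem_setE in_itv/= -ler_norml.
case: (leP `|t| A) => tA; last first.
  rewrite mulr0 -(@Int0 _ _ _ mu); apply: Int_le => //; [exact: L1_norm|exact: L10|].
  by move=> x; rewrite fA ?normr0//; left.
rewrite mulr1 -Int_itv_cst; last lra.
apply: Int_le => //; [exact: L1_norm|by apply: L1Z; exact: integrable_indic_itv|].
move=> x; rewrite indicE mem_setE in_itv/= -ler_norml.
case: (leP `|x| A) => xA; first by rewrite mulr1.
by rewrite mulr0 fA ?normr0//; right.
Qed.

(** As a weight, this indicator of nonnegative times lets the time integrals over [[0, +oo[] be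
    taken over the whole plane. *)
Definition past (t : R) : R := \1_(`[0, +oo[%classic : set R) t.

Lemma pastE t : past t = if 0 <= t then 1 else 0.
Proof. by rewrite /past indicE mem_setE in_itv/= andbT; case: ifP. Qed.

Lemma measurable_past : measurable_fun setT past.
Proof. exact: measurable_indic. Qed.

Lemma Int_half (Phi : RT * RT -> R) (H : R -> R -> R) (A C : R) :
  measurable_fun setT Phi -> (forall p, `|Phi p| <= C) ->
  (forall p, A < `|p.1| \/ A < `|p.2| -> Phi p = 0) ->
  (forall t x, 0 <= t -> H t x = Phi (t, x)) ->
  L1 mu2 (fun p => past p.1 * Phi p) /\
  \int[mu]_(t in `[0, +oo[) \int[mu]_x H t x =
  \int[mu2]_p (past p.1 * Phi p).
Proof.
move=> mP PC PA HP.
have past1 t : `|past t| <= 1.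
  by rewrite pastE; case: ifP; rewrite ?normr1 ?normr0.
have [l2 l1] : L1 mu2 (fun p => past p.1 * Phi p) /\
    forall t, L1 mu (fun x => past (t, x).1 * Phi (t, x)).
  apply: (@L1_box (fun p => past p.1 * Phi p) A C).
  - apply: measurable_funM => //.
    exact: measurableT_comp measurable_past measurable_fst.
  - by move=> p; rewrite normrM (le_trans _ (PC p))// ler_piMl.
  - by move=> p /PA ->; rewrite mulr0.
split => //.
rewrite (Int_prod l2 l1) [LHS]Rintegral_mkcond; apply: Int_eq => t.
rewrite patchE mem_setE in_itv/= andbT; case: ifPn => t0.
  by apply: Int_eq => x; rewrite HP//= pastE t0 mul1r.
rewrite -[LHS](@Int0 _ _ _ mu); apply: Int_eq => x /=.
by rewrite pastE (negbTE t0) mul0r.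
Qed.

End Box.

(** * Entropy inequalities with product test functions *)

Section Solutions.
Context {R : realType}.
Local Notation mu := (@lebesgue_measure R).
Local Notation RT := (measurableTypeR R).
Local Notation mu2 := (@plane R).
Variables (M : nat) (L V lip : R) (v : R -> R) (S : nat -> R -> R -> R) (tau : R).
Hypotheses (hM : (0 < M)%N) (hL : 0 < L) (hV : hypV L V v) (hS0 : hypS0 M L lip S)
  (hS1 : hypS1 M L S) (htau : 0 < tau).
Local Notation F := (flux v).

Record solution (u0 : nat -> R -> R) (u : nat -> R -> R -> R) : Prop := IsSolution {
  sol_system : system_entropy_solution M L F S tau u0 u ;
  sol_data_range : forall j, (1 <= j <= M)%N -> forall x, u0 j x \in `[0, L] ;
  sol_data_L1 : forall j, (1 <= j <= M)%N -> L1 mu (u0 j) }.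

(* Times before 0 are sent to 0, so that the integrals can be taken over the
   whole plane. *)
Definition ext (u : R -> R -> R) (p : RT * RT) : R := u (Num.max p.1 0) p.2.

Lemma measurable_ext (B : R) (u : R -> R -> R) : C0L1 B u -> measurable_fun setT (ext u).
Proof.
move=> hu.
pose g (p : RT * RT) : RT * RT := (Num.max p.1 0, p.2).
have mg : measurable_fun setT g.
  apply: measurable_fun_pair; last exact: measurable_snd.
  apply: measurable_maxr; last exact: measurable_cst.
  exact: measurable_fst.
have mD : measurable ([set p | 0 <= p.1] : set (RT * RT)).
  have -> : [set p : RT * RT | 0 <= p.1] = setT `&` fst @^-1` `[0, +oo[%classic.
    by rewrite setTI; apply/seteqP; split => p /=; rewrite in_itv/= andbT.
  by apply: measurable_fst.
apply: (@measurable_comp _ _ _ _ _ _ [set p : RT * RT | 0 <= p.1] (fun p => u p.1 p.2) setT g) => //.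
- by move=> _ [p _ <-] /=; rewrite le_max lexx orbT.
- exact: C0L1_measurable hu.
Qed.

Lemma ext_range (B : R) (u : R -> R -> R) p : C0L1 B u -> ext u p \in `[0, B].
Proof. by move=> hu; apply: (C0L1_range hu); rewrite le_max lexx orbT. Qed.

Lemma ext_ge0 (u : R -> R -> R) t x : 0 <= t -> ext u (t, x) = u t x.
Proof. by move=> t0; rewrite /ext /=; congr u; apply/max_idPl. Qed.

(** Kruzhkov's entropy flux. It is symmetric in its two arguments, which makes the space derivatives
    cancel in the doubling. *)
Definition kflux (a k : R) : R := Num.sg (a - k) * (F a - F k).

Definition entropy_integrand (U : nat -> RT * RT -> R) (j : nat) (k : R)
    (f f' g g' : R -> R) (p : RT * RT) : R :=
  `|U j p - k| * (f' p.1 * g p.2) + kflux (U j p) k * (f p.1 * g' p.2) +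
  Num.sg (U j p - k) * (tau^-1 * rhs M S (fun i => U i p) j) * (f p.1 * g p.2).

Lemma norm_sgr_le (x : R) : `|Num.sg x| <= 1.
Proof. by case: sgrP => _; rewrite ?normr0 ?normrN1 ?normr1. Qed.

Section OneSolution.
Variables (u0 : nat -> R -> R) (u : nat -> R -> R -> R).
Hypothesis hu : solution u0 u.
Local Notation U := (fun j => ext (u j)).

Lemma sol_C0L1 j : (1 <= j <= M)%N -> C0L1 L (u j).
Proof. by move=> /(sol_system hu)[]. Qed.

Lemma U_range j p : (1 <= j <= M)%N -> ext (u j) p \in `[0, L].
Proof. by move=> jM; exact: ext_range (sol_C0L1 jM). Qed.

Lemma measurable_U j : (1 <= j <= M)%N -> measurable_fun setT (ext (u j)).
Proof. by move=> jM; exact: measurable_ext (sol_C0L1 jM). Qed.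

Lemma measurable_rhsU j : (1 <= j <= M)%N ->
  measurable_fun setT (fun p => rhs M S (fun i => ext (u i) p) j).
Proof.
move=> jM; apply: (measurable_rhs hL hS0 jM).
- by move=> i iM; exact: measurable_U.
- by move=> i iM x; exact: U_range.
Qed.

Lemma C1c_bounded A (f f' : R -> R) : C1c A f f' -> exists2 C, 0 <= C & forall x, `|f x| <= C /\ `|f' x| <= C.
Proof.
move=> hf.
have bd (h : R -> R) : continuous h -> (forall x, A <= `|x| -> h x = 0) ->
    exists2 C, 0 <= C & forall x, `|h x| <= C.
  move=> ch h0; have [A0|A0] := ltP A 0.
    by exists 0 => // x; rewrite h0 ?normr0// (le_trans (ltW A0)).
  have AA : - A <= A by lra.
  have ch' : {within `[-A, A], continuous (fun x => `|h x|)}.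
    apply: continuous_subspaceT => x.
    by apply: (cvg_comp h (fun y : R => `|y|)); [exact: ch|exact: norm_continuous].
  have [c _ hc] := EVT_max AA ch'.
  exists `|h c| => // x; have [xA|/ltW xA] := leP `|x| A.
    by apply: hc; rewrite in_itv/= -ler_norml.
  by rewrite h0// normr0.
have [C1 C10 h1] := bd f (C1c_continuousf hf) (fun x xA => (C1c_support hf xA).1).
have [C2 C20 h2] := bd f' (C1c_continuous hf) (fun x xA => (C1c_support hf xA).2).
exists (C1 + C2); first exact: addr_ge0.
by move=> x; rewrite (le_trans (h1 x)) ?lerDl// (le_trans (h2 x))// lerDr.
Qed.

Lemma C1c_measurable A (f f' : R -> R) : C1c A f f' ->
  measurable_fun setT f /\ measurable_fun setT f'.
Proof.
move=> hf; split; apply: continuous_measurable_fun.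
- exact: C1c_continuousf hf.
- exact: C1c_continuous hf.
Qed.

Lemma C1c_out A (f f' : R -> R) x : C1c A f f' -> A < `|x| -> f x = 0 /\ f' x = 0.
Proof. by move=> hf /ltW; exact: (C1c_support hf). Qed.

Variables (A : R) (f f' g g' : R -> R) (hf : C1c A f f') (hg : C1c A g g').
Variables (j : nat) (k : R) (jM : (1 <= j <= M)%N) (kL : k \in `[0, L]).

Lemma norm_itv (a b : R) : a \in `[0, L] -> b \in `[0, L] -> `|a - b| <= L.
Proof. by rewrite !in_itv/= => /andP[? ?] /andP[? ?]; rewrite ler_norml; lra. Qed.

Lemma kflux_norm a b : a \in `[0, L] -> b \in `[0, L] -> `|kflux a b| <= V * (a + b).
Proof.
move=> ha hb; rewrite /kflux normrM.
apply: (@le_trans _ _ (1 * `|F a - F b|)); first by rewrite ler_wpM2r// norm_sgr_le.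
rewrite mul1r (le_trans (ler_normB _ _))// mulrDr; apply: lerD; exact: (flux_norm hV).
Qed.

Lemma sum_lanes_le (a : nat -> R) : (forall i, (1 <= i <= M)%N -> a i \in `[0, L]) ->
  \sum_(1 <= i < M.+1) a i <= M%:R * L.
Proof.
move=> aL; apply: (@le_trans _ _ (\sum_(1 <= i < M.+1) L)).
  rewrite big_nat_cond [leRHS]big_nat_cond; apply: ler_sum => i.
  by rewrite andbT ltnS => /aL; rewrite in_itv/= => /andP[].
by rewrite sumr_const_nat subSS subn0 mulr_natl.
Qed.

(** All integrands are bounded with compact support, so the two space-time integrals of the
    definition merge into one over the plane. Integrability is recorded alongside because it is what
    allows sums and Fubini later. *)
Lemma entropy_X :
  L1 mu2 (fun p => past p.1 * entropy_integrand U j k f f' g g' p) /\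
  0 <= \int[mu2]_p (past p.1 * entropy_integrand U j k f f' g g' p) +
       \int[mu]_x (`|u0 j x - k| * (f 0 * g x)).
Proof.
have [C C0 fC] := C1c_bounded hf; have [D D0 gD] := C1c_bounded hg.
have prodC (a b : R) : `|a| <= C -> `|b| <= D -> `|a * b| <= C * D.
  by move=> aC bD; rewrite normrM ler_pM.
pose P1 (p : RT * RT) := `|ext (u j) p - k| * (f' p.1 * g p.2) +
   kflux (ext (u j) p) k * (f p.1 * g' p.2).
pose P2 (p : RT * RT) := Num.sg (ext (u j) p - k) *
   (tau^-1 * rhs M S (fun i => ext (u i) p) j) * (f p.1 * g p.2).
have [mf mf'] := C1c_measurable hf; have [mg mg'] := C1c_measurable hg.
have m1 (h : R -> R) : measurable_fun setT h -> measurable_fun setT (fun p : RT * RT => h p.1).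
  by move=> mh; exact: measurableT_comp mh measurable_fst.
have m2 (h : R -> R) : measurable_fun setT h -> measurable_fun setT (fun p : RT * RT => h p.2).
  by move=> mh; exact: measurableT_comp mh measurable_snd.
have mUk : measurable_fun setT (fun p => ext (u j) p - k).
  by apply: measurable_funB; [exact: measurable_U|exact: measurable_cst].
have mP1 : measurable_fun setT P1.
  apply: measurable_funD.
  - apply: measurable_funM; first exact: measurableT_comp.
    by apply: measurable_funM; [exact: m1|exact: m2].
  - apply: measurable_funM.
      apply: measurable_funM; first exact: measurable_sgr.
      apply: measurable_funB; last exact: measurable_cst.
      apply: (measurable_flux hL hV); first exact: measurable_U.
      by move=> p; exact: U_range.
    by apply: measurable_funM; [exact: m1|exact: m2].
have mP2 : measurable_fun setT P2.
  apply: measurable_funM.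
    apply: measurable_funM; first exact: measurable_sgr.
    by apply: measurable_funM; [exact: measurable_cst|exact: measurable_rhsU].
  by apply: measurable_funM; [exact: m1|exact: m2].
have V0 := V_ge0 hL hV.
have [kl kL'] : 0 <= k /\ k <= L by move: kL; rewrite in_itv/= => /andP[].
have P1b p : `|P1 p| <= L * (C * D) + V * (L + L) * (C * D).
  have UL := U_range p jM; have UL' := UL.
  move: UL'; rewrite in_itv/= => /andP[U0' U1'].
  rewrite (le_trans (ler_normD _ _))// lerD// normrM ler_pM//.
  - by rewrite normr_id; exact: norm_itv.
  - by apply: prodC; [exact: (fC _).2|exact: (gD _).1].
  - rewrite (le_trans (kflux_norm UL kL))// ler_wpM2l// lerD//.
  - by apply: prodC; [exact: (fC _).1|exact: (gD _).2].
have P2b p : `|P2 p| <= (1 * (`|tau^-1| * (2 * `|lip| * (M%:R * L)))) * (C * D).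
  rewrite normrM ler_pM//; last by apply: prodC; [exact: (fC _).1|exact: (gD _).1].
  rewrite normrM ler_pM//; first exact: norm_sgr_le.
  rewrite normrM ler_wpM2l//.
  have UL i : (1 <= i <= M)%N -> ext (u i) p \in `[0, L] by exact: U_range.
  rewrite (le_trans (rhs_norm hS0 jM UL))// ler_wpM2l ?mulr_ge0//.
  exact: (@sum_lanes_le (fun i => ext (u i) p)).
have out (p : RT * RT) : A < `|p.1| \/ A < `|p.2| ->
   [/\ f' p.1 * g p.2 = 0, f p.1 * g' p.2 = 0 & f p.1 * g p.2 = 0].
  by case => h; [have [-> ->] := C1c_out hf h|have [-> ->] := C1c_out hg h]; rewrite ?mul0r ?mulr0.
have P1o p : A < `|p.1| \/ A < `|p.2| -> P1 p = 0.
  by rewrite /P1 => /out[-> -> _]; rewrite !mulr0 addr0.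
have P2o p : A < `|p.1| \/ A < `|p.2| -> P2 p = 0.
  by rewrite /P2 => /out[_ _ ->]; rewrite mulr0.
pose phi (p : R * R) := f p.1 * g p.2.
have D1E p : 'D_((1, 0) : R * R) phi p = f' p.1 * g p.2.
  exact: (@derive_val _ _ _ _ _ _ _ (is_derive_prod_t g hf p)).
have D2E p : 'D_((0, 1) : R * R) phi p = f p.1 * g' p.2.
  exact: (@derive_val _ _ _ _ _ _ _ (is_derive_prod_x f hg p)).
pose H1 t x := `|u j t x - k| * 'D_((1, 0) : R * R) phi (t, x) +
  Num.sg (u j t x - k) * (F (u j t x) - F k) * 'D_((0, 1) : R * R) phi (t, x).
pose H2 t x := Num.sg (u j t x - k) * (tau^-1 * (exchange M S j.-1 (u j.-1 t x) (u j t x) -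
        exchange M S j (u j t x) (u j.+1 t x))) * phi (t, x).
have H1E t x : 0 <= t -> H1 t x = P1 (t, x).
  by move=> t0; rewrite /H1 D1E D2E /P1 /kflux !ext_ge0.
have H2E t x : 0 <= t -> H2 t x = P2 (t, x).
  by move=> t0; rewrite /H2 /P2 /rhs !ext_ge0.
have [i1 E1] := Int_half mP1 P1b P1o H1E.
have [i2 E2] := Int_half mP2 P2b P2o H2E.
have split_int : (fun p => past p.1 * entropy_integrand U j k f f' g g' p) =
    (fun p => past p.1 * P1 p + past p.1 * P2 p).
  by apply/funext => p; rewrite -mulrDr.
rewrite split_int; split; first exact: L1D.
have := (sol_system hu jM).2 k phi (test_function_prod hf hg).
rewrite -/(H1) -/(H2).
rewrite -[X in X + _ + _]/(\int[mu]_(t in `[0, +oo[) \int[mu]_x H1 t x).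
rewrite -[X in _ + _ + X]/(\int[mu]_(t in `[0, +oo[) \int[mu]_x H2 t x).
by rewrite E1 E2 addrAC -(IntD i1 i2).
Qed.

End OneSolution.
End Solutions.

(** * Continuity in time and integrability on strips *)

Section FubiniSwap.
Context d1 d2 (T1 : measurableType d1) (T2 : measurableType d2) (R : realType).
Context (m1 : {sigma_finite_measure set T1 -> \bar R}).
Context (m2 : {sigma_finite_measure set T2 -> \bar R}).

Lemma L1_prod_swap (f : T1 * T2 -> R) (H : T2 -> R) :
  measurable_fun setT f -> L1 m2 H ->
  (forall y, L1 m1 (fun x => f (x, y))) ->
  (forall y, \int[m1]_x `|f (x, y)| <= H y) -> L1 (m1 \x m2)%E f.
Proof.
move=> mf lH sf fH; apply/(integrable21ltyP _ _ _).2; first exact/measurable_EFinP.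
have H0 y : 0 <= H y by rewrite (le_trans _ (fH y))// Int_ge0.
apply: (@le_lt_trans _ _ (\int[m2]_x (H x)%:E)%E); last first.
  by rewrite -EFin_Int// ltry.
apply: ge0_le_integral => //.
- by move=> x _; apply: integral_ge0.
- apply: (measurable_fun_fubini_tonelli_G (fun z => `|(EFin \o f) z|%E)) => //.
  by apply: measurableT_comp => //; exact/measurable_EFinP.
- by apply/measurable_EFinP; exact: L1_measurable lH.
- move=> x _; have := fH x; rewrite -lee_fin EFin_Int//.
  exact: L1_norm.
Qed.

End FubiniSwap.

Section Continuity.
Context {R : realType}.
Local Notation mu := (@lebesgue_measure R).
Variables (B : R) (u : R -> R -> R).
Hypothesis hu : C0L1 B u.

Lemma L1_ext t : L1 mu (fun x => ext u (t, x)).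
Proof.
have t0 : 0 <= Num.max t 0 by rewrite le_max lexx orbT.
exact: (C0L1_integrable hu t0).
Qed.

Lemma ext_nneg p : 0 <= ext u p.
Proof. by have := ext_range p hu; rewrite in_itv/= => /andP[]. Qed.

(** The map sending [t] to its maximum with 0 is 1-Lipschitz, so one-sided continuity at time 0
    becomes two-sided for the extension. *)
Lemma ext_continuous t e : 0 < e -> exists2 d, 0 < d & forall s, `|s - t| < d ->
  \int[mu]_x `|ext u (s, x) - ext u (t, x)| <= e.
Proof.
move=> e0; have t0 : 0 <= Num.max t 0 by rewrite le_max lexx orbT.
have /cvgrPdist_le/(_ e e0) := C0L1_continuous hu t0.
move=> [d /= d0 hd]; exists d => // s st.
have := hd (Num.max s 0); rewrite sub0r normrN ger0_norm; last exact: Int_ge0.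
apply.
  apply: le_lt_trans st; rewrite distrC.
  have h1 := ler_norm (t - s); have h2 := ler_norm (s - t); rewrite distrC in h1.
  by rewrite ler_norml; case: (lerP t 0) => h3; case: (lerP s 0) => h4; lra.
by rewrite /= in_itv/= le_max lexx orbT.
Qed.

Lemma ext_bounded A : exists2 C, 0 <= C & forall t, `|t| <= A -> \int[mu]_x ext u (t, x) <= C.
Proof.
have [A0|A0] := ltP A 0.
  by exists 0 => // t tA; move: (le_lt_trans tA A0); rewrite ltNge normr_ge0.
have AA : - A <= A by lra.
have ch : {within `[-A, A], continuous (fun t => \int[mu]_x ext u (t, x))}.
  apply: continuous_subspaceT => t; apply/cvgrPdist_le => /= e e0.
  have [d d0 hd] := ext_continuous t e0.
  exists d => //= s; rewrite /= distrC => st.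
  have l1 := L1_ext s; have l2 := L1_ext t.
  rewrite -IntB//; apply: le_trans (hd s st).
  rewrite (le_trans (Int_norm (L1B l2 l1)))//.
  by rewrite le_eqVlt; apply/orP; left; apply/eqP; apply: Int_eq => x; rewrite distrC.
have [c _ hc] := EVT_max AA ch.
exists (\int[mu]_x ext u (c, x)).
  by apply: Int_ge0 => x; exact: ext_nneg.
by move=> t tA; apply: hc; rewrite in_itv/= -ler_norml.
Qed.

End Continuity.

Section Strip.
Context {R : realType}.
Local Notation mu := (@lebesgue_measure R).
Local Notation RT := (measurableTypeR R).
Local Notation mu2 := (@plane R).
Local Notation mu4 := (mu2 \x mu2)%E.

Definition box1 (A t : R) : R := \1_(`[-A, A]%classic : set R) t.

Lemma box1E A t : box1 A t = if `|t| <= A then 1 else 0.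
Proof. by rewrite /box1 indicE mem_setE in_itv/= -ler_norml; case: ifP. Qed.

Lemma box1_ge0 A t : 0 <= box1 A t.
Proof. by rewrite box1E; case: ifP. Qed.

Lemma measurable_box1 A : measurable_fun setT (box1 A).
Proof. exact: measurable_indic. Qed.

Lemma L1_box1 A : L1 mu (box1 A).
Proof. exact: integrable_indic_itv. Qed.

Lemma Int_itv (a b : R) : a <= b -> \int[mu]_x (\1_(`[a, b]%classic : set R) x) = b - a.
Proof.
move=> ab; rewrite -[RHS]mul1r -Int_itv_cst//.
by apply: Int_eq => x; rewrite mul1r.
Qed.

Lemma L1_box1_shift A x : L1 mu (fun y => box1 A (x - y)) /\
  (0 <= A -> \int[mu]_y box1 A (x - y) = 2 * A).
Proof.
have E y : box1 A (x - y) = \1_(`[x - A, x + A]%classic : set R) y.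
  rewrite box1E indicE mem_setE in_itv/= ler_norml.
  by rewrite (_ : (- A <= x - y <= A) = (x - A <= y <= x + A)); [case: ifP|
    apply/andP/andP => -[? ?]; split; lra].
split; first by rewrite (funext E); exact: integrable_indic_itv.
move=> A0; rewrite (funext E) Int_itv; last lra.
ring.
Qed.

Lemma L1_strip (a : RT * RT -> R) A C : measurable_fun setT a ->
  (forall p, 0 <= a p) -> (forall t, L1 mu (fun x => a (t, x))) ->
  (forall t, `|t| <= A -> \int[mu]_x a (t, x) <= C) ->
  L1 mu2 (fun p => box1 A p.1 * a p).
Proof.
move=> ma a0 la aC.
apply: (@L1_prod _ _ _ _ _ mu mu _ (fun t => `|C| * box1 A t)).
- apply: measurable_funM => //.
  exact: measurableT_comp (measurable_box1 A) measurable_fst.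
- by apply: L1Z; exact: L1_box1.
- by move=> t /=; apply: L1Z.
move=> t /=; rewrite box1E; case: ifPn => tA; rewrite ?mulr1 ?mulr0.
  rewrite (le_trans _ (ler_norm _))// (le_trans _ (aC t tA))//.
  rewrite le_eqVlt; apply/orP; left; apply/eqP; apply: Int_eq => x.
  by rewrite mul1r ger0_norm.
rewrite le_eqVlt; apply/orP; left; apply/eqP.
by rewrite -[RHS](@Int0 _ _ _ mu); apply: Int_eq => x; rewrite mul0r normr0.
Qed.

(** The doubling kernel confines the times but not the positions: [x] and [y] may run to infinity
    together. For fixed [p] the admissible [q] still form a set of measure [2 * A * (2 * e)], so an
    integrable function of [p] times this indicator is integrable in both points. *)
Definition link (A e : R) (z : (RT * RT) * (RT * RT)) : R :=
  box1 A z.2.1 * box1 e (z.1.2 - z.2.2).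

Lemma L1_link A e p : L1 mu2 (fun q => link A e (p, q)) /\
  (0 <= A -> 0 <= e -> \int[mu2]_q link A e (p, q) = 2 * A * (2 * e)).
Proof.
have [l1 i1] := L1_box1_shift e p.2.
have mlink : measurable_fun setT (fun q : RT * RT => link A e (p, q)).
  apply: measurable_funM.
    exact: measurableT_comp (measurable_box1 A) measurable_fst.
  apply: measurableT_comp (measurable_box1 e) _.
  by apply: measurable_funB; [exact: measurable_cst|exact: measurable_snd].
have sl s : L1 mu (fun y => link A e (p, (s, y))) by rewrite /link /=; apply: L1Z.
have lk : L1 mu2 (fun q => link A e (p, q)).
  apply: (@L1_prod _ _ _ _ _ mu mu _ (fun s => `|\int[mu]_y box1 e (p.2 - y)| * box1 A s)) => //.
    by apply: L1Z; exact: L1_box1.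
  move=> s; rewrite mulrC.
  rewrite ger0_norm; last by apply: Int_ge0 => y; exact: box1_ge0.
  rewrite -IntZ// le_eqVlt; apply/orP; left; apply/eqP; apply: Int_eq => y.
  by rewrite ger0_norm// mulr_ge0// box1_ge0.
split=> // A0 e0; rewrite (Int_prod lk sl).
have E s : \int[mu]_y link A e (p, (s, y)) = (2 * e) * box1 A s.
  by rewrite /link /= IntZ// i1// mulrC.
rewrite (funext E) IntZ; last exact: L1_box1.
rewrite Int_itv; last lra.
ring.
Qed.

Lemma measurable_link A e : measurable_fun setT (link A e).
Proof.
apply: measurable_funM.
  apply: measurableT_comp (measurable_box1 A) _.
  exact: measurableT_comp measurable_fst measurable_snd.
apply: measurableT_comp (measurable_box1 e) _.
apply: measurable_funB; first exact: measurableT_comp measurable_snd measurable_fst.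
exact: measurableT_comp measurable_snd measurable_snd.
Qed.

Lemma link_ge0 A e z : 0 <= link A e z.
Proof. by rewrite mulr_ge0// box1_ge0. Qed.

Lemma L1_link1 A e a : 0 <= A -> 0 <= e -> L1 mu2 a -> (forall p, 0 <= a p) ->
  L1 mu4 (fun z => a z.1 * link A e z).
Proof.
move=> A0 e0 la a0.
apply: (@L1_prod _ _ _ _ _ mu2 mu2 _ (fun p => 2 * A * (2 * e) * a p)).
- apply: measurable_funM; last exact: measurable_link.
  exact: measurableT_comp (L1_measurable la) measurable_fst.
- exact: L1Z.
- by move=> p /=; apply: L1Z; exact: (L1_link A e p).1.
move=> p /=; have [l1 /(_ A0 e0) <-] := L1_link A e p.
rewrite mulrC -IntZ// le_eqVlt; apply/orP; left; apply/eqP; apply: Int_eq => q.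
by rewrite ger0_norm// mulr_ge0// link_ge0.
Qed.

Definition link' (A e : R) (z : (RT * RT) * (RT * RT)) : R :=
  box1 A z.1.1 * box1 e (z.1.2 - z.2.2).

Lemma link'E A e p q : link' A e (p, q) = link A e (q, p).
Proof. by rewrite /link' /link/= !box1E distrC. Qed.

Lemma measurable_link' A e : measurable_fun setT (link' A e).
Proof.
apply: measurable_funM.
  apply: measurableT_comp (measurable_box1 A) _.
  exact: measurableT_comp measurable_fst measurable_fst.
apply: measurableT_comp (measurable_box1 e) _.
apply: measurable_funB; first exact: measurableT_comp measurable_snd measurable_fst.
exact: measurableT_comp measurable_snd measurable_snd.
Qed.

Lemma L1_link2 A e a : 0 <= A -> 0 <= e -> L1 mu2 a -> (forall p, 0 <= a p) ->
  L1 mu4 (fun z => a z.2 * link' A e z).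
Proof.
move=> A0 e0 la a0.
have E q : (fun p => link' A e (p, q)) = (fun p => link A e (q, p)).
  by apply/funext => p; exact: link'E.
apply: (@L1_prod_swap _ _ _ _ _ mu2 mu2 _ (fun p => 2 * A * (2 * e) * a p)).
- apply: measurable_funM; last exact: measurable_link'.
  exact: measurableT_comp (L1_measurable la) measurable_snd.
- exact: L1Z.
- by move=> p /=; apply: L1Z; rewrite E; exact: (L1_link A e p).1.
move=> p /=; have [l1 /(_ A0 e0) <-] := L1_link A e p.
rewrite mulrC -IntZ// le_eqVlt; apply/orP; left; apply/eqP; apply: Int_eq => q.
by rewrite ger0_norm link'E// mulr_ge0// link_ge0.
Qed.

End Strip.

Lemma measurable_bigsum d (T : measurableType d) (R : realType) I (s : seq I)
    (P : pred I) (f : I -> T -> R) :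
  (forall i, P i -> measurable_fun setT (f i)) ->
  measurable_fun setT (fun x => \sum_(i <- s | P i) f i x).
Proof.
move=> mf; elim: s => [|i s IH].
  by rewrite (_ : (fun _ => _) = cst 0)//; apply/funext => x; rewrite big_nil.
have [Pi|Pi] := boolP (P i).
  rewrite (_ : (fun _ => _) = (fun x => f i x + \sum_(i <- s | P i) f i x)).
    by apply: measurable_funD => //; exact: mf.
  by apply/funext => x; rewrite big_cons Pi.
rewrite (_ : (fun _ => _) = (fun x => \sum_(i <- s | P i) f i x))//.
by apply/funext => x; rewrite big_cons (negbTE Pi).
Qed.

(** The repeated range condition hands the hypothesis on the index to lemmas about conditional big
    operators. *)
Lemma sum_lanes_cond (R : realType) (M : nat) (f : nat -> R) :
  \sum_(1 <= j < M.+1) f j = \sum_(1 <= j < M.+1 | (1 <= j <= M)%N) f j.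
Proof.
rewrite [LHS]big_nat_cond [RHS]big_nat_cond; apply: eq_bigl => j.
by rewrite andbT ltnS andbb.
Qed.

(** * Doubling of variables *)

Lemma measurable_entropy_terms d (T : measurableType d) (R : realType) (c : R)
    (a b q r f f' g g' : T -> R) :
  measurable_fun setT a -> measurable_fun setT b -> measurable_fun setT q ->
  measurable_fun setT r -> measurable_fun setT f -> measurable_fun setT f' ->
  measurable_fun setT g -> measurable_fun setT g' ->
  measurable_fun setT (fun z => `|a z - b z| * (f' z * g z) + q z * (f z * g' z) +
    Num.sg (a z - b z) * (c * r z) * (f z * g z)).
Proof.
move=> ma mb mq mr mf mf' mg mg'.
have mab : measurable_fun setT (fun z => a z - b z) by exact: measurable_funB ma mb.
apply: measurable_funD; first apply: measurable_funD.
- apply: (measurable_funM _ (measurable_funM mf' mg)).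
  exact: (measurableT_comp (@normr_measurable R setT) mab).
- exact: (measurable_funM mq (measurable_funM mf mg')).
- apply: (measurable_funM _ (measurable_funM mf mg)).
  apply: (measurable_funM (measurable_sgr mab)).
  exact: (measurable_funM (@measurable_cst _ _ _ _ setT c) mr).
Qed.

Section Doubling.
Context {R : realType}.
Local Notation mu := (@lebesgue_measure R).
Local Notation RT := (measurableTypeR R).
Local Notation mu2 := (@plane R).
Local Notation mu4 := (mu2 \x mu2)%E.
Variables (M : nat) (L V lip : R) (v : R -> R) (S : nat -> R -> R -> R) (tau : R).
Hypotheses (hM : (0 < M)%N) (hL : 0 < L) (hV : hypV L V v) (hS0 : hypS0 M L lip S)
  (hS1 : hypS1 M L S) (htau : 0 < tau).
Local Notation F := (flux v).
Local Notation sol := (solution M L v S tau).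
Local Notation EI := (entropy_integrand M v S tau).

Lemma dbumpN (e z : R) : dbump e (- z) = - dbump e z.
Proof. by rewrite /dbump (mulNr z) sqrrN mulrN !mulNr. Qed.

Lemma C1cZ A c (f f' : R -> R) : 0 <= c -> C1c A f f' ->
  C1c A (fun x => c * f x) (fun x => c * f' x).
Proof.
move=> c0 hf; split.
- by move=> x; rewrite mulr_ge0// (C1c_ge0 hf).
- move=> x; have df := C1c_derive hf x.
  by apply: is_derive_eq; rewrite /GRing.scale/=; ring.
- by move=> x; apply: cvgM; [exact: cvg_cst|exact: (C1c_continuous hf)].
- by move=> x /(C1c_support hf)[-> ->]; rewrite !mulr0.
Qed.

Definition total (U : nat -> RT * RT -> R) (p : RT * RT) : R := \sum_(1 <= j < M.+1) U j p.

Lemma total_ge (U : nat -> RT * RT -> R) p j : (forall j, (1 <= j <= M)%N -> 0 <= U j p) ->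
  (1 <= j <= M)%N -> U j p <= total U p.
Proof.
move=> U0 /andP[j1 jM]; rewrite /total (bigD1_seq j) ?iota_uniq//=; last first.
  by rewrite mem_index_iota j1 ltnS.
rewrite lerDl big_seq_cond; apply: sumr_ge0 => k; rewrite mem_index_iota ltnS => /andP[kM _].
exact: U0.
Qed.

(** The summands [1], [V] and [tau^-1 * (2 * |lip|)] belong to the three terms of the integrand. All
    are linear in the densities, with no additive constant, hence dominated by integrable functions
    on strips. *)
Lemma entropy_integrand_bound (U : nat -> RT * RT -> R) j k (f f' g g' : R -> R) p K :
  (forall j, (1 <= j <= M)%N -> U j p \in `[0, L]) -> (1 <= j <= M)%N -> k \in `[0, L] ->
  `|f' p.1 * g p.2| <= K -> `|f p.1 * g' p.2| <= K -> `|f p.1 * g p.2| <= K ->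
  `|EI U j k f f' g g' p| <=
   (1 + V + tau^-1 * (2 * `|lip|)) * (total U p + k) * K.
Proof.
move=> UL jM kL h1 h2 h3.
have U0 i : (1 <= i <= M)%N -> 0 <= U i p by move=> /UL; rewrite in_itv/= => /andP[].
have k0 : 0 <= k by move: kL; rewrite in_itv/= => /andP[].
have V0 := V_ge0 hL hV.
have K0 : 0 <= K by rewrite (le_trans _ h1).
have Ut := total_ge U0 jM.
have t0 : 0 <= total U p by rewrite (le_trans (U0 j jM)).
rewrite /entropy_integrand.
have -> : (1 + V + tau^-1 * (2 * `|lip|)) * (total U p + k) * K =
  (total U p + k) * K + V * (total U p + k) * K +
  tau^-1 * (2 * `|lip| * (total U p + k)) * K by ring.
rewrite (le_trans (ler_normD _ _))// lerD//.
  rewrite (le_trans (ler_normD _ _))// lerD// normrM ler_pM//.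
    by rewrite normr_id (le_trans (ler_normB _ _))// lerD// ger0_norm// U0.
  rewrite (le_trans (kflux_norm hV (UL j jM) kL))// ler_wpM2l// lerD2r//.
rewrite normrM ler_pM// normrM -[leRHS]mul1r ler_pM// ?norm_sgr_le//.
rewrite normrM gtr0_norm ?invr_gt0// ler_pM2l ?invr_gt0//.
rewrite (le_trans (rhs_norm hS0 jM UL))// ler_wpM2l ?mulr_ge0//.
by rewrite lerDl.
Qed.

Section TwoSolutions.
Variables (u0 w0 : nat -> R -> R) (u w : nat -> R -> R -> R).
Hypotheses (hu : sol u0 u) (hw : sol w0 w).
Local Notation U := (fun j => ext (u j)).
Local Notation W := (fun j => ext (w j)).
Variables (e h t1 t2 : R).
Hypotheses (e0 : 0 < e) (h0 : 0 < h) (ht1 : h + h <= t1) (t12 : t1 <= t2).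
Local Notation theta := (window h t1 t2).
Local Notation theta' := (dwindow h t1 t2).
Local Notation T := (t2 + h + h).

Lemma theta_support (t : R) : (t <= t1 - h) || (t2 + h <= t) -> theta t = 0 /\ theta' t = 0.
Proof.
move=> ht; rewrite /window /dwindow.
have h0' := h0; have t12' := t12; case/orP: ht => ht.
  have h1 : t - t1 <= - h by lra.
  have h2 : t - t2 <= - h by lra.
  rewrite !prim0//.
  by rewrite !(bump_supp h0 _).1 ?subrr// ler0_norm//; lra.
have h1 : h <= t - t1 by lra.
have h2 : h <= t - t2 by lra.
rewrite !prim_mass//.
by rewrite !(bump_supp h0 _).1 ?subrr// ger0_norm//; lra.
Qed.

(** The window forces [t1 - h < t < t2 + h] and the bump forces [|t - s| < h]. As [t1 >= 2 * h],
    both times stay positive on the support, so no initial term appears in the doubling. *)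
Lemma kernel_support (t s : R) : t < h \/ s < 0 \/ T < `|t| \/ T < `|s| ->
  [/\ theta t * bump h (t - s) = 0, theta' t * bump h (t - s) = 0 &
      theta t * dbump h (t - s) = 0].
Proof.
move=> ts.
have h0' := h0; have t12' := t12; have ht1' := ht1.
have [/theta_support[-> ->]|] := boolP ((t <= t1 - h) || (t2 + h <= t)).
  by rewrite !mul0r.
rewrite negb_or -!ltNge => /andP[ta tb].
have [/(bump_supp h0)[-> ->]|/ltr_normlP[h1 h2]] := leP h `|t - s|; first by rewrite !mulr0.
case: ts => [|[|[|]]]; [lra|lra| |]; rewrite ger0_norm; lra.
Qed.

(** At [z.1] the constants are the values of [w] at [z.2]; in [PhiW] the roles are exchanged. The
    window depends on [t] alone, so it is a constant factor in [PhiW] and its derivative survives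
    only here. *)
Definition PhiU (z : (RT * RT) * (RT * RT)) : R :=
  \sum_(1 <= j < M.+1) past z.1.1 * EI U j (ext (w j) z.2)
    (fun t => theta t * bump h (t - z.2.1))
    (fun t => theta' t * bump h (t - z.2.1) + theta t * dbump h (t - z.2.1))
    (fun x => bump e (x - z.2.2)) (fun x => dbump e (x - z.2.2)) z.1.

Definition PhiW (z : (RT * RT) * (RT * RT)) : R :=
  \sum_(1 <= j < M.+1) past z.2.1 * EI W j (ext (u j) z.1)
    (fun s => theta z.1.1 * bump h (s - z.1.1))
    (fun s => theta z.1.1 * dbump h (s - z.1.1))
    (fun y => bump e (y - z.1.2)) (fun y => dbump e (y - z.1.2)) z.2.

Definition Psi (z : (RT * RT) * (RT * RT)) : R :=
  \sum_(1 <= j < M.+1) `|ext (u j) z.1 - ext (w j) z.2| *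
    (theta' z.1.1 * bump h (z.1.1 - z.2.1) * bump e (z.1.2 - z.2.2)).

(** The derivatives of the bumps are odd in [t - s] and [x - y] while [kflux] and the distance are
    symmetric, so these terms cancel. The two sources combine into the expression of [rhs_dissip],
    and only the derivative of the window is left. *)
Lemma Phi_le_Psi z : PhiU z + PhiW z <= Psi z.
Proof.
case: z => -[t x] [s y]; rewrite /PhiU /PhiW /Psi /=.
set b := bump h (t - s); set g := bump e (x - y).
have bN : bump h (s - t) = b by rewrite -bumpN opprB.
have gN : bump e (y - x) = g by rewrite -bumpN opprB.
have b'N : dbump h (s - t) = - dbump h (t - s) by rewrite -dbumpN opprB.
have g'N : dbump e (y - x) = - dbump e (x - y) by rewrite -dbumpN opprB.
rewrite -big_split/=.
pose a j := ext (u j) (t, x); pose c j := ext (w j) (s, y).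
rewrite [leLHS](_ : _ = \sum_(1 <= j < M.+1) (`|a j - c j| * (theta' t * b * g)) +
   tau^-1 * (theta t * b * g) *
   \sum_(1 <= j < M.+1) Num.sg (a j - c j) * (rhs M S a j - rhs M S c j)); last first.
  rewrite mulr_sumr -big_split/=; apply: eq_bigr => j _.
  rewrite /entropy_integrand /= -/(a j) -/(c j) -/b bN gN b'N g'N.
  rewrite (distrC (c j)) /kflux -[c j - a j]opprB -[F (c j) - _]opprB sgrN.
  (* When both times are nonnegative the factors [past] are 1; otherwise every term contains a
     vanishing kernel. *)
  have [st|] := boolP ((0 <= t) && (0 <= s)).
    have /andP[t0 s0] := st; rewrite !pastE t0 s0 /= -/a -/c -/g; ring.
  rewrite negb_and -!ltNge => st.
  have h0' := h0; have [|E1 E2 E3] := @kernel_support t s; first by case/orP: st => st; [left; lra|right; left].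
  rewrite -/b in E1 E2; rewrite E1 E2 mulrDl !mulrN E3.
  by rewrite !(mul0r, mulr0, oppr0, addr0).
rewrite gerDl mulr_ge0_le0//.
  rewrite mulr_ge0 ?invr_ge0 ?(ltW htau)// mulr_ge0 ?bump_ge0// mulr_ge0 ?bump_ge0//.
  by rewrite subr_ge0 prim_homo// lerD2l lerN2.
apply: (rhs_dissip hL hS0 hM) => j jM.
- exact: (ext_range _ (sol_C0L1 hu jM)).
- exact: (ext_range _ (sol_C0L1 hw jM)).
Qed.

(** One link for each solution, since a density integrable in its own point must be integrated over
    the other point. *)
Definition dominant (z : (RT * RT) * (RT * RT)) : R :=
  (box1 T z.1.1 * total U z.1) * link T e z + (box1 T z.2.1 * total W z.2) * link' T e z.

Lemma total_ge0 (u1 : nat -> R -> R -> R) (u10 : nat -> R -> R) p :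
  sol u10 u1 -> 0 <= total (fun j => ext (u1 j)) p.
Proof.
move=> hu1; rewrite /total big_nat_cond; apply: sumr_ge0 => j; rewrite andbT ltnS => jM.
exact: (ext_nneg (sol_C0L1 hu1 jM)).
Qed.

Lemma L1_strip_total (A : R) (u1 : nat -> R -> R -> R) (u10 : nat -> R -> R) :
  sol u10 u1 -> L1 mu2 (fun p => box1 A p.1 * total (fun j => ext (u1 j)) p).
Proof.
move=> hu1.
have lj j : (1 <= j <= M)%N -> L1 mu2 (fun p => box1 A p.1 * ext (u1 j) p).
  move=> jM; have hj := sol_C0L1 hu1 jM.
  have [C C0 hC] := ext_bounded hj A.
  apply: (L1_strip (C := C)) => //.
  - exact: measurable_ext hj.
  - by move=> p; exact: (ext_nneg hj).
  - by move=> t; exact: (L1_ext hj).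
have -> : (fun p => box1 A p.1 * total (fun j => ext (u1 j)) p) =
    (fun p => \sum_(1 <= j < M.+1 | (1 <= j <= M)%N) box1 A p.1 * ext (u1 j) p).
  by apply/funext => p; rewrite /total mulr_sumr sum_lanes_cond.
by apply: L1_sum => j jM; exact: lj.
Qed.

Lemma L1_dominant : L1 mu4 dominant.
Proof.
have T0 : 0 <= T by move: (ht1) (h0) (t12); lra.
apply: L1D.
- apply: (@L1_link1 _ T e (fun p => box1 T p.1 * total U p) T0 (ltW e0)).
    exact: (L1_strip_total _ hu).
  by move=> p; rewrite mulr_ge0 ?box1_ge0// (total_ge0 _ hu).
- apply: (@L1_link2 _ T e (fun p => box1 T p.1 * total W p) T0 (ltW e0)).
    exact: (L1_strip_total _ hw).
  by move=> p; rewrite mulr_ge0 ?box1_ge0// (total_ge0 _ hw).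
Qed.

Lemma measurable_t_ (k : R -> R) : measurable_fun setT k ->
  measurable_fun setT (fun z : (RT * RT) * (RT * RT) => k z.1.1).
Proof.
move=> mk; apply: measurableT_comp mk _.
exact: measurableT_comp measurable_fst measurable_fst.
Qed.

Lemma measurable_s_ (k : R -> R) : measurable_fun setT k ->
  measurable_fun setT (fun z : (RT * RT) * (RT * RT) => k z.2.1).
Proof.
move=> mk; apply: measurableT_comp mk _.
exact: measurableT_comp measurable_fst measurable_snd.
Qed.

Lemma measurable_ts (k : R -> R) : measurable_fun setT k ->
  measurable_fun setT (fun z : (RT * RT) * (RT * RT) => k (z.1.1 - z.2.1)).
Proof.
move=> mk; apply: measurableT_comp mk _.
by apply: measurable_funB; [exact: (@measurable_t_ id)|exact: (@measurable_s_ id)].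
Qed.

Lemma measurable_xy (k : R -> R) : measurable_fun setT k ->
  measurable_fun setT (fun z : (RT * RT) * (RT * RT) => k (z.1.2 - z.2.2)).
Proof.
move=> mk; apply: measurableT_comp mk _.
by apply: measurable_funB; [exact: measurableT_comp measurable_snd measurable_fst|
  exact: measurableT_comp measurable_snd measurable_snd].
Qed.

Lemma measurable_U1 (a : RT * RT -> R) : measurable_fun setT a ->
  measurable_fun setT (fun z : (RT * RT) * (RT * RT) => a z.1).
Proof. by move=> ma; exact: measurableT_comp ma measurable_fst. Qed.

Lemma measurable_U2 (a : RT * RT -> R) : measurable_fun setT a ->
  measurable_fun setT (fun z : (RT * RT) * (RT * RT) => a z.2).
Proof. by move=> ma; exact: measurableT_comp ma measurable_snd. Qed.

Lemma C1c_theta : exists A, C1c A theta theta'.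
Proof.
exists (Num.max (`|t1| + h) (`|t2| + h)).
by apply: C1c_window => //; rewrite le_max lexx ?orbT.
Qed.

Lemma measurable_theta : measurable_fun setT theta /\ measurable_fun setT theta'.
Proof. by have [A /C1c_measurable] := C1c_theta. Qed.

Lemma kernel_bounded : exists2 K, 0 <= K & forall z : (RT * RT) * (RT * RT),
  let kap := box1 T z.1.1 * box1 T z.2.1 * box1 e (z.1.2 - z.2.2) in
  [/\ `|(theta' z.1.1 * bump h (z.1.1 - z.2.1) + theta z.1.1 * dbump h (z.1.1 - z.2.1)) *
     bump e (z.1.2 - z.2.2)| <= K * kap,
   `|theta z.1.1 * bump h (z.1.1 - z.2.1) * dbump e (z.1.2 - z.2.2)| <= K * kap,
   `|theta z.1.1 * bump h (z.1.1 - z.2.1) * bump e (z.1.2 - z.2.2)| <= K * kap,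
   `|theta z.1.1 * dbump h (z.1.1 - z.2.1) * bump e (z.1.2 - z.2.2)| <= K * kap &
   `|theta' z.1.1 * bump h (z.1.1 - z.2.1) * bump e (z.1.2 - z.2.2)| <= K * kap].
Proof.
have [A hA] := C1c_theta; have [C C0 hC] := C1c_bounded hA.
(* Each constant bounds a bump, which is at most 1, and also its derivative, which is at most 4 over
   its width. *)
pose Cb : R := 1 + 4 / h; pose Cg : R := 1 + 4 / e.
have b0 z : `|bump h z| <= Cb by rewrite (le_trans (norm_bump _ _))// lerDl divr_ge0// ltW.
have b1 z : `|dbump h z| <= Cb by rewrite (le_trans (dbump_le _ h0))// lerDr.
have g0 z : `|bump e z| <= Cg by rewrite (le_trans (norm_bump _ _))// lerDl divr_ge0// ltW.
have g1 z : `|dbump e z| <= Cg by rewrite (le_trans (dbump_le _ e0))// lerDr.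
have Cb0 : 0 <= Cb by rewrite (le_trans _ (b0 0)).
have Cg0 : 0 <= Cg by rewrite (le_trans _ (g0 0)).
exists ((C * Cb + C * Cb) * Cg); first by rewrite mulr_ge0// addr_ge0// mulr_ge0.
case=> -[t x] [s y] /=.
have [ts|ts] := boolP ((T < `|t|) || (T < `|s|)).
  have [|E1 E2 E3] := @kernel_support t s.
    by case/orP: ts => ?; right; right; [left|right].
  rewrite E1 E2 E3 addr0 !mul0r normr0.
  have K0 : 0 <= (C * Cb + C * Cb) * Cg * (box1 T t * box1 T s * box1 e (x - y)).
    by rewrite mulr_ge0 ?mulr_ge0 ?box1_ge0// addr_ge0// mulr_ge0.
  by split.
have [/ltW xy|xy] := ltP e `|x - y|.
  have [-> ->] := bump_supp e0 xy; rewrite !mulr0 normr0.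
  have K0 : 0 <= (C * Cb + C * Cb) * Cg * (box1 T t * box1 T s * box1 e (x - y)).
    by rewrite mulr_ge0 ?mulr_ge0 ?box1_ge0// addr_ge0// mulr_ge0.
  by split.
move: ts; rewrite negb_or -!leNgt => /andP[tT sT].
rewrite !box1E tT sT xy !mulr1.
have m2 (a b : R) : `|a| <= C -> `|b| <= Cb -> `|a * b| <= C * Cb by move=> ? ?; rewrite normrM ler_pM.
have m3 (a b : R) : `|a| <= C * Cb -> `|b| <= Cg -> `|a * b| <= (C * Cb + C * Cb) * Cg.
  move=> ha hb; rewrite normrM ler_pM// (le_trans ha)// lerDl mulr_ge0//.
have [hC1 hC2] := hC t.
split; try by apply: m3 => //; apply: m2.
rewrite normrM ler_pM// (le_trans (ler_normD _ _))// lerD//; exact: m2.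
Qed.

Lemma dominantE z : box1 T z.1.1 * box1 T z.2.1 * box1 e (z.1.2 - z.2.2) *
  (total U z.1 + total W z.2) = dominant z.
Proof. by rewrite /dominant /link /link'; ring. Qed.

Let rangeU p : forall j, (1 <= j <= M)%N -> ext (u j) p \in `[0, L].
Proof. by move=> j jM; exact: (U_range hu). Qed.

Let rangeW p : forall j, (1 <= j <= M)%N -> ext (w j) p \in `[0, L].
Proof. by move=> j jM; exact: (U_range hw). Qed.

Lemma norm_past (t : R) : `|past t| <= 1.
Proof. by rewrite pastE; case: ifP; rewrite ?normr1 ?normr0. Qed.

Let leU p j : (1 <= j <= M)%N -> ext (u j) p <= total U p.
Proof.
move=> jM; apply: (@total_ge U p j) => // i iM.
exact: (ext_nneg (sol_C0L1 hu iM)).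
Qed.

Let leW p j : (1 <= j <= M)%N -> ext (w j) p <= total W p.
Proof.
move=> jM; apply: (@total_ge W p j) => // i iM.
exact: (ext_nneg (sol_C0L1 hw iM)).
Qed.

Lemma measurable_kfluxZ (a b : (RT * RT) * (RT * RT) -> R) :
  measurable_fun setT a -> measurable_fun setT b ->
  (forall z, a z \in `[0, L]) -> (forall z, b z \in `[0, L]) ->
  measurable_fun setT (fun z => kflux v (a z) (b z)).
Proof.
move=> ma mb aL bL; apply: measurable_funM.
  by apply: measurable_sgr; exact: measurable_funB.
by apply: measurable_funB; exact: (measurable_flux hL hV).
Qed.

Lemma L1_PhiU : L1 mu4 PhiU.
Proof.
have [K K0 hK] := kernel_bounded.
have V0 := V_ge0 hL hV.
have [mth mth'] := measurable_theta.
pose C := 1 + V + tau^-1 * (2 * `|lip|).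
have C0 : 0 <= C by rewrite addr_ge0 ?addr_ge0// mulr_ge0 ?invr_ge0 ?(ltW htau)// mulr_ge0.
rewrite (_ : PhiU = fun z => \sum_(1 <= j < M.+1 | (1 <= j <= M)%N) past z.1.1 * EI U j (ext (w j) z.2)
    (fun t => theta t * bump h (t - z.2.1))
    (fun t => theta' t * bump h (t - z.2.1) + theta t * dbump h (t - z.2.1))
    (fun x => bump e (x - z.2.2)) (fun x => dbump e (x - z.2.2)) z.1); last first.
  by apply/funext => z; rewrite /PhiU sum_lanes_cond.
apply: L1_sum => j jM.
apply: (L1_dom _ (L1Z (C * K) L1_dominant)).
  apply: measurable_funM; first exact: (measurable_t_ measurable_past).
  have mu1 := measurable_U1 (measurable_U hu jM).
  have mw2 := measurable_U2 (measurable_U hw jM).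
  have mbh := measurable_ts (measurable_bump h).
  have mdbh := measurable_ts (measurable_dbump h).
  have mbe := measurable_xy (measurable_bump e).
  have mdbe := measurable_xy (measurable_dbump e).
  have mt := measurable_t_ mth; have mt' := measurable_t_ mth'.
  have mr := measurable_U1 (measurable_rhsU hL hS0 hu jM).
  have mkf : measurable_fun setT (fun z : (RT * RT) * (RT * RT) => kflux v (ext (u j) z.1) (ext (w j) z.2)).
    by apply: (measurable_kfluxZ mu1 mw2) => z; [exact: rangeU|exact: rangeW].
  exact: (measurable_entropy_terms tau^-1 mu1 mw2 mkf mr (measurable_funM mt mbh)
    (measurable_funD (measurable_funM mt' mbh) (measurable_funM mt mdbh)) mbe mdbe).
move=> z; have [h1 h2 h3 _ _] := hK z.
rewrite normrM -[leRHS]mul1r ler_pM// ?norm_past//.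
apply: (le_trans (entropy_integrand_bound (rangeU z.1) jM (rangeW z.2 jM) h1 h2 h3)).
rewrite -/C -dominantE -!mulrA ler_wpM2l// mulrCA.
rewrite [leLHS](_ : _ = K * (box1 T z.1.1 * (box1 T z.2.1 * (box1 e (z.1.2 - z.2.2) *
  (total U z.1 + ext (w j) z.2))))); last by ring.
rewrite ler_wpM2l// !ler_wpM2l ?box1_ge0//.
by rewrite lerD2l leW.
Qed.

Lemma L1_PhiW : L1 mu4 PhiW.
Proof.
have [K K0 hK] := kernel_bounded.
have V0 := V_ge0 hL hV.
have [mth mth'] := measurable_theta.
pose C := 1 + V + tau^-1 * (2 * `|lip|).
have C0 : 0 <= C by rewrite addr_ge0 ?addr_ge0// mulr_ge0 ?invr_ge0 ?(ltW htau)// mulr_ge0.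
rewrite (_ : PhiW = fun z => \sum_(1 <= j < M.+1 | (1 <= j <= M)%N) past z.2.1 * EI W j (ext (u j) z.1)
    (fun s => theta z.1.1 * bump h (s - z.1.1))
    (fun s => theta z.1.1 * dbump h (s - z.1.1))
    (fun y => bump e (y - z.1.2)) (fun y => dbump e (y - z.1.2)) z.2); last first.
  by apply/funext => z; rewrite /PhiW sum_lanes_cond.
have bN (c a b : R) : bump c (a - b) = bump c (b - a) by rewrite -bumpN opprB.
have dN (c a b : R) : dbump c (a - b) = - dbump c (b - a) by rewrite -dbumpN opprB.
apply: L1_sum => j jM.
apply: (L1_dom _ (L1Z (C * K) L1_dominant)).
  apply: measurable_funM; first exact: (measurable_s_ measurable_past).
  have mu1 := measurable_U1 (measurable_U hu jM).
  have mw2 := measurable_U2 (measurable_U hw jM).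
  have mbh : measurable_fun setT (fun z : (RT * RT) * (RT * RT) => bump h (z.2.1 - z.1.1)).
    by under eq_fun do rewrite bN; exact: (measurable_ts (measurable_bump h)).
  have mdbh : measurable_fun setT (fun z : (RT * RT) * (RT * RT) => dbump h (z.2.1 - z.1.1)).
    under eq_fun do rewrite dN; apply: measurableT_comp => //.
    exact: (measurable_ts (measurable_dbump h)).
  have mbe : measurable_fun setT (fun z : (RT * RT) * (RT * RT) => bump e (z.2.2 - z.1.2)).
    by under eq_fun do rewrite bN; exact: (measurable_xy (measurable_bump e)).
  have mdbe : measurable_fun setT (fun z : (RT * RT) * (RT * RT) => dbump e (z.2.2 - z.1.2)).
    under eq_fun do rewrite dN; apply: measurableT_comp => //.
    exact: (measurable_xy (measurable_dbump e)).
  have mt := measurable_t_ mth; have mt' := measurable_t_ mth'.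
  have mr := measurable_U2 (measurable_rhsU hL hS0 hw jM).
  have mkf : measurable_fun setT (fun z : (RT * RT) * (RT * RT) => kflux v (ext (w j) z.2) (ext (u j) z.1)).
    by apply: (measurable_kfluxZ mw2 mu1) => z; [exact: rangeW|exact: rangeU].
  exact: (measurable_entropy_terms tau^-1 mw2 mu1 mkf mr (measurable_funM mt mbh)
    (measurable_funM mt mdbh) mbe mdbe).
move=> z; have [_ h2 h3 h1 _] := hK z.
rewrite normrM -[leRHS]mul1r ler_pM// ?norm_past//.
have h1' : `|theta z.1.1 * dbump h (z.2.1 - z.1.1) * bump e (z.2.2 - z.1.2)| <=
    K * (box1 T z.1.1 * box1 T z.2.1 * box1 e (z.1.2 - z.2.2)).
  by rewrite dN (bN e) mulrN mulNr normrN.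
have h2' : `|theta z.1.1 * bump h (z.2.1 - z.1.1) * dbump e (z.2.2 - z.1.2)| <=
    K * (box1 T z.1.1 * box1 T z.2.1 * box1 e (z.1.2 - z.2.2)).
  by rewrite dN (bN h) mulrN normrN.
have h3' : `|theta z.1.1 * bump h (z.2.1 - z.1.1) * bump e (z.2.2 - z.1.2)| <=
    K * (box1 T z.1.1 * box1 T z.2.1 * box1 e (z.1.2 - z.2.2)).
  by rewrite (bN e) (bN h).
apply: (le_trans (entropy_integrand_bound (rangeW z.2) jM (rangeU z.1 jM) h1' h2' h3')).
rewrite -/C -dominantE -!mulrA ler_wpM2l// mulrCA.
rewrite [leLHS](_ : _ = K * (box1 T z.1.1 * (box1 T z.2.1 * (box1 e (z.1.2 - z.2.2) *
  (ext (u j) z.1 + total W z.2))))); last by ring.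
rewrite ler_wpM2l// !ler_wpM2l ?box1_ge0//.
by rewrite lerD2r leU.
Qed.

Lemma C1c_kernel (a : R) : exists2 A, C1c A theta theta' &
  C1c A (fun t => theta t * bump h (t - a))
    (fun t => theta' t * bump h (t - a) + theta t * dbump h (t - a)).
Proof.
have [A hA] := C1c_theta; pose B := Num.max A (`|a| + h).
have hB : C1c B theta theta' by apply: C1c_widen hA; rewrite le_max lexx.
exists B => //; apply: C1cM => //.
by apply: C1c_bump => //; rewrite le_max lexx orbT.
Qed.

(** For each fixed [q] the inner integral is a sum of entropy inequalities of [u] with constants
    [w_j(q)]; the initial terms vanish because the window is 0 at time 0. *)
Lemma Int_PhiU_ge0 : 0 <= \int[mu4]_z PhiU z.
Proof.
have key q : L1 mu2 (fun p => PhiU (p, q)) /\ 0 <= \int[mu2]_p PhiU (p, q).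
  have [A _ hA] := C1c_kernel q.1; pose B := Num.max A (`|q.2| + e).
  have hB := C1c_widen (_ : A <= B) hA.
  have {}hB := hB ltac:(by rewrite le_max lexx).
  have hg : C1c B (fun x => bump e (x - q.2)) (fun x => dbump e (x - q.2)).
    by apply: C1c_bump => //; rewrite le_max lexx orbT.
  have th0 : theta 0 = 0.
    by apply: (theta_support _).1; apply/orP; left; move: (h0) (ht1); lra.
  have E (j : nat) : (1 <= j <= M)%N -> _ := fun jM =>
     entropy_X hL hV hS0 hu hB hg jM (rangeW q jM).
  have -> : (fun p => PhiU (p, q)) = (fun p => \sum_(1 <= j < M.+1 | (1 <= j <= M)%N)
      past p.1 * EI U j (ext (w j) q)
      (fun t => theta t * bump h (t - q.1))
      (fun t => theta' t * bump h (t - q.1) + theta t * dbump h (t - q.1))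
      (fun x => bump e (x - q.2)) (fun x => dbump e (x - q.2)) p).
    by apply/funext => p; rewrite /PhiU sum_lanes_cond.
  split; first by apply: L1_sum => j jM; exact: (E j jM).1.
  rewrite Int_sum; last by move=> j jM; exact: (E j jM).1.
  apply: sumr_ge0 => j jM; have [_] := E j jM.
  rewrite (_ : \int[mu]_x _ = 0) ?addr0//.
  by rewrite -[RHS](@Int0 _ _ _ mu); apply: Int_eq => x; rewrite th0 !mul0r mulr0.
rewrite (Int_prod_swap L1_PhiU (fun q => (key q).1)).
by apply: Int_ge0 => q; exact: (key q).2.
Qed.

End TwoSolutions.
End Doubling.

Section Contraction.
Context {R : realType}.
Local Notation mu := (@lebesgue_measure R).
Local Notation RT := (measurableTypeR R).
Local Notation mu2 := (@plane R).
Local Notation mu4 := (mu2 \x mu2)%E.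
Variables (M : nat) (L V lip : R) (v : R -> R) (S : nat -> R -> R -> R) (tau : R).
Hypotheses (hM : (0 < M)%N) (hL : 0 < L) (hV : hypV L V v) (hS0 : hypS0 M L lip S)
  (hS1 : hypS1 M L S) (htau : 0 < tau).
Local Notation sol := (solution M L v S tau).
Local Notation EI := (entropy_integrand M v S tau).
Variables (u0 w0 : nat -> R -> R) (u w : nat -> R -> R -> R).
Hypotheses (hu : sol u0 u) (hw : sol w0 w).
Local Notation W := (fun j => ext (w j)).

Section Kernel.
Variables (e h t1 t2 : R).
Hypotheses (e0 : 0 < e) (h0 : 0 < h) (ht1 : h + h <= t1) (t12 : t1 <= t2).
Local Notation theta := (window h t1 t2).
Local Notation PW := (PhiW M v S tau u w e h t1 t2).
Local Notation PS := (Psi M u w e h t1 t2).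

Let lPW : L1 mu4 PW.
Proof. exact: (L1_PhiW hL hV hS0 htau hu hw e0 h0 ht1 t12). Qed.

Lemma Int_PhiW_ge0 : 0 <= \int[mu4]_z PW z.
Proof.
have key p : L1 mu2 (fun q => PW (p, q)) /\ 0 <= \int[mu2]_q PW (p, q).
  pose B := Num.max (`|p.1| + h) (`|p.2| + e).
  have th0 : 0 <= theta p.1 by rewrite subr_ge0 prim_homo// lerD2l lerN2.
  have hB : C1c B (fun s => theta p.1 * bump h (s - p.1)) (fun s => theta p.1 * dbump h (s - p.1)).
    by apply: C1cZ => //; apply: C1c_bump => //; rewrite le_max lexx.
  have hg : C1c B (fun x => bump e (x - p.2)) (fun x => dbump e (x - p.2)).
    by apply: C1c_bump => //; rewrite le_max lexx orbT.
  (* Here the time variable of the test function is [s], and it is the bump that kills the initial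
     term: where the window is nonzero, [t] exceeds [h]. *)
  have init : theta p.1 * bump h (0 - p.1) = 0.
    have [/(theta_support h0 t12)[-> _]|] := boolP ((p.1 <= t1 - h) || (t2 + h <= p.1)).
      by rewrite mul0r.
    rewrite negb_or -!ltNge => /andP[ta tb].
    rewrite (bump_supp h0 _).1 ?mulr0// sub0r normrN ger0_norm; move: (h0) (ht1); lra.
  have E (j : nat) : (1 <= j <= M)%N -> _ := fun jM =>
     entropy_X hL hV hS0 hw hB hg jM (U_range hu p jM).
  have -> : (fun q => PW (p, q)) = (fun q => \sum_(1 <= j < M.+1 | (1 <= j <= M)%N)
      past q.1 * EI W j (ext (u j) p)
      (fun s => theta p.1 * bump h (s - p.1))
      (fun s => theta p.1 * dbump h (s - p.1))
      (fun x => bump e (x - p.2)) (fun x => dbump e (x - p.2)) q).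
    by apply/funext => q; rewrite /PhiW sum_lanes_cond.
  split; first by apply: L1_sum => j jM; exact: (E j jM).1.
  rewrite Int_sum; last by move=> j jM; exact: (E j jM).1.
  apply: sumr_ge0 => j jM; have [_] := E j jM.
  rewrite (_ : \int[mu]_x _ = 0) ?addr0//.
  by rewrite -[RHS](@Int0 _ _ _ mu); apply: Int_eq => x; rewrite init !mul0r mulr0.
rewrite (Int_prod lPW (fun q => (key q).1)).
by apply: Int_ge0 => q; exact: (key q).2.
Qed.

(* The part of [Psi] coming from the time bump at [c]. *)
Definition psi (c : R) (j : nat) (z : (RT * RT) * (RT * RT)) : R :=
  `|ext (u j) z.1 - ext (w j) z.2| *
    (bump h (z.1.1 - c) * bump h (z.1.1 - z.2.1) * bump e (z.1.2 - z.2.2)).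

Lemma Psi_psi z : PS z = \sum_(1 <= j < M.+1) psi t1 j z - \sum_(1 <= j < M.+1) psi t2 j z.
Proof.
by rewrite -sumrB; apply: eq_bigr => j _; rewrite /psi /dwindow; ring.
Qed.

End Kernel.
End Contraction.

(** * The doubling kernel near a fixed time and the smeared distance *)

Section FubiniSwap2.
Context d1 d2 (T1 : measurableType d1) (T2 : measurableType d2) (R : realType).
Context (m1 : {sigma_finite_measure set T1 -> \bar R}).
Context (m2 : {sigma_finite_measure set T2 -> \bar R}).

Lemma measurable_Int_prod_swap (f : T1 * T2 -> R) : L1 (m1 \x m2)%E f ->
  (forall y, L1 m1 (fun x => f (x, y))) ->
  measurable_fun setT (fun y => \int[m1]_x f (x, y)).
Proof.
move=> lf sf; apply/measurable_EFinP.
rewrite (_ : EFin \o _ = fubini_G m1 (EFin \o f)); first exact: (measurable_fubini_G lf).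
by apply/funext => y; rewrite /fubini_G /= EFin_Int.
Qed.

End FubiniSwap2.

Section Tensor.
Context {R : realType}.
Local Notation mu := (@lebesgue_measure R).
Local Notation RT := (measurableTypeR R).
Local Notation mu2 := (@plane R).
Local Notation mu4 := (mu2 \x mu2)%E.

Lemma tensor (a b : R -> R) : L1 mu a -> L1 mu b ->
  L1 mu2 (fun p => a p.1 * b p.2) /\
  \int[mu2]_p (a p.1 * b p.2) = (\int[mu]_x a x) * (\int[mu]_x b x).
Proof.
move=> la lb.
have sl x : L1 mu (fun y => a x * b y) by apply: L1Z.
have l2 : L1 mu2 (fun p => a p.1 * b p.2).
  apply: (@L1_prod _ _ _ _ _ mu mu _ (fun x => (\int[mu]_y `|b y|) * `|a x|)).
  - apply: measurable_funM.
      exact: measurableT_comp (L1_measurable la) measurable_fst.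
    exact: measurableT_comp (L1_measurable lb) measurable_snd.
  - by apply: L1Z; exact: L1_norm.
  - exact: sl.
  - move=> x /=; rewrite mulrC -IntZ; last exact: L1_norm.
    by rewrite le_eqVlt; apply/orP; left; apply/eqP; apply: Int_eq => y; rewrite normrM.
split => //; rewrite (Int_prod l2 sl) mulrC -IntZ//.
by apply: Int_eq => x; rewrite /= IntZ// mulrC.
Qed.

Lemma L1_bump_shiftN (e a : R) : 0 < e -> L1 mu (fun x => bump e (a - x)).
Proof.
move=> e0; apply: (@L1_compact_support _ _ (`|a| + e) 1).
- apply: continuous_measurable_fun => x; apply: (cvg_comp (fun x => a - x) (bump e)).
    by apply: cvgB; [exact: cvg_cst|exact: cvg_id].
  exact: continuous_bump.
- by move=> x; exact: norm_bump.
- move=> x xa; apply: (bump_supp e0 _).1.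
  have := ler_normB (a - x) a; rewrite (_ : a - x - a = - x); last by ring.
  by rewrite normrN; lra.
Qed.

Lemma L1_bump_shift (e a : R) : 0 < e -> L1 mu (fun x => bump e (x - a)).
Proof.
move=> e0; have -> : (fun x => bump e (x - a)) = (fun x => bump e (a - x)).
  by apply/funext => x; rewrite -bumpN opprB.
exact: L1_bump_shiftN.
Qed.

Variables (e h c : R).
Hypotheses (e0 : 0 < e) (h0 : 0 < h).

(** As [h] tends to 0 this concentrates both times at [c] with total weight [mass h ^+ 2], leaving
    only the kernel of width [e] in space. *)
Definition kern (z : (RT * RT) * (RT * RT)) : R :=
  bump h (z.1.1 - c) * bump h (z.1.1 - z.2.1) * bump e (z.1.2 - z.2.2).

Lemma kern_ge0 z : 0 <= kern z.
Proof.
by apply: mulr_ge0; [apply: mulr_ge0|]; exact: bump_ge0.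
Qed.

Lemma measurable_kern : measurable_fun setT kern.
Proof.
apply: measurable_funM; [apply: measurable_funM|].
- apply: (@measurable_t_ _ (fun t => bump h (t - c))).
  exact: L1_measurable (L1_bump_shift c h0).
- exact: measurable_ts (measurable_bump h).
- exact: measurable_xy (measurable_bump e).
Qed.

Section Weight.
Variable a : RT * RT -> R.
Hypotheses (ma : measurable_fun setT a) (a0 : forall p, 0 <= a p)
  (la : forall A, L1 mu2 (fun p => box1 A p.1 * a p))
  (sa : forall t, L1 mu (fun x => a (t, x))).

Lemma L1_weight (k : R -> R) A : measurable_fun setT k -> (forall t, 0 <= k t <= 1) ->
  (forall t, A < `|t| -> k t = 0) -> L1 mu2 (fun p => k p.1 * a p).
Proof.
move=> mk k1 kA; apply: (L1_dom _ (la A)).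
  by apply: measurable_funM => //; exact: measurableT_comp mk measurable_fst.
move=> [t x] /=; have /andP[kt0 kt1] := k1 t.
rewrite ger0_norm ?mulr_ge0// ler_wpM2r// box1E.
by case: (leP `|t| A) => // /kA ->.
Qed.

Lemma Int_weight_le (k : R -> R) A eta : L1 mu k -> (forall t, 0 <= k t <= 1) ->
  (forall t, A < `|t| -> k t = 0) ->
  (forall t, k t != 0 -> \int[mu]_x a (t, x) <= eta) ->
  \int[mu2]_p (k p.1 * a p) <= eta * \int[mu]_t k t.
Proof.
move=> lk k1 kA aeta.
have l2 := L1_weight (L1_measurable lk) k1 kA.
have sl t : L1 mu (fun x => k t * a (t, x)) by apply: L1Z.
rewrite (Int_prod l2 sl) -IntZ//; apply: Int_le.
- exact: (L1_Int_prod l2 sl).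
- exact: L1Z.
move=> t /=; rewrite IntZ// mulrC.
have [->|kt] := eqVneq (k t) 0; first by rewrite !mulr0.
by rewrite ler_wpM2r ?aeta//; have /andP[] := k1 t.
Qed.

Lemma bump01 (d z : R) : 0 <= bump d z <= 1.
Proof. by rewrite bump_ge0 bump_le1. Qed.

Lemma bump_c_supp (t : R) : `|c| + h < `|t| -> bump h (t - c) = 0.
Proof.
move=> ht; apply: (bump_supp h0 _).1.
have := ler_normD (t - c) c; rewrite subrK; lra.
Qed.

Lemma kern1 : L1 mu4 (fun z => a z.1 * kern z) /\
  \int[mu4]_z (a z.1 * kern z) = mass h * mass e * \int[mu2]_p (bump h (p.1 - c) * a p).
Proof.
have lw : L1 mu2 (fun p => bump h (p.1 - c) * a p).
  apply: (@L1_weight (fun t => bump h (t - c)) (`|c| + h)).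
  - exact: L1_measurable (L1_bump_shift c h0).
  - by move=> t; exact: bump01.
  - exact: bump_c_supp.
have key p : L1 mu2 (fun q => a p * kern (p, q)) /\
    \int[mu2]_q (a p * kern (p, q)) = mass h * mass e * (bump h (p.1 - c) * a p).
  have [l2 i2] := tensor (L1_bump_shiftN p.1 h0) (L1_bump_shiftN p.2 e0).
  have E : (fun q => a p * kern (p, q)) =
      (fun q => (a p * bump h (p.1 - c)) * (bump h (p.1 - q.1) * bump e (p.2 - q.2))).
    by apply/funext => q; rewrite /kern /=; ring.
  rewrite E; split; first exact: L1Z.
  by rewrite IntZ// i2 !Int_bump_shiftN//; ring.
have lZ : L1 mu4 (fun z => a z.1 * kern z).
  apply: (@L1_prod _ _ _ _ _ mu2 mu2 _ (fun p => mass h * mass e * (bump h (p.1 - c) * a p))).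
  - apply: measurable_funM; last exact: measurable_kern.
    exact: measurableT_comp ma measurable_fst.
  - exact: L1Z.
  - by move=> p; exact: (key p).1.
  - move=> p /=; rewrite -(key p).2 le_eqVlt; apply/orP; left; apply/eqP.
    by apply: Int_eq => q; rewrite ger0_norm// mulr_ge0// kern_ge0.
split => //; rewrite (Int_prod lZ (fun p => (key p).1)) -IntZ//.
by apply: Int_eq => p; exact: (key p).2.
Qed.

(** Integrating out [t] leaves a convolution of two bumps, dominated by [mass h] times the indicator
    of [|s - c| <= 2 * h]. Compared with the exact formula of [kern1] this loses only a constant
    factor. *)
Lemma kern2 : L1 mu4 (fun z => a z.2 * kern z) /\
  \int[mu4]_z (a z.2 * kern z) <=
    mass h * mass e * \int[mu2]_p (box1 (2 * h) (p.1 - c) * a p).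
Proof.
have b01 t : 0 <= box1 (2 * h) (t - c) <= 1 by rewrite box1E; case: ifP; rewrite ?lexx ?ler01.
have lw : L1 mu2 (fun p => box1 (2 * h) (p.1 - c) * a p).
  apply: (@L1_weight (fun t => box1 (2 * h) (t - c)) (`|c| + 2 * h)).
  - apply: measurableT_comp (measurable_box1 _) _.
    by apply: measurable_funB => //; exact: measurable_cst.
  - exact: b01.
  - move=> t ht; rewrite box1E; case: leP => //.
    have := ler_normD (t - c) c; rewrite subrK; lra.
pose K t s := bump h (t - c) * bump h (t - s).
have lK s : L1 mu (fun t => K t s).
  apply: (L1_dom _ (L1_bump_shift c h0)).
    by apply: measurable_funM; exact: L1_measurable (L1_bump_shift _ h0).
  move=> t; have k0 : 0 <= K t s by rewrite mulr_ge0 ?bump_ge0.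
  by rewrite ger0_norm// /K ler_piMr ?bump_ge0 ?bump_le1.
have iK s : \int[mu]_t K t s <= mass h * box1 (2 * h) (s - c).
  rewrite box1E; case: (leP `|s - c| (2 * h)) => hs.
    rewrite mulr1 -(Int_bump_shift c h0); apply: Int_le => //; first exact: L1_bump_shift.
    by move=> t; rewrite /K ler_piMr ?bump_ge0 ?bump_le1.
  rewrite mulr0 -(@Int0 _ _ _ mu); apply: Int_le => //; first exact: L10.
  move=> t; rewrite /K; have [tc|tc] := leP h `|t - c|.
    by rewrite (bump_supp h0 tc).1 mul0r.
  rewrite [X in _ * X](bump_supp h0 _).1 ?mulr0//.
  have := ler_normD (s - t) (t - c).
  rewrite (_ : s - t + (t - c) = s - c); last by ring.
  by rewrite (distrC s t); lra.
have key q : L1 mu2 (fun p => a q * kern (p, q)) /\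
    \int[mu2]_p (a q * kern (p, q)) <= mass h * mass e * (box1 (2 * h) (q.1 - c) * a q).
  have [l2 i2] := tensor (lK q.1) (L1_bump_shift q.2 e0).
  have E : (fun p => a q * kern (p, q)) =
      (fun p => a q * (K p.1 q.1 * bump e (p.2 - q.2))).
    by apply/funext => p; rewrite /kern /=.
  rewrite E; split; first exact: L1Z.
  rewrite IntZ// i2 Int_bump_shift//.
  rewrite [leRHS](_ : _ = a q * (mass h * box1 (2 * h) (q.1 - c) * mass e)); last by ring.
  by rewrite ler_wpM2l// ler_wpM2r// ltW// mass_gt0.
have lZ : L1 mu4 (fun z => a z.2 * kern z).
  apply: (@L1_prod_swap _ _ _ _ _ mu2 mu2 _ (fun p => mass h * mass e * (box1 (2 * h) (p.1 - c) * a p))).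
  - apply: measurable_funM; last exact: measurable_kern.
    exact: measurableT_comp ma measurable_snd.
  - exact: L1Z.
  - by move=> p; exact: (key p).1.
  - move=> p /=; rewrite (le_trans _ (key p).2)// le_eqVlt; apply/orP; left; apply/eqP.
    by apply: Int_eq => q; rewrite ger0_norm// mulr_ge0// kern_ge0.
split => //; rewrite (Int_prod_swap lZ (fun p => (key p).1)) -IntZ//.
apply: Int_le; [|exact: L1Z|by move=> p; exact: (key p).2].
apply: (L1_dom _ (L1Z (mass h * mass e) lw)).
  exact: (measurable_Int_prod_swap lZ (fun q => (key q).1)).
move=> q; rewrite ger0_norm ?(key q).2//.
by apply: Int_ge0 => p; rewrite mulr_ge0// kern_ge0.
Qed.

End Weight.
End Tensor.

Section Spread.
Context {R : realType}.
Local Notation mu := (@lebesgue_measure R).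
Local Notation RT := (measurableTypeR R).
Local Notation mu2 := (@plane R).
Local Notation mu4 := (mu2 \x mu2)%E.
Variable (e : R).
Hypothesis e0 : 0 < e.

(** The L^1 distance smeared at scale [e]. For [g = f] it is the average of the L^1 norms of
    [f - f(. - z)] over shifts [z], weighted by the bump: an integral modulus of continuity. *)
Definition spread (f g : R -> R) : R :=
  \int[mu2]_p (`|f p.1 - g p.2| * bump e (p.1 - p.2)).

Lemma measurable_bumpxy : measurable_fun setT (fun p : RT * RT => bump e (p.1 - p.2)).
Proof.
apply: measurableT_comp (measurable_bump e) _.
by apply: measurable_funB; [exact: measurable_fst|exact: measurable_snd].
Qed.

Lemma spread_l (f : R -> R) : L1 mu f ->
  L1 mu2 (fun p => `|f p.1| * bump e (p.1 - p.2)) /\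
  \int[mu2]_p (`|f p.1| * bump e (p.1 - p.2)) = mass e * \int[mu]_x `|f x|.
Proof.
move=> lf.
have sl x : L1 mu (fun y => `|f x| * bump e (x - y)).
  by apply: L1Z; exact: L1_bump_shiftN.
have E x : \int[mu]_y (`|f x| * bump e (x - y)) = mass e * `|f x|.
  by rewrite IntZ; [rewrite Int_bump_shiftN// mulrC|exact: L1_bump_shiftN].
have l2 : L1 mu2 (fun p => `|f p.1| * bump e (p.1 - p.2)).
  apply: (@L1_prod _ _ _ _ _ mu mu _ (fun x => mass e * `|f x|)).
  - apply: measurable_funM; last exact: measurable_bumpxy.
    apply: measurableT_comp => //.
    exact: measurableT_comp (L1_measurable lf) measurable_fst.
  - by apply: L1Z; exact: L1_norm.
  - exact: sl.
  - move=> x /=; rewrite -E le_eqVlt; apply/orP; left; apply/eqP; apply: Int_eq => y.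
    by rewrite ger0_norm// mulr_ge0// bump_ge0.
split=> //; rewrite (Int_prod l2 sl) -IntZ; last exact: L1_norm.
by apply: Int_eq => x; rewrite /= E.
Qed.

Lemma spread_r (f : R -> R) : L1 mu f ->
  L1 mu2 (fun p => `|f p.2| * bump e (p.1 - p.2)) /\
  \int[mu2]_p (`|f p.2| * bump e (p.1 - p.2)) = mass e * \int[mu]_x `|f x|.
Proof.
move=> lf.
have sl y : L1 mu (fun x => `|f y| * bump e (x - y)).
  by apply: L1Z; exact: L1_bump_shift.
have E y : \int[mu]_x (`|f y| * bump e (x - y)) = mass e * `|f y|.
  by rewrite IntZ; [rewrite Int_bump_shift// mulrC|exact: L1_bump_shift].
have l2 : L1 mu2 (fun p => `|f p.2| * bump e (p.1 - p.2)).
  apply: (@L1_prod_swap _ _ _ _ _ mu mu _ (fun x => mass e * `|f x|)).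
  - apply: measurable_funM; last exact: measurable_bumpxy.
    apply: measurableT_comp => //.
    exact: measurableT_comp (L1_measurable lf) measurable_snd.
  - by apply: L1Z; exact: L1_norm.
  - exact: sl.
  - move=> x /=; rewrite -E le_eqVlt; apply/orP; left; apply/eqP; apply: Int_eq => y.
    by rewrite ger0_norm// mulr_ge0// bump_ge0.
split=> //; rewrite (Int_prod_swap l2 sl) -IntZ; last exact: L1_norm.
by apply: Int_eq => x; rewrite /= E.
Qed.

Lemma L1_spread (f g : R -> R) : L1 mu f -> L1 mu g ->
  L1 mu2 (fun p => `|f p.1 - g p.2| * bump e (p.1 - p.2)) /\
  forall x, L1 mu (fun y => `|f x - g y| * bump e (x - y)).
Proof.
move=> lf lg.
have dom p : `| `|f p.1 - g p.2| * bump e (p.1 - p.2)| <=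
    `|f p.1| * bump e (p.1 - p.2) + `|g p.2| * bump e (p.1 - p.2).
  have h0 : 0 <= `|f p.1 - g p.2| * bump e (p.1 - p.2) by rewrite mulr_ge0 ?bump_ge0.
  by rewrite (ger0_norm h0) -mulrDl; apply: ler_wpM2r; [exact: bump_ge0|exact: ler_normB].
have mm : measurable_fun setT (fun p : RT * RT => `|f p.1 - g p.2| * bump e (p.1 - p.2)).
  apply: measurable_funM; last exact: measurable_bumpxy.
  apply: measurableT_comp => //; apply: measurable_funB.
    exact: measurableT_comp (L1_measurable lf) measurable_fst.
  exact: measurableT_comp (L1_measurable lg) measurable_snd.
split; first by apply: (L1_dom mm (L1D (spread_l lf).1 (spread_r lg).1)).
move=> x; have lxy : L1 mu (fun y => `|f x| * bump e (x - y) + `|g y|).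
  apply: L1D; last exact: L1_norm.
  by apply: L1Z; exact: L1_bump_shiftN.
apply: (L1_dom _ lxy).
- exact: measurableT_comp mm (pair1_measurable x).
- move=> y; apply: (le_trans (dom (x, y))); rewrite /= lerD2l ler_piMr//.
  exact: bump_le1.
Qed.

Lemma spread_tri (f g f' g' : R -> R) : L1 mu f -> L1 mu g -> L1 mu f' -> L1 mu g' ->
  spread f g <= spread f' g' +
    mass e * (\int[mu]_x `|f x - f' x| + \int[mu]_x `|g x - g' x|).
Proof.
move=> lf lg lf' lg'; have [l1 _] := L1_spread lf lg; have [l2 _] := L1_spread lf' lg'.
have [l3 i3] := spread_l (L1B lf lf'); have [l4 i4] := spread_r (L1B lg lg').
rewrite mulrDr -i3 -i4 addrA /spread -IntD// -IntD//; last exact: L1D.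
apply: Int_le => //; first by apply: L1D => //; exact: L1D.
move=> p; rewrite -!mulrDl ler_wpM2r ?bump_ge0//.
have -> : f p.1 - g p.2 = (f' p.1 - g' p.2) + (f p.1 - f' p.1) - (g p.2 - g' p.2) by ring.
by rewrite (le_trans (ler_normB _ _))// lerD2r ler_normD.
Qed.

(** With [k = g] this bounds the true L^1 distance by the smeared one, up to the oscillation of [g]
    at scale [e]. *)
Lemma dist_le_spread (f g k : R -> R) : L1 mu f -> L1 mu g -> L1 mu k ->
  mass e * \int[mu]_x `|f x - g x| <= spread f k + spread g k.
Proof.
move=> lf lg lk; have [l1 _] := L1_spread lf lk; have [l2 _] := L1_spread lg lk.
have [l3 <-] := spread_l (L1B lf lg).
rewrite /spread -IntD//; apply: Int_le => //; first exact: L1D.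
move=> p; rewrite -!mulrDl ler_wpM2r ?bump_ge0//.
have -> : f p.1 - g p.1 = (f p.1 - k p.2) - (g p.1 - k p.2) by ring.
exact: ler_normB.
Qed.

Section Main.
Variables (h c : R).
Hypothesis h0 : 0 < h.

Lemma L1_box1M A (f : R -> R) : L1 mu f -> L1 mu2 (fun p => box1 A p.1 * f p.2).
Proof. by move=> lf; have [] := tensor (L1_box1 A) lf. Qed.

Lemma kern_spread (f g : R -> R) : L1 mu f -> L1 mu g ->
  L1 mu4 (fun z => `|f z.1.2 - g z.2.2| * kern e h c z) /\
  \int[mu4]_z (`|f z.1.2 - g z.2.2| * kern e h c z) = mass h ^+ 2 * spread f g.
Proof.
move=> lf lg; have [l2 sl] := L1_spread lf lg.
have mf2 : measurable_fun setT (fun p : RT * RT => `|f p.2|).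
  apply: measurableT_comp => //.
  exact: measurableT_comp (L1_measurable lf) measurable_snd.
have mg2 : measurable_fun setT (fun p : RT * RT => `|g p.2|).
  apply: measurableT_comp => //.
  exact: measurableT_comp (L1_measurable lg) measurable_snd.
have [k1 _] := @kern1 _ e h c e0 h0 (fun p => `|f p.2|) mf2 (fun p => normr_ge0 _)
  (fun A => L1_box1M A (L1_norm lf)).
have [k2 _] := @kern2 _ e h c e0 h0 (fun p => `|g p.2|) mg2 (fun p => normr_ge0 _)
  (fun A => L1_box1M A (L1_norm lg)).
pose d x := \int[mu]_y (`|f x - g y| * bump e (x - y)).
have ld : L1 mu d by exact: (L1_Int_prod l2 sl).
have key p : L1 mu2 (fun q => `|f p.2 - g q.2| * kern e h c (p, q)) /\
    \int[mu2]_q (`|f p.2 - g q.2| * kern e h c (p, q)) = mass h * (bump h (p.1 - c) * d p.2).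
  have [l3 i3] := tensor (L1_bump_shiftN p.1 h0) (sl p.2).
  have -> : (fun q => `|f p.2 - g q.2| * kern e h c (p, q)) = (fun q => bump h (p.1 - c) *
      (bump h (p.1 - q.1) * (`|f p.2 - g q.2| * bump e (p.2 - q.2)))).
    by apply/funext => q; rewrite /kern /=; ring.
  split; first exact: L1Z.
  by rewrite IntZ// i3 Int_bump_shiftN//; rewrite /d; ring.
have lZ : L1 mu4 (fun z => `|f z.1.2 - g z.2.2| * kern e h c z).
  apply: (L1_dom _ (L1D k1 k2)).
    apply: measurable_funM; last exact: measurable_kern.
    apply: measurableT_comp => //; apply: measurable_funB.
      exact: measurableT_comp (L1_measurable lf) (measurableT_comp measurable_snd measurable_fst).
    exact: measurableT_comp (L1_measurable lg) (measurableT_comp measurable_snd measurable_snd).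
  move=> z; have z0 : 0 <= `|f z.1.2 - g z.2.2| * kern e h c z by rewrite mulr_ge0 ?kern_ge0.
  by rewrite (ger0_norm z0) -mulrDl; apply: ler_wpM2r; [exact: kern_ge0|exact: ler_normB].
split=> //; rewrite (Int_prod lZ (fun p => (key p).1)).
have [l4 i4] := tensor (L1_bump_shift c h0) ld.
transitivity (\int[mu2]_p (mass h * (bump h (p.1 - c) * d p.2))).
  by apply: Int_eq => p; exact: (key p).2.
by rewrite IntZ// i4 Int_bump_shift// /spread (Int_prod l2 sl) expr2 mulrA.
Qed.

End Main.
End Spread.

Lemma lanes_uniform (R : realType) (M : nat) (P : nat -> R -> Prop) :
  (forall j, (1 <= j <= M)%N -> exists2 d : R, 0 < d & forall h, 0 < h -> h <= d -> P j h) ->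
  exists2 d : R, 0 < d & forall h, 0 < h -> h <= d -> forall j, (1 <= j <= M)%N -> P j h.
Proof.
elim: M => [|M IH] HP.
  by exists 1 => // h _ _ j /andP[j1 /(leq_trans j1)].
have [d d0 hd] : exists2 d : R, 0 < d & forall h, 0 < h -> h <= d ->
    forall j, (1 <= j <= M)%N -> P j h.
  by apply: IH => j /andP[j1 jM]; apply: HP; rewrite j1 ltnW.
have [d' d'0 hd'] : exists2 d : R, 0 < d & forall h, 0 < h -> h <= d -> P M.+1 h.
  by apply: HP; rewrite /= leqnn.
exists (Num.min d d'); first by rewrite lt_min d0.
move=> h h0; rewrite le_min => /andP[h1 h2] j /andP[j1].
by rewrite leq_eqVlt => /predU1P[->|jM]; [exact: hd'|apply: hd => //; rewrite j1].
Qed.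

Lemma mass_plus_le (R : realType) (h : R) : 0 < h -> mass h + 4 * h <= 17 * mass h.
Proof. by move=> h0; have := mass_ge h0; lra. Qed.

Lemma lt_of_quarter (R : realFieldType) (x h m d : R) : x <= 2 * h -> h <= m / 4 ->
  0 < h -> m <= d -> x < d.
Proof. lra. Qed.

Section PsiApprox.
Context {R : realType}.
Local Notation mu := (@lebesgue_measure R).
Local Notation RT := (measurableTypeR R).
Local Notation mu2 := (@plane R).
Local Notation mu4 := (mu2 \x mu2)%E.
Variables (B : R) (a b : R -> R -> R) (e c : R).
Hypotheses (ha : C0L1 B a) (hb : C0L1 B b) (e0 : 0 < e).

Lemma L1_increment (u : R -> R -> R) (hu : C0L1 B u) (p := fun q : RT * RT => `|ext u q - ext u (c, q.2)|) :
  [/\ measurable_fun setT p, forall A, L1 mu2 (fun q => box1 A q.1 * p q) &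
      forall t, L1 mu (fun x => p (t, x))].
Proof.
have mu' : measurable_fun setT (ext u) := measurable_ext hu.
have lc : L1 mu (fun x => ext u (c, x)) := L1_ext hu c.
have mc : measurable_fun setT (fun q : RT * RT => ext u (c, q.2)).
  exact: measurableT_comp (L1_measurable lc) measurable_snd.
have mp : measurable_fun setT p.
  by apply: measurableT_comp => //; exact: measurable_funB.
split => //.
- move=> A; have [C C0 hC] := ext_bounded hu A.
  have l1 := @L1_strip _ (ext u) A C mu' (ext_nneg hu) (L1_ext hu) hC.
  have l2 := L1_box1M A lc.
  apply: (L1_dom _ (L1D l1 l2)).
    apply: measurable_funM => //.
    exact: measurableT_comp (measurable_box1 A) measurable_fst.
  move=> q; have q0 : 0 <= box1 A q.1 * p q.
    by apply: mulr_ge0; [exact: box1_ge0|exact: normr_ge0].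
  rewrite (ger0_norm q0) -mulrDr; apply: ler_wpM2l; first exact: box1_ge0.
  by rewrite (le_trans (ler_normB _ _))// !ger0_norm//; exact: (ext_nneg hu).
- by move=> t; apply: L1_norm; apply: L1B; exact: (L1_ext hu).
Qed.

Lemma psi_approx (h eta : R) : 0 < h ->
  (forall t, `|t - c| <= 2 * h -> \int[mu]_x `|ext a (t, x) - ext a (c, x)| <= eta) ->
  (forall t, `|t - c| <= 2 * h -> \int[mu]_x `|ext b (t, x) - ext b (c, x)| <= eta) ->
  L1 mu4 (fun z => `|ext a z.1 - ext b z.2| * kern e h c z) /\
  `|\int[mu4]_z (`|ext a z.1 - ext b z.2| * kern e h c z) -
    mass h ^+ 2 * spread e (fun x => ext a (c, x)) (fun x => ext b (c, x))| <=
   mass h ^+ 2 * (mass e * 17 * eta).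
Proof.
move=> h0 aeta beta.
have mh := mass_gt0 h0; have me := mass_gt0 e0; have mh4 := mass_ge h0.
have eta0 : 0 <= eta.
  rewrite (le_trans _ (aeta c _)) ?subrr ?normr0 ?mulr_ge0 ?(ltW h0)//.
  exact: Int_ge0.
have la := L1_ext ha c; have lb := L1_ext hb c.
have [l0 <-] := kern_spread e0 c h0 la lb.
have [ma1 ma2 ma3] := L1_increment ha; have [mb1 mb2 mb3] := L1_increment hb.
have [k1 i1] := kern1 c e0 h0 ma1 (fun p => normr_ge0 _) ma2.
have [k2 i2] := kern2 c e0 h0 mb1 (fun p => normr_ge0 _) mb2.
have lpsi : L1 mu4 (fun z => `|ext a z.1 - ext b z.2| * kern e h c z).
  apply: (L1_dom _ (L1D (L1D k1 k2) l0)).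
    apply: measurable_funM; last exact: measurable_kern.
    apply: measurableT_comp => //; apply: measurable_funB.
      exact: measurableT_comp (measurable_ext ha) measurable_fst.
    exact: measurableT_comp (measurable_ext hb) measurable_snd.
  move=> z; rewrite ger0_norm; last by rewrite mulr_ge0 ?kern_ge0.
  rewrite -!mulrDl; apply: ler_wpM2r; first exact: kern_ge0.
  have -> : ext a z.1 - ext b z.2 = (ext a z.1 - ext a (c, z.1.2)) -
     (ext b z.2 - ext b (c, z.2.2)) + (ext a (c, z.1.2) - ext b (c, z.2.2)) by ring.
  by rewrite (le_trans (ler_normD _ _))// lerD2r ler_normB.
split => //; rewrite -IntB// (le_trans (Int_norm (L1B lpsi l0)))//.
apply: (@le_trans _ _ (\int[mu4]_z (`|ext a z.1 - ext a (c, z.1.2)| * kern e h c z +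
   `|ext b z.2 - ext b (c, z.2.2)| * kern e h c z))).
  apply: Int_le; [by apply: L1_norm; exact: L1B|exact: L1D|] => z.
  rewrite -mulrBl -mulrDl normrM (ger0_norm (kern_ge0 _ _ _ _)).
  apply: ler_wpM2r; first exact: kern_ge0.
  apply: (le_trans (ler_dist_dist _ _)).
  have -> : ext a z.1 - ext b z.2 - (ext a (c, z.1.2) - ext b (c, z.2.2)) =
    (ext a z.1 - ext a (c, z.1.2)) - (ext b z.2 - ext b (c, z.2.2)) by ring.
  exact: ler_normB.
rewrite IntD// i1 (le_trans (lerD (lexx _) i2))//.
have w1 : \int[mu2]_p (bump h (p.1 - c) * `|ext a p - ext a (c, p.2)|) <= eta * mass h.
  rewrite -(Int_bump_shift c h0).
  apply: (@Int_weight_le _ _ ma1 (fun p => normr_ge0 _) ma2 ma3 (fun t => bump h (t - c)) (`|c| + h)).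
  - exact: L1_bump_shift.
  - by move=> t; exact: bump01.
  - by move=> t; exact: bump_c_supp.
  - move=> t; have [tc|tc _] := leP h `|t - c|; first by rewrite (bump_supp h0 tc).1 eqxx.
    by apply: aeta; apply: (le_trans (ltW tc)); rewrite ler_peMl ?ler1n// ltW.
have w2 : \int[mu2]_p (box1 (2 * h) (p.1 - c) * `|ext b p - ext b (c, p.2)|) <= eta * (4 * h).
  have E t : box1 (2 * h) (t - c) = box1 (2 * h) (c - t) by rewrite !box1E distrC.
  have [lE iE] := L1_box1_shift (2 * h) c.
  have -> : 4 * h = \int[mu]_t box1 (2 * h) (t - c).
    rewrite (funext E) iE; last by apply: mulr_ge0; rewrite ?ltW.
    by ring.
  apply: (@Int_weight_le _ _ mb1 (fun p => normr_ge0 _) mb2 mb3 (fun t => box1 (2 * h) (t - c)) (`|c| + 2 * h)).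
  - by rewrite (funext E).
  - by move=> t; rewrite box1E; case: ifP; rewrite ?lexx ?ler01.
  - move=> t ht; rewrite box1E leNgt (_ : (2 * h < `|t - c|)%R)//.
    rewrite -(ltrD2l `|c|) (lt_le_trans ht)//.
    by rewrite -{1}[t](subrK c) addrC ler_normD.
  - by move=> t; rewrite box1E; case: leP => [tc _|_]; [exact: beta|rewrite eqxx].
have mm : 0 <= mass h * mass e by rewrite mulr_ge0// ltW.
apply: (@le_trans _ _ (mass h * mass e * (eta * mass h) + mass h * mass e * (eta * (4 * h)))).
  by apply: lerD; apply: ler_wpM2l.
rewrite -mulrDr -mulrDr expr2.
rewrite [leRHS](_ : _ = mass h * mass e * (eta * (17 * mass h))); last by ring.
by rewrite ler_wpM2l// ler_wpM2l// mass_plus_le.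
Qed.

End PsiApprox.

Section Contraction.
Context {R : realType}.
Local Notation mu := (@lebesgue_measure R).
Local Notation mu2 := (@plane R).
Local Notation mu4 := (mu2 \x mu2)%E.
Variables (M : nat) (L V lip : R) (v : R -> R) (S : nat -> R -> R -> R) (tau : R).
Hypotheses (hM : (0 < M)%N) (hL : 0 < L) (hV : hypV L V v) (hS0 : hypS0 M L lip S)
  (htau : 0 < tau).
Local Notation sol := (solution M L v S tau).
Variables (u0 w0 : nat -> R -> R) (u w : nat -> R -> R -> R).
Hypotheses (hu : sol u0 u) (hw : sol w0 w).
Variable e : R.
Hypothesis e0 : 0 < e.

Definition spreads (t : R) : R :=
  \sum_(1 <= j < M.+1) spread e (fun x => ext (u j) (t, x)) (fun x => ext (w j) (t, x)).

Lemma spreads_pos_le (t1 t2 : R) : 0 < t1 -> t1 <= t2 -> spreads t2 <= spreads t1.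
Proof.
move=> t10 t12; apply/ler_addgt0Pr => eps eps0.
have me := mass_gt0 e0.
pose eta := eps / (2 * M%:R * mass e * 17).
have M0 : 0 < M%:R :> R by rewrite ltr0n.
have den : 0 < 2 * M%:R * mass e * 17 by rewrite !mulr_gt0.
have eta0 : 0 < eta by rewrite divr_gt0.
have cont j c : (1 <= j <= M)%N -> exists2 d : R, 0 < d & forall h, 0 < h -> h <= d ->
   (forall t, `|t - c| <= 2 * h -> \int[mu]_x `|ext (u j) (t, x) - ext (u j) (c, x)| <= eta) /\
   (forall t, `|t - c| <= 2 * h -> \int[mu]_x `|ext (w j) (t, x) - ext (w j) (c, x)| <= eta).
  move=> jM.
  have [d1 d10 hd1] := ext_continuous (sol_C0L1 hu jM) c eta0.
  have [d2 d20 hd2] := ext_continuous (sol_C0L1 hw jM) c eta0.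
  exists (Num.min d1 d2 / 4); first by rewrite divr_gt0// lt_min d10.
  move=> h h0 hd; have [m1 m2] : Num.min d1 d2 <= d1 /\ Num.min d1 d2 <= d2.
    by rewrite !ge_min !lexx orbT.
  by split=> t tc; [apply: hd1|apply: hd2]; apply: (lt_of_quarter tc hd).
have [d1 d10 hd1] := lanes_uniform (cont^~ t1).
have [d2 d20 hd2] := lanes_uniform (cont^~ t2).
pose h := Num.min (Num.min d1 d2) (t1 / 2).
have h0 : 0 < h by rewrite !lt_min d10 d20 divr_gt0.
have [hh1 hh2 hh3] : [/\ h <= d1, h <= d2 & h <= t1 / 2].
  by rewrite /h !ge_min !lexx !orbT.
have ht1 : h + h <= t1 by rewrite [t1]splitr lerD.
have mh := mass_gt0 h0.
have app1 j (jM : (1 <= j <= M)%N) := psi_approx (c := t1) (sol_C0L1 hu jM)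
  (sol_C0L1 hw jM) e0 h0 (hd1 h h0 hh1 j jM).1 (hd1 h h0 hh1 j jM).2.
have app2 j (jM : (1 <= j <= M)%N) := psi_approx (c := t2) (sol_C0L1 hu jM)
  (sol_C0L1 hw jM) e0 h0 (hd2 h h0 hh2 j jM).1 (hd2 h h0 hh2 j jM).2.
have key : 0 <= \sum_(1 <= j < M.+1 | (1 <= j <= M)%N)
     \int[mu4]_z (`|ext (u j) z.1 - ext (w j) z.2| * kern e h t1 z) -
   \sum_(1 <= j < M.+1 | (1 <= j <= M)%N)
     \int[mu4]_z (`|ext (u j) z.1 - ext (w j) z.2| * kern e h t2 z).
  rewrite -Int_sum; last by move=> j jM; exact: (app1 j jM).1.
  rewrite -Int_sum; last by move=> j jM; exact: (app2 j jM).1.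
  rewrite -IntB; last 2 first.
  - by apply: L1_sum => j jM; exact: (app1 j jM).1.
  - by apply: L1_sum => j jM; exact: (app2 j jM).1.
  have lU := L1_PhiU hL hV hS0 htau hu hw e0 h0 ht1 t12.
  have lW := L1_PhiW hL hV hS0 htau hu hw e0 h0 ht1 t12.
  apply: (@le_trans _ _ (\int[mu4]_z (PhiU M v S tau u w e h t1 t2 z + PhiW M v S tau u w e h t1 t2 z))).
    rewrite IntD// addr_ge0//.
      exact: (Int_PhiU_ge0 hL hV hS0 htau hu hw e0 h0 ht1 t12).
    exact: (Int_PhiW_ge0 hL hV hS0 htau hu hw e0 h0 ht1 t12).
  apply: Int_le; first exact: L1D.
    by apply: L1B; apply: L1_sum => j jM; [exact: (app1 j jM).1|exact: (app2 j jM).1].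
  move=> z.
  apply: (le_trans (Phi_le_Psi hM hL hS0 htau hu hw e h0 ht1 t12 z)).
  by rewrite -!sum_lanes_cond Psi_psi.
rewrite subr_ge0 in key.
rewrite -(ler_pM2l (exprn_gt0 2 mh)) /spreads.
have up j : (1 <= j <= M)%N -> mass h ^+ 2 * spread e (fun x => ext (u j) (t2, x)) (fun x => ext (w j) (t2, x)) <=
   \int[mu4]_z (`|ext (u j) z.1 - ext (w j) z.2| * kern e h t2 z) + mass h ^+ 2 * (mass e * 17 * eta).
  by move=> jM; have [_ /ler_distlCDr] := app2 j jM.
have dn j : (1 <= j <= M)%N -> \int[mu4]_z (`|ext (u j) z.1 - ext (w j) z.2| * kern e h t1 z) <=
   mass h ^+ 2 * spread e (fun x => ext (u j) (t1, x)) (fun x => ext (w j) (t1, x)) +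
    mass h ^+ 2 * (mass e * 17 * eta).
  by move=> jM; have [_ /ler_distlDr] := app1 j jM.
rewrite mulrDr !mulr_sumr !sum_lanes_cond.
apply: (le_trans (ler_sum _ up)); rewrite big_split/=.
apply: (le_trans (lerD key (lexx _))).
apply: (le_trans (lerD (ler_sum _ dn) (lexx _))); rewrite big_split/= -addrA lerD2l.
rewrite -!sum_lanes_cond !sumr_const_nat subSS subn0 -mulr_natl.
by rewrite le_eqVlt; apply/orP; left; apply/eqP; rewrite /eta; field; rewrite !lt0r_neq0.
Qed.

End Contraction.

Section TimeZero.
Context {R : realType}.
Local Notation mu := (@lebesgue_measure R).
Variables (M : nat) (L V lip : R) (v : R -> R) (S : nat -> R -> R -> R) (tau : R).
Hypotheses (hM : (0 < M)%N) (hL : 0 < L) (hV : hypV L V v) (hS0 : hypS0 M L lip S)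
  (htau : 0 < tau).
Local Notation sol := (solution M L v S tau).

Lemma lanes_continuous (u0 : nat -> R -> R) (u : nat -> R -> R -> R) (hu : sol u0 u)
    (c eta : R) : 0 < eta -> exists2 d : R, 0 < d & forall t, `|t - c| < d ->
  forall j, (1 <= j <= M)%N -> \int[mu]_x `|ext (u j) (t, x) - ext (u j) (c, x)| <= eta.
Proof.
move=> eta0.
have [d d0 hd] : exists2 d : R, 0 < d & forall h, 0 < h -> h <= d -> forall j, (1 <= j <= M)%N ->
    forall t, `|t - c| < h -> \int[mu]_x `|ext (u j) (t, x) - ext (u j) (c, x)| <= eta.
  apply: lanes_uniform => j jM; have [d d0 hd] := ext_continuous (sol_C0L1 hu jM) c eta0.
  by exists d => // h _ hh t tc; apply: hd; rewrite (lt_le_trans tc).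
by exists d => // t tc j jM; apply: (hd d d0 (lexx _) j jM).
Qed.

Lemma spreads_le (u0 w0 : nat -> R -> R) (u w : nat -> R -> R -> R) (e t : R) :
  sol u0 u -> sol w0 w -> 0 < e -> 0 <= t ->
  forall s, 0 <= s -> s <= t -> spreads M u w e t <= spreads M u w e s.
Proof.
move=> hu hw e0 t0 s s0 st.
move: s0; rewrite le_eqVlt => /predU1P[s0|s0]; last exact: (spreads_pos_le hM hL hV hS0 htau hu hw e0).
rewrite -{s}s0 in st *.
move: t0; rewrite le_eqVlt => /predU1P[<-//|t0].
apply/ler_addgt0Pr => eps eps0.
have me := mass_gt0 e0; have M0 : 0 < M%:R :> R by rewrite ltr0n.
pose eta := eps / (2 * M%:R * mass e).
have eta0 : 0 < eta by rewrite divr_gt0 ?mulr_gt0.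
have [d1 d10 hd1] := lanes_continuous hu 0 eta0.
have [d2 d20 hd2] := lanes_continuous hw 0 eta0.
pose r := Num.min (Num.min d1 d2 / 2) t.
have r0 : 0 < r by rewrite lt_min t0 andbT divr_gt0// lt_min d10.
have rd : r < d1 /\ r < d2.
  have : r <= Num.min d1 d2 / 2 by rewrite ge_min lexx.
  have : Num.min d1 d2 <= d1 by rewrite ge_min lexx.
  have : Num.min d1 d2 <= d2 by rewrite ge_min lexx orbT.
  by move: (Num.min d1 d2) => m ? ? ?; split; lra.
have rt : r <= t by rewrite ge_min lexx orbT.
apply: (le_trans (spreads_pos_le hM hL hV hS0 htau hu hw e0 r0 rt)).
have rr : `|r - 0| = r by rewrite subr0 gtr0_norm.
have step j : (1 <= j <= M)%N ->
  spread e (fun x => ext (u j) (r, x)) (fun x => ext (w j) (r, x)) <=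
  spread e (fun x => ext (u j) (0, x)) (fun x => ext (w j) (0, x)) + mass e * (eta + eta).
  move=> jM; have hj := sol_C0L1 hu jM; have hj' := sol_C0L1 hw jM.
  apply: (le_trans (spread_tri e0 (L1_ext hj r) (L1_ext hj' r) (L1_ext hj 0) (L1_ext hj' 0))).
  rewrite lerD2l ler_wpM2l ?(ltW me)//.
  by apply: lerD; [apply: hd1|apply: hd2]; rewrite ?rr//; case: rd.
rewrite /spreads !sum_lanes_cond; apply: (le_trans (ler_sum _ step)).
rewrite big_split/= lerD2l -sum_lanes_cond sumr_const_nat subSS subn0 -mulr_natl.
by rewrite le_eqVlt; apply/orP; left; apply/eqP; rewrite /eta; field; rewrite !lt0r_neq0.
Qed.

End TimeZero.

(** * Behaviour near the initial time *)

Section WeakEntropy.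
Context {R : realType}.
Local Notation mu := (@lebesgue_measure R).
Local Notation RT := (measurableTypeR R).
Local Notation mu2 := (@plane R).
Variables (M : nat) (L V lip : R) (v : R -> R) (S : nat -> R -> R -> R) (tau : R).
Hypotheses (hM : (0 < M)%N) (hL : 0 < L) (hV : hypV L V v) (hS0 : hypS0 M L lip S)
  (htau : 0 < tau).
Local Notation sol := (solution M L v S tau).
Variables (u0 : nat -> R -> R) (u : nat -> R -> R -> R).
Hypothesis (hu : sol u0 u).
Variables (A : R) (g g' : R -> R) (hg : C1c A g g') (k : nat -> R).
Hypothesis (kL : forall j, (1 <= j <= M)%N -> k j \in `[0, L]).

Definition excess := tau^-1 * \sum_(1 <= j < M.+1) `|rhs M S k j|.

Definition dist_k (p : RT * RT) : R :=
  \sum_(1 <= j < M.+1 | (1 <= j <= M)%N) `|ext (u j) p - k j|.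
Definition flux_k (p : RT * RT) : R :=
  \sum_(1 <= j < M.+1 | (1 <= j <= M)%N) kflux v (ext (u j) p) (k j).

Lemma measurable_dist_k : measurable_fun setT dist_k.
Proof.
apply: measurable_bigsum => j jM; apply: measurableT_comp => //.
by apply: measurable_funB; [exact: (measurable_U hu)|exact: measurable_cst].
Qed.

Lemma measurable_flux_k : measurable_fun setT flux_k.
Proof.
apply: measurable_bigsum => j jM; apply: measurable_funM.
  apply: measurable_sgr.
  by apply: measurable_funB; [exact: (measurable_U hu)|exact: measurable_cst].
apply: measurable_funB; last exact: measurable_cst.
apply: (measurable_flux hL hV); first exact: (measurable_U hu).
by move=> p; exact: (U_range hu).
Qed.

Lemma sum_lanes_const (c : R) : \sum_(1 <= j < M.+1 | (1 <= j <= M)%N) c = M%:R * c.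
Proof. by rewrite -sum_lanes_cond sumr_const_nat subSS subn0 mulr_natl. Qed.

Lemma dist_k_le p : `|dist_k p| <= M%:R * L.
Proof.
rewrite (le_trans (ler_norm_sum _ _ _))// -sum_lanes_const; apply: ler_sum => j jM.
by rewrite normr_id; apply: norm_itv; [exact: (U_range hu)|exact: kL].
Qed.

Lemma flux_k_le p : `|flux_k p| <= M%:R * (V * (L + L)).
Proof.
rewrite (le_trans (ler_norm_sum _ _ _))// -sum_lanes_const; apply: ler_sum => j jM.
have Uj := U_range hu p jM; have kj := kL jM.
rewrite (le_trans (kflux_norm hV Uj kj))// ler_wpM2l ?(V_ge0 hL hV)//.
by move: Uj kj; rewrite !in_itv/= => /andP[_ ?] /andP[_ ?]; exact: lerD.
Qed.

Lemma L1_bounded_kernel (f : RT * RT -> R) (C : R) (b : R -> R) (B D : R) :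
  measurable_fun setT f -> (forall p, `|f p| <= C) ->
  measurable_fun setT b -> (forall x, `|b x| <= D) -> (forall x, B < `|x| -> b x = 0) ->
  (forall t, L1 mu (fun x => f (t, x) * b x)) /\
  (forall a : R -> R, measurable_fun setT a -> (forall x, `|a x| <= D) ->
     (forall x, B < `|x| -> a x = 0) -> L1 mu2 (fun p => a p.1 * (f p * b p.2))).
Proof.
move=> mf fC mb bD bB.
have C0 : 0 <= C by rewrite (le_trans _ (fC (0, 0))).
split=> [t|a ma aD aB].
  apply: (@L1_compact_support _ _ B (C * D)).
  - by apply: measurable_funM => //; exact: measurableT_comp mf (pair1_measurable t).
  - by move=> x; rewrite normrM ler_pM.
  - by move=> x /bB ->; rewrite mulr0.
apply: (@L1_box _ (fun p => a p.1 * (f p * b p.2)) B (D * (C * D)) _ _ _).1.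
- apply: measurable_funM; first exact: measurableT_comp ma measurable_fst.
  by apply: measurable_funM => //; exact: measurableT_comp mb measurable_snd.
- by move=> p; rewrite !normrM ler_pM// ler_pM.
- by move=> p [/aB ->|/bB ->]; rewrite ?mul0r ?mulr0.
Qed.

Definition dist_g (t : R) : R := \int[mu]_x (dist_k (t, x) * g x).
Definition rate (t : R) : R := \int[mu]_x (flux_k (t, x) * g' x + excess * g x).

End WeakEntropy.

Section WeakEntropy.
Context {R : realType}.
Local Notation mu := (@lebesgue_measure R).
Local Notation RT := (measurableTypeR R).
Local Notation mu2 := (@plane R).
Variables (M : nat) (L V lip : R) (v : R -> R) (S : nat -> R -> R -> R) (tau : R).
Hypotheses (hM : (0 < M)%N) (hL : 0 < L) (hV : hypV L V v) (hS0 : hypS0 M L lip S)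
  (htau : 0 < tau).
Local Notation sol := (solution M L v S tau).
Local Notation EI := (entropy_integrand M v S tau).
Variables (u0 : nat -> R -> R) (u : nat -> R -> R -> R).
Hypothesis (hu : sol u0 u).
Variables (A : R) (g g' : R -> R) (hg : C1c A g g') (k : nat -> R).
Hypothesis (kL : forall j, (1 <= j <= M)%N -> k j \in `[0, L]).
Local Notation dk := (dist_k M u k).
Local Notation fk := (flux_k M v u k).
Local Notation exc := (excess M S tau k).
Local Notation dg := (dist_g M u g k).
Local Notation rt := (rate M v S tau u g g' k).
Local Notation data_g := (\sum_(1 <= j < M.+1 | (1 <= j <= M)%N) \int[mu]_x (`|u0 j x - k j| * g x)).

Lemma excess_ge0 : 0 <= exc.
Proof. by rewrite mulr_ge0 ?invr_ge0 ?(ltW htau)// sumr_ge0. Qed.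

Lemma source_le p : \sum_(1 <= j < M.+1 | (1 <= j <= M)%N)
    Num.sg (ext (u j) p - k j) * (tau^-1 * rhs M S (fun i => ext (u i) p) j) <= exc.
Proof.
rewrite /excess.
have -> : \sum_(1 <= j < M.+1 | (1 <= j <= M)%N)
    Num.sg (ext (u j) p - k j) * (tau^-1 * rhs M S (fun i => ext (u i) p) j) =
  tau^-1 * (\sum_(1 <= j < M.+1) Num.sg (ext (u j) p - k j) *
     (rhs M S (fun i => ext (u i) p) j - rhs M S k j) +
   \sum_(1 <= j < M.+1) Num.sg (ext (u j) p - k j) * rhs M S k j).
  rewrite -big_split/= mulr_sumr -sum_lanes_cond; apply: eq_bigr => j _.
  ring.
rewrite ler_wpM2l ?invr_ge0 ?(ltW htau)//.
have d := rhs_dissip hL hS0 hM (fun j jM => U_range hu p jM) kL.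
rewrite -[leRHS]add0r lerD//; apply: ler_sum => j _.
rewrite (le_trans (ler_norm _))// normrM ler_piMl//; exact: norm_sgr_le.
Qed.

Lemma data_L1 j : (1 <= j <= M)%N -> L1 mu (fun x => `|u0 j x - k j| * g x).
Proof.
move=> jM; have [mg _] := C1c_measurable hg; have [C C0 hC] := C1c_bounded hg.
apply: (@L1_compact_support _ _ A (L * C)).
- apply: measurable_funM => //; apply: measurableT_comp => //.
  by apply: measurable_funB; [exact: L1_measurable (sol_data_L1 hu jM)|exact: measurable_cst].
- move=> x; rewrite normrM ler_pM//; last by have [] := hC x.
  by rewrite normr_id; apply: norm_itv; [exact: (sol_data_range hu)|exact: kL].
- by move=> x /(C1c_out hg)[-> _]; rewrite mulr0.
Qed.

Lemma L1_slices : (forall t, L1 mu (fun x => dk (t, x) * g x)) /\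
  (forall t, L1 mu (fun x => fk (t, x) * g' x + exc * g x)).
Proof.
have [mg mg'] := C1c_measurable hg; have [C C0 hC] := C1c_bounded hg.
have [l1 _] := L1_bounded_kernel (measurable_dist_k hu k) (dist_k_le hu kL) mg
  (fun x => (hC x).1) (fun x h => (C1c_out hg h).1).
have [l2 _] := L1_bounded_kernel (measurable_flux_k hL hV hu k) (flux_k_le hL hV hu kL) mg'
  (fun x => (hC x).2) (fun x h => (C1c_out hg h).2).
split=> // t; apply: L1D => //; apply: L1Z.
apply: (@L1_compact_support _ _ A C) => //; first by move=> x; have [] := hC x.
by move=> x /(C1c_out hg)[].
Qed.

Lemma dist_g_continuous (c eta : R) : 0 < eta ->
  exists2 d, 0 < d & forall t, `|t - c| < d -> `|dg t - dg c| <= eta.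
Proof.
move=> eta0; have [C C0 hC] := C1c_bounded hg; have [sl _] := L1_slices.
pose C1 := C + 1; have C10 : 0 < C1 by rewrite ltr_wpDl.
have M0 : 0 < M%:R :> R by rewrite ltr0n.
pose eta1 := eta / (M%:R * C1).
have eta10 : 0 < eta1 by rewrite divr_gt0// mulr_gt0.
have [d d0 hd] := lanes_continuous hu c eta10.
exists d => // t tc; rewrite /dist_g -IntB//.
rewrite (le_trans (Int_norm (L1B (sl t) (sl c))))//.
have ln j : (1 <= j <= M)%N -> L1 mu (fun x => `|ext (u j) (t, x) - ext (u j) (c, x)|).
  by move=> jM; apply: L1_norm; apply: L1B; exact: (L1_ext (sol_C0L1 hu jM)).
have ls : L1 mu (fun x => \sum_(1 <= j < M.+1 | (1 <= j <= M)%N) `|ext (u j) (t, x) - ext (u j) (c, x)|).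
  exact: L1_sum.
apply: (@le_trans _ _ (C1 * \int[mu]_x \sum_(1 <= j < M.+1 | (1 <= j <= M)%N)
   `|ext (u j) (t, x) - ext (u j) (c, x)|)).
  rewrite -IntZ//; apply: Int_le; [by apply: L1_norm; exact: L1B|exact: L1Z|] => x.
  rewrite -mulrBl normrM mulrC; apply: ler_pM => //.
    by rewrite (le_trans (hC x).1)// lerDl.
  rewrite /dist_k -sumrB (le_trans (ler_norm_sum _ _ _))//; apply: ler_sum => j _.
  apply: (le_trans (ler_dist_dist _ _)).
  by rewrite opprB addrA subrK.
rewrite Int_sum//.
have le1 j : (1 <= j <= M)%N -> \int[mu]_x `|ext (u j) (t, x) - ext (u j) (c, x)| <= eta1.
  by move=> jM; exact: hd.
apply: (le_trans (ler_wpM2l (ltW C10) (ler_sum _ le1))).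
rewrite sum_lanes_const /eta1 le_eqVlt; apply/orP; left; apply/eqP.
by field; rewrite !lt0r_neq0.
Qed.

Section Time.
Variables (s h : R).
Hypotheses (h0 : 0 < h) (h1 : h <= 1) (hs : h <= s).
Local Notation f := (window h (-2) s).
Local Notation f' := (dwindow h (-2) s).

Lemma window0 : f 0 = mass h.
Proof.
have h0' := h0; have h1' := h1; have hs' := hs.
rewrite /window prim_mass//; last lra.
by rewrite prim0 ?subr0//; lra.
Qed.

Lemma window_pos (t : R) : 0 <= t -> f' t = - bump h (t - s) /\
  0 <= f t <= mass h * box1 (s + h) t.
Proof.
have h0' := h0; have h1' := h1; have hs' := hs; move=> t0.
have E1 : bump h (t - -2) = 0 by apply: (bump_supp h0 _).1; rewrite ger0_norm; lra.
have E2 : prim h (t - -2) = mass h by rewrite prim_mass//; lra.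
rewrite /dwindow /window E1 sub0r; split=> //.
rewrite E2 subr_ge0 prim_le//= box1E ger0_norm//.
have [ts|ts] := leP t (s + h); first by rewrite mulr1 lerBlDr lerDl prim_ge0.
by rewrite mulr0 prim_mass ?subrr//; lra.
Qed.

Lemma L1_time :
  L1 mu2 (fun p => - bump h (p.1 - s) * (dk p * g p.2)) /\
  L1 mu2 (fun p => past p.1 * f p.1 * (fk p * g' p.2 + exc * g p.2)).
Proof.
have h0' := h0; have h1' := h1; have hs' := hs.
have [mg mg'] := C1c_measurable hg; have [C C0 hC] := C1c_bounded hg.
pose B := Num.max A (s + h); pose D := 1 + C + mass h.
have mh := mass_gt0 h0.
have CD : C <= D by rewrite /D; lra.
have D1 : 1 <= D by rewrite /D; lra.
have mD : mass h <= D by rewrite /D; lra.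
have AB : A <= B by rewrite /B le_max lexx.
have sB : s + h <= B by rewrite /B le_max lexx orbT.
have gD x : `|g x| <= D by rewrite (le_trans (hC x).1).
have g'D x : `|g' x| <= D by rewrite (le_trans (hC x).2).
have gB x : B < `|x| -> g x = 0 by move=> /(le_lt_trans AB)/(C1c_out hg)[].
have g'B x : B < `|x| -> g' x = 0 by move=> /(le_lt_trans AB)/(C1c_out hg)[].
have [_ l1] := L1_bounded_kernel (measurable_dist_k hu k) (dist_k_le hu kL) mg gD gB.
have [_ l2] := L1_bounded_kernel (measurable_flux_k hL hV hu k) (flux_k_le hL hV hu kL) mg' g'D g'B.
have mb : measurable_fun setT (fun t : R => bump h (t - s)).
  exact: L1_measurable (L1_bump_shift s h0).
split.
  apply: (l1 (fun t => - bump h (t - s))).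
  - exact: measurableT_comp.
  - by move=> t; rewrite normrN (le_trans (norm_bump _ _)).
  - move=> t tB; rewrite (bump_supp h0 _).1 ?oppr0//.
    have := ler_normD (t - s) s; rewrite subrK (ger0_norm (_ : 0 <= s)); lra.
have mf : measurable_fun setT (fun t : R => past t * f t).
  apply: measurable_funM; first exact: measurable_past.
  apply: continuous_measurable_fun => t; apply/differentiable_continuous/derivable1_diffP.
  have ip c : is_derive t 1 (fun y => prim h (y - c)) (bump h (t - c)).
    by apply: is_derive_subr => y; exact: is_derive_prim.
  exact: (@ex_derive _ _ _ _ _ _ _ (is_deriveB (ip (-2)) (ip s))).
have fb t : `|past t * f t| <= mass h * box1 (s + h) t.
  rewrite pastE; case: (leP 0 t) => t0; last by rewrite mul0r normr0 mulr_ge0 ?box1_ge0// ltW.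
  by have [_ /andP[f0 f1]] := window_pos t0; rewrite mul1r ger0_norm.
have fD t : `|past t * f t| <= D.
  rewrite (le_trans (fb t))// (le_trans _ mD)// ler_piMr ?(ltW mh)//.
  by rewrite box1E; case: ifP.
have fB t : B < `|t| -> past t * f t = 0.
  move=> tB; apply/normr0_eq0/le_anti; rewrite normr_ge0 andbT (le_trans (fb t))//.
  have -> : box1 (s + h) t = 0 by rewrite box1E leNgt (le_lt_trans sB tB).
  by rewrite mulr0.
have lf := l2 _ mf fD fB.
have lgg : L1 mu g.
  by apply: (@L1_compact_support _ _ B D).
have lff : L1 mu (fun t => past t * f t).
  by apply: (@L1_compact_support _ _ B D).
have [lt _] := tensor lff lgg.
have -> : (fun p : RT * RT => past p.1 * f p.1 * (fk p * g' p.2 + exc * g p.2)) =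
  (fun p => past p.1 * f p.1 * (fk p * g' p.2) + exc * (past p.1 * f p.1 * g p.2)).
  by apply/funext => p; ring.
by apply: L1D => //; exact: L1Z.
Qed.

Lemma entropy_sum : 0 <= \int[mu2]_p
    (- bump h (p.1 - s) * (dk p * g p.2) +
     past p.1 * f p.1 * (fk p * g' p.2 + exc * g p.2)) +
  mass h * data_g.
Proof.
have [mg mg'] := C1c_measurable hg; have [C C0 hC] := C1c_bounded hg.
have h0' := h0; have h1' := h1; have hs' := hs.
pose B := Num.max A (Num.max (2 + h) (s + h)).
have hf : C1c B f f'.
  apply: C1c_window => //; first lra.
    by rewrite normrN normr_nat /B !le_max lexx orbT.
  by rewrite ger0_norm; [rewrite /B !le_max lexx !orbT|lra].
have hgB : C1c B g g' by apply: C1c_widen hg; rewrite /B le_max lexx.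
have E j (jM : (1 <= j <= M)%N) := entropy_X hL hV hS0 hu hf hgB jM (kL jM).
have lE : L1 mu2 (fun p => \sum_(1 <= j < M.+1 | (1 <= j <= M)%N)
    past p.1 * EI (fun j => ext (u j)) j (k j) f f' g g' p).
  by apply: L1_sum => j jM; exact: (E j jM).1.
have s0 : 0 <= \int[mu2]_p (\sum_(1 <= j < M.+1 | (1 <= j <= M)%N)
    past p.1 * EI (fun j => ext (u j)) j (k j) f f' g g' p) + mass h * data_g.
  rewrite Int_sum; last by move=> j jM; exact: (E j jM).1.
  rewrite mulr_sumr -big_split/=; apply: sumr_ge0 => j jM.
  have [_] := E j jM; rewrite window0 -IntZ; last exact: data_L1.
  by rewrite (Int_eq _ (fun x => mulrCA _ _ _)).
apply: (le_trans s0); rewrite lerD2r; apply: Int_le => //; last first.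
  move=> [t x]; rewrite -mulr_sumr pastE /=.
  case: (leP 0 t) => t0; last first.
    rewrite mul0r !mul0r addr0 (bump_supp h0 _).1 ?oppr0 ?mul0r//.
    by rewrite ler0_norm; lra.
  rewrite !mul1r; have [E1 /andP[f0 _]] := window_pos t0.
  rewrite /entropy_integrand /= !big_split/= E1 -!mulr_suml mulrDr.
  rewrite -addrA; apply: lerD.
    by rewrite le_eqVlt; apply/orP; left; apply/eqP; rewrite /dist_k; ring.
  apply: lerD.
    by rewrite le_eqVlt; apply/orP; left; apply/eqP; rewrite /flux_k; ring.
  rewrite [leRHS]mulrCA; apply: ler_wpM2r; first by rewrite mulr_ge0 ?(C1c_ge0 hg).
  exact: source_le.
exact: L1D (L1_time).1 (L1_time).2.
Qed.

Lemma dist_g_le (T C eta : R) : s + h <= T -> 0 <= C ->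
  (forall t, 0 <= t -> t <= T -> rt t <= C) ->
  (forall t, `|t - s| < h -> `|dg t - dg s| <= eta) ->
  dg s <= data_g + (s + h) * C + eta.
Proof.
have h0' := h0; have h1' := h1; have hs' := hs.
move=> sT C0 hrate hcont.
have [l1 l2] := L1_time; have [sl1 sl2] := L1_slices.
have mh := mass_gt0 h0.
have := entropy_sum; rewrite IntD//.
have sl1' t : L1 mu (fun x => - bump h (t - s) * (dk (t, x) * g x)) by apply: L1Z.
have sl2' t : L1 mu (fun x => past t * f t * (fk (t, x) * g' x + exc * g x)) by apply: L1Z.
rewrite (Int_prod l1 sl1') (Int_prod l2 sl2') => E.
have i1 : \int[mu]_t \int[mu]_x (- bump h (t - s) * (dk (t, x) * g x)) <=
    (eta - dg s) * mass h.
  rewrite -(Int_bump_shift s h0) -IntZ; last exact: L1_bump_shift.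
  apply: Int_le; [exact: (L1_Int_prod l1 sl1')|by apply: L1Z; exact: L1_bump_shift|].
  move=> t; rewrite IntZ// -/(dg t) mulNr mulrC -mulNr.
  have [ts|ts] := leP h `|t - s|; first by rewrite (bump_supp h0 ts).1 !mulr0.
  apply: ler_wpM2r; first exact: bump_ge0.
  by have := hcont t ts; rewrite ler_norml => /andP[? _]; lra.
have i2 : \int[mu]_t \int[mu]_x (past t * f t * (fk (t, x) * g' x + exc * g x)) <=
    C * mass h * (s + h).
  have -> : C * mass h * (s + h) = \int[mu]_t ((C * mass h) * \1_(`[0, s + h]%classic : set R) t).
    by rewrite Int_itv_cst ?subr0// addr_ge0// (le_trans (ltW h0)).
  apply: Int_le; [exact: (L1_Int_prod l2 sl2')|by apply: L1Z; exact: integrable_indic_itv|].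
  move=> t; rewrite IntZ// -/(rt t) pastE indicE mem_setE in_itv/=.
  case: (leP 0 t) => t0 /=; last by rewrite !mul0r mulr0.
  have [_] := window_pos t0; rewrite box1E ger0_norm//.
  have [ts|ts] := leP t (s + h); rewrite ?mulr1 ?mulr0 mul1r => /andP[f0 f1].
    apply: (@le_trans _ _ (f t * C)); last by rewrite mulrC ler_wpM2l.
    by apply: ler_wpM2l => //; apply: hrate => //; rewrite (le_trans ts).
  by have -> : f t = 0 by [apply/le_anti; rewrite f1]; rewrite mul0r.
rewrite -(ler_pM2r mh).
by move: E i1 i2; move: (\int[mu]_t _) (\int[mu]_t _) => I J; lra.
Qed.

End Time.

Lemma weak_entropy (s T C : R) : 0 < s -> s < T -> 0 <= C ->
  (forall t, 0 <= t -> t <= T -> rt t <= C) ->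
  dg s <= data_g + s * C.
Proof.
move=> s0 sT C0 hrate; apply/ler_addgt0Pr => eps eps0.
have e2 : 0 < eps / 2 by rewrite divr_gt0.
have [d d0 hd] := dist_g_continuous s e2.
pose h := Num.min (Num.min d 1) (Num.min s (Num.min (T - s) (eps / 2 / (C + 1)))).
have C1 : 0 < C + 1 by rewrite ltr_wpDl.
have h0 : 0 < h by rewrite !lt_min d0 ltr01 s0 subr_gt0 sT divr_gt0.
have [hd1 h1 hs [hT hC]] : [/\ h <= d, h <= 1, h <= s & h <= T - s /\ h <= eps / 2 / (C + 1)].
  by rewrite /h !ge_min !lexx !orbT.
have sT' : s + h <= T by lra.
apply: (le_trans (dist_g_le h0 h1 hs sT' C0 hrate (fun t tc => hd t (lt_le_trans tc hd1)))).
rewrite mulrDl -!addrA !lerD2l.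
have : h * C <= eps / 2.
  apply: (@le_trans _ _ (h * (C + 1))); first by rewrite ler_wpM2l ?(ltW h0)// lerDl.
  by rewrite -ler_pdivlMr.
by move=> hC'; rewrite [leRHS]splitr lerD2r.
Qed.

End WeakEntropy.

Section SpreadSym.
Context {R : realType}.
Local Notation mu := (@lebesgue_measure R).
Variable (e : R).
Hypothesis e0 : 0 < e.

Lemma L1_spread_l (f g : R -> R) : L1 mu f -> L1 mu g ->
  forall y, L1 mu (fun x => `|f x - g y| * bump e (x - y)).
Proof.
move=> lf lg y; have [_ /(_ y)] := L1_spread e0 lg lf.
by apply: L1_eq => x; rewrite distrC -bumpN opprB.
Qed.

Lemma spread_swapE (f g : R -> R) : L1 mu f -> L1 mu g ->
  spread e f g = \int[mu]_y \int[mu]_x (`|f x - g y| * bump e (x - y)).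
Proof.
move=> lf lg; have [l2 _] := L1_spread e0 lf lg.
by rewrite /spread (Int_prod_swap l2 (L1_spread_l lf lg)).
Qed.

Lemma spread_sym (f g : R -> R) : L1 mu f -> L1 mu g -> spread e f g = spread e g f.
Proof.
move=> lf lg; have [l2 sl] := L1_spread e0 lf lg.
rewrite (spread_swapE lg lf) /spread (Int_prod l2 sl).
apply: Int_eq => x; apply: Int_eq => y /=.
by rewrite distrC -bumpN opprB.
Qed.

Lemma L1_spread_int (f g : R -> R) : L1 mu f -> L1 mu g ->
  L1 mu (fun y => \int[mu]_x (`|f x - g y| * bump e (x - y))).
Proof.
move=> lf lg; have [l2 sl] := L1_spread e0 lg lf.
have := L1_Int_prod l2 sl; congr (L1 _ _); apply/funext => y; apply: Int_eq => x /=.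
by rewrite distrC -bumpN opprB.
Qed.

End SpreadSym.

Section Initial.
Context {R : realType}.
Local Notation mu := (@lebesgue_measure R).
Variables (M : nat) (L V lip : R) (v : R -> R) (S : nat -> R -> R -> R) (tau : R).
Hypotheses (hM : (0 < M)%N) (hL : 0 < L) (hV : hypV L V v) (hS0 : hypS0 M L lip S)
  (hS1 : hypS1 M L S) (htau : 0 < tau).
Local Notation sol := (solution M L v S tau).
Variables (u0 : nat -> R -> R) (u : nat -> R -> R -> R).
Hypothesis (hu : sol u0 u).

Lemma initial_le (A : R) (g g' : R -> R) (hg : C1c A g g') (k : nat -> R) :
  (forall j, (1 <= j <= M)%N -> k j \in `[0, L]) ->
  \sum_(1 <= j < M.+1 | (1 <= j <= M)%N) \int[mu]_x (`|ext (u j) (0, x) - k j| * g x) <=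
  \sum_(1 <= j < M.+1 | (1 <= j <= M)%N) \int[mu]_x (`|u0 j x - k j| * g x).
Proof.
move=> kL.
have [mg mg'] := C1c_measurable hg; have [D D0 hD] := C1c_bounded hg.
have V0 := V_ge0 hL hV.
have lg : L1 mu g.
  apply: (@L1_compact_support _ _ A D) => //; first by move=> x; have [] := hD x.
  by move=> x /(C1c_out hg)[].
have lg' : L1 mu g'.
  apply: (@L1_compact_support _ _ A D) => //; first by move=> x; have [] := hD x.
  by move=> x /(C1c_out hg)[].
have [sl1 sl2] := L1_slices hL hV hu hg kL (S := S) (tau := tau).
pose K := M%:R * (V * (L + L)).
have K0 : 0 <= K by rewrite !mulr_ge0// addr_ge0// ltW.
have ex0 := excess_ge0 M S htau k.
pose C := K * \int[mu]_x `|g' x| + excess M S tau k * \int[mu]_x g x.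
have C0 : 0 <= C.
  rewrite addr_ge0// mulr_ge0//; apply: Int_ge0 => x //; exact: (C1c_ge0 hg).
have hrate t : rate M v S tau u g g' k t <= C.
  rewrite /rate /C -!IntZ//; last exact: L1_norm.
  rewrite -IntD; [|by apply: L1Z; exact: L1_norm|exact: L1Z].
  apply: Int_le => //; first by apply: L1D; apply: L1Z => //; exact: L1_norm.
  move=> x; rewrite lerD2r (le_trans (ler_norm _))// normrM ler_wpM2r//.
  exact: (flux_k_le hL hV hu kL).
have E : \sum_(1 <= j < M.+1 | (1 <= j <= M)%N) \int[mu]_x (`|ext (u j) (0, x) - k j| * g x) =
    dist_g M u g k 0.
  rewrite /dist_g -Int_sum.
    by apply: Int_eq => x; rewrite /dist_k mulr_suml.
  move=> j jM; apply: (@L1_compact_support _ _ A (L * D)).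
  - apply: measurable_funM => //; apply: measurableT_comp => //.
    apply: measurable_funB; last exact: measurable_cst.
    exact: L1_measurable (L1_ext (sol_C0L1 hu jM) 0).
  - move=> x; rewrite normrM ler_pM//; last by have [] := hD x.
    by rewrite normr_id; apply: norm_itv; [exact: (U_range hu)|exact: kL].
  - by move=> x /(C1c_out hg)[-> _]; rewrite mulr0.
rewrite E; apply/ler_addgt0Pr => eps eps0.
have e2 : 0 < eps / 2 by rewrite divr_gt0.
have [d d0 hd] := dist_g_continuous hM hL hV hu hg kL 0 e2.
pose s := Num.min (d / 2) (eps / 2 / (C + 1)).
have C1 : 0 < C + 1 by rewrite ltr_wpDl.
have s0 : 0 < s by rewrite lt_min !divr_gt0.
have sd : s < d.
  by rewrite gt_min; apply/orP; left; rewrite ltr_pdivrMr// ltr_pMr// ltr1n.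
have sC : s * C <= eps / 2.
  apply: (@le_trans _ _ (s * (C + 1))); first by rewrite ler_wpM2l ?(ltW s0)// lerDl.
  by rewrite -ler_pdivlMr// ge_min lexx orbT.
have ss : s < s + 1 by rewrite ltrDl.
have h1 := weak_entropy hM hL hV hS0 htau hu hg kL s0 ss C0 (fun t _ _ => hrate t).
have /ler_distlCDr h2 : `|dist_g M u g k s - dist_g M u g k 0| <= eps / 2.
  by apply: hd; rewrite subr0 gtr0_norm.
apply: (le_trans h2); apply: (le_trans (lerD h1 (lexx _))).
by rewrite [eps in leRHS]splitr addrA lerD2r lerD2l.
Qed.

End Initial.

Section Mass.
Context {R : realType}.
Local Notation mu := (@lebesgue_measure R).
Variables (M : nat) (L V lip : R) (v : R -> R) (S : nat -> R -> R -> R) (tau : R).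
Hypotheses (hM : (0 < M)%N) (hL : 0 < L) (hV : hypV L V v) (hS0 : hypS0 M L lip S)
  (hS1 : hypS1 M L S) (htau : 0 < tau).
Local Notation F := (flux v).
Local Notation sol := (solution M L v S tau).
Variables (u0 : nat -> R -> R) (u : nat -> R -> R -> R).
Hypothesis (hu : sol u0 u).

Lemma initial_spread (e : R) : 0 < e ->
  spreads M u u e 0 <= \sum_(1 <= j < M.+1) spread e (u0 j) (u0 j).
Proof.
move=> e0.
pose U j x := ext (u j) (0, x).
have lU j : (1 <= j <= M)%N -> L1 mu (U j) by move=> jM; exact: (L1_ext (sol_C0L1 hu jM)).
have l0 j : (1 <= j <= M)%N -> L1 mu (u0 j) by move=> jM; exact: (sol_data_L1 hu jM).
have step (k : nat -> R -> R) :
    (forall j, (1 <= j <= M)%N -> forall y, k j y \in `[0, L]) ->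
    (forall j, (1 <= j <= M)%N -> L1 mu (k j)) ->
    \sum_(1 <= j < M.+1 | (1 <= j <= M)%N) spread e (U j) (k j) <=
    \sum_(1 <= j < M.+1 | (1 <= j <= M)%N) spread e (u0 j) (k j).
  move=> kL kl.
  under eq_bigr => j jM do rewrite (spread_swapE e0 (lU j jM) (kl j jM)).
  under [leRHS]eq_bigr => j jM do rewrite (spread_swapE e0 (l0 j jM) (kl j jM)).
  rewrite -Int_sum; last by move=> j jM; exact: (L1_spread_int e0 (lU j jM) (kl j jM)).
  rewrite -Int_sum; last by move=> j jM; exact: (L1_spread_int e0 (l0 j jM) (kl j jM)).
  apply: Int_le.
  - by apply: L1_sum => j jM; exact: (L1_spread_int e0 (lU j jM) (kl j jM)).
  - by apply: L1_sum => j jM; exact: (L1_spread_int e0 (l0 j jM) (kl j jM)).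
  move=> y; exact: (initial_le hM hL hV hS0 htau hu (C1c_bump e0 (lexx (`|y| + e)))
    (fun j jM => kL j jM y)).
rewrite /spreads !sum_lanes_cond.
apply: (le_trans (step U _ lU)).
  by move=> j jM y; exact: (U_range hu).
under eq_bigr => j jM do rewrite (spread_sym e0 (l0 j jM) (lU j jM)).
by apply: (step u0 _ l0) => j jM y; exact: (sol_data_range hu).
Qed.

Section WeakMass.
Variables (A : R) (g g' : R -> R) (hg : C1c A g g') (s T C : R).
Hypotheses (s0 : 0 < s) (sT : s < T) (C0 : 0 <= C).
Hypothesis hC : forall t, 0 <= t -> t <= T ->
  `|\int[mu]_x (\sum_(1 <= j < M.+1 | (1 <= j <= M)%N) F (ext (u j) (t, x)) * g' x)| <= C.

Let S0 : forall c, c \in `[0, L] -> excess M S tau (fun=> c) = 0.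
Proof.
move=> c cL; rewrite /excess big1 ?mulr0// => j _.
by rewrite /rhs !(exchange_diag hL hS0 hS1)// subrr normr0.
Qed.

Let lg : L1 mu g.
Proof.
have [mg _] := C1c_measurable hg; have [D D0 hD] := C1c_bounded hg.
apply: (@L1_compact_support _ _ A D) => //; first by move=> x; have [] := hD x.
by move=> x /(C1c_out hg)[].
Qed.

Lemma L1_mul_g (f : R -> R) : L1 mu f -> L1 mu (fun x => f x * g x).
Proof.
move=> lf; have [mg _] := C1c_measurable hg; have [D D0 hD] := C1c_bounded hg.
apply: (L1_dom _ (L1Z D (L1_norm lf))).
  by apply: measurable_funM => //; exact: L1_measurable lf.
by move=> x; rewrite normrM mulrC; apply: ler_wpM2r => //; have [] := hD x.
Qed.

Let flux0 : F 0 = 0. Proof. by rewrite /flux mul0r. Qed.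
Let fluxL : F L = 0. Proof. by rewrite /flux (hypV_L hV) mulr0. Qed.

Lemma weak_mass :
  `|\sum_(1 <= j < M.+1 | (1 <= j <= M)%N) \int[mu]_x (ext (u j) (s, x) * g x) -
    \sum_(1 <= j < M.+1 | (1 <= j <= M)%N) \int[mu]_x (u0 j x * g x)| <= s * C.
Proof.
have h0 : (0 : R) \in `[0, L] by rewrite in_itv/= lexx ltW.
have hLL : L \in `[0, L] by rewrite in_itv/= lexx ltW.
have lU j t (jM : (1 <= j <= M)%N) := L1_ext (sol_C0L1 hu jM) t.
have l0 j (jM : (1 <= j <= M)%N) := sol_data_L1 hu jM.
have Ur j p (jM : (1 <= j <= M)%N) : 0 <= ext (u j) p <= L.
  by have := U_range hu p jM; rewrite in_itv.
have U0r j x (jM : (1 <= j <= M)%N) : 0 <= u0 j x <= L.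
  by have := sol_data_range hu jM x; rewrite in_itv.
have up : \sum_(1 <= j < M.+1 | (1 <= j <= M)%N) \int[mu]_x (ext (u j) (s, x) * g x) <=
    \sum_(1 <= j < M.+1 | (1 <= j <= M)%N) \int[mu]_x (u0 j x * g x) + s * C.
  have hr t : 0 <= t -> t <= T -> rate M v S tau u g g' (fun=> 0) t <= C.
    move=> t0 tT; apply: le_trans (hC t0 tT); apply: le_trans (ler_norm _).
    rewrite le_eqVlt; apply/orP; left; apply/eqP; apply: Int_eq => x.
    rewrite S0// mul0r addr0 /flux_k mulr_suml; apply: eq_bigr => j jM; congr (_ * _).
    rewrite /kflux flux0 !subr0.
    have /andP[U0 _] := Ur j (t, x) jM; move: U0; rewrite le_eqVlt => /predU1P[<-|U0].
      by rewrite flux0 mulr0.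
    by rewrite gtr0_sg// mul1r.
  have := weak_entropy hM hL hV hS0 htau hu hg (fun _ _ => h0) s0 sT C0 hr.
  rewrite /dist_g.
  have -> : \int[mu]_x (dist_k M u (fun=> 0) (s, x) * g x) =
      \sum_(1 <= j < M.+1 | (1 <= j <= M)%N) \int[mu]_x (ext (u j) (s, x) * g x).
    rewrite -Int_sum; last by move=> j jM; apply: L1_mul_g; exact: lU.
    apply: Int_eq => x; rewrite /dist_k mulr_suml; apply: eq_bigr => j jM.
    by rewrite subr0 ger0_norm//; have /andP[] := Ur j (s, x) jM.
  have -> : \sum_(1 <= j < M.+1 | (1 <= j <= M)%N) \int[mu]_x (`|u0 j x - 0| * g x) =
      \sum_(1 <= j < M.+1 | (1 <= j <= M)%N) \int[mu]_x (u0 j x * g x).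
    apply: eq_bigr => j jM; apply: Int_eq => x; rewrite subr0 ger0_norm//.
    by have /andP[] := U0r j x jM.
  by [].
have dn : \sum_(1 <= j < M.+1 | (1 <= j <= M)%N) \int[mu]_x (u0 j x * g x) <=
    \sum_(1 <= j < M.+1 | (1 <= j <= M)%N) \int[mu]_x (ext (u j) (s, x) * g x) + s * C.
  have hr t : 0 <= t -> t <= T -> rate M v S tau u g g' (fun=> L) t <= C.
    move=> t0 tT; apply: le_trans (hC t0 tT); rewrite -normrN; apply: le_trans (ler_norm _).
    rewrite le_eqVlt; apply/orP; left; apply/eqP; rewrite -IntN.
      apply: Int_eq => x.
      rewrite S0// mul0r addr0 /flux_k mulr_suml -sumrN; apply: eq_bigr => j jM.
      rewrite -mulNr; congr (_ * _).
      rewrite /kflux fluxL !subr0.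
      have /andP[_ UL] := Ur j (t, x) jM; move: UL; rewrite le_eqVlt => /predU1P[->|UL].
        by rewrite fluxL mulr0 oppr0.
      by rewrite ltr0_sg ?subr_lt0// mulN1r.
    have [mg mg'] := C1c_measurable hg; have [D D0 hD] := C1c_bounded hg.
    apply: L1_sum => j jM; apply: (@L1_compact_support _ _ A (V * L * D)).
    - apply: measurable_funM => //; apply: (measurable_flux hL hV).
        exact: L1_measurable (lU j t jM).
      by move=> x; exact: (U_range hu).
    - move=> x; rewrite normrM ler_pM//; last by have [] := hD x.
      rewrite (le_trans (flux_norm hV (U_range hu (t, x) jM)))// ler_wpM2l ?(V_ge0 hL hV)//.
      by have /andP[] := Ur j (t, x) jM.
    - by move=> x /(C1c_out hg)[_ ->]; rewrite mulr0.
  have := weak_entropy hM hL hV hS0 htau hu hg (fun _ _ => hLL) s0 sT C0 hr.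
  rewrite /dist_g.
  have -> : \int[mu]_x (dist_k M u (fun=> L) (s, x) * g x) =
      \sum_(1 <= j < M.+1 | (1 <= j <= M)%N) (L * \int[mu]_x g x - \int[mu]_x (ext (u j) (s, x) * g x)).
    have Ej j : (1 <= j <= M)%N -> L * \int[mu]_x g x - \int[mu]_x (ext (u j) (s, x) * g x) =
        \int[mu]_x (L * g x - ext (u j) (s, x) * g x).
      by move=> jM; rewrite IntB; [rewrite IntZ|exact: L1Z|exact: L1_mul_g (lU j s jM)].
    rewrite (eq_bigr _ Ej) -Int_sum; last by move=> j jM; apply: L1B; [exact: L1Z|exact: L1_mul_g (lU j s jM)].
    apply: Int_eq => x; rewrite /dist_k mulr_suml; apply: eq_bigr => j jM.
    by rewrite -mulrBl ler0_norm ?opprB// subr_le0; have /andP[] := Ur j (s, x) jM.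
  have -> : \sum_(1 <= j < M.+1 | (1 <= j <= M)%N) \int[mu]_x (`|u0 j x - L| * g x) =
      \sum_(1 <= j < M.+1 | (1 <= j <= M)%N) (L * \int[mu]_x g x - \int[mu]_x (u0 j x * g x)).
    apply: eq_bigr => j jM; rewrite -IntZ// -IntB; [|exact: L1Z|exact: L1_mul_g (l0 j jM)].
    apply: Int_eq => x.
    by rewrite -mulrBl ler0_norm ?opprB// subr_le0; have /andP[] := U0r j x jM.
  rewrite !sumrB; move: (\sum_(_ <= _ < _ | _) _ ) (\sum_(_ <= _ < _ | _) _) (\sum_(_ <= _ < _ | _) _) => a b c.
  by rewrite -addrA lerD2l lerNl opprD opprK lerBlDr addrC.
rewrite ler_norml; apply/andP; split; first by rewrite lerBrDr addrC lerBlDr.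
by rewrite lerBlDl.
Qed.

End WeakMass.
End Mass.

Lemma Int_dominated_cvg d (T : measurableType d) (R : realType)
    (m : {measure set T -> \bar R}) (f_ : nat -> T -> R) (f g : T -> R) :
  (forall n, measurable_fun setT (f_ n)) -> measurable_fun setT f -> L1 m g ->
  (forall x, f_ n x @[n --> \oo] --> f x) -> (forall n x, `|f_ n x| <= g x) ->
  \int[m]_x f_ n x @[n --> \oo] --> \int[m]_x f x.
Proof.
move=> mf_ mf lg cv fg.
have lf_ n : L1 m (f_ n) by apply: (L1_dom _ lg).
have [||||| lf _ h] := @dominated_convergence _ T R m setT measurableT
  (fun n x => (f_ n x)%:E) (EFin \o f) (EFin \o g).
- by move=> n; apply/measurable_EFinP.
- exact/measurable_EFinP.
- by apply: aeW => x _; apply: cvg_EFin; [exact: nearW|exact: cv].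
- exact: lg.
- by apply: aeW => x n _ /=; rewrite lee_fin.
have h2 : (\int[m]_x f_ n x)%:E @[n --> \oo] --> (\int[m]_x f x)%:E.
  rewrite (EFin_Int lf).
  have -> : (fun n => (\int[m]_x f_ n x)%:E) = (fun n => (\int[m]_x (f_ n x)%:E)%E).
    by apply/funext => n; rewrite EFin_Int.
  exact: h.
exact: (fine_cvg h2).
Qed.

Section Cutoff.
Context {R : realType}.
Local Notation mu := (@lebesgue_measure R).

Lemma L1_mul_bump (f : R -> R) (N a : R) : L1 mu f -> L1 mu (fun x => f x * bump N (x - a)).
Proof.
move=> lf; apply: (L1_dom _ (L1_norm lf)).
  apply: measurable_funM; first exact: L1_measurable lf.
  by apply: (measurableT_comp (measurable_bump N)); exact: measurable_funB.
by move=> x; rewrite normrM ler_piMr// norm_bump.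
Qed.

Lemma Int_bump_cvg (f : R -> R) : L1 mu f ->
  (\int[mu]_x (f x * bump n.+1%:R x)) @[n --> \oo] --> \int[mu]_x f x.
Proof.
move=> lf; have mf := L1_measurable lf.
apply: (@Int_dominated_cvg _ _ _ mu _ f (fun x => `|f x|)) => //.
- by move=> n; apply: measurable_funM => //; exact: measurable_bump.
- exact: L1_norm.
- move=> x; rewrite -[X in _ --> X]mulr1; apply: cvgM; first exact: cvg_cst.
  have hx : (x * n.+1%:R^-1 : R) @[n --> \oo] --> (x * 0 : R).
    apply: cvgM; [exact: cvg_cst|exact: cvg_harmonic].
  have b0 : bump 1 (x * 0) = 1 :> R.
    by rewrite /bump mulr0 mul0r expr0n/= subr0 (max_idPl ler01) expr1n.
  have := cvg_comp _ _ hx (@continuous_bump R 1 (x * 0)); rewrite b0.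
  by apply: cvg_trans; apply: near_eq_cvg; apply: nearW => n; rewrite /= /bump divr1.
- by move=> n x; rewrite normrM ler_piMr// norm_bump.
Qed.

Lemma Int_bump_tail (f : R -> R) (eta : R) : L1 mu f -> 0 < eta ->
  exists2 N : R, 1 <= N & \int[mu]_x f x - eta <= \int[mu]_x (f x * bump N x).
Proof.
move=> lf eta0; have /cvgrPdist_le /(_ _ eta0) [n _ /(_ n (leqnn _))] := Int_bump_cvg lf.
rewrite ler_norml => /andP[_ h]; exists n.+1%:R; first by rewrite ler1n.
by rewrite lerBlDr addrC -lerBlDr.
Qed.

End Cutoff.

Section MassLanes.
Context {R : realType}.
Local Notation mu := (@lebesgue_measure R).
Variables (M : nat) (L V lip : R) (v : R -> R) (S : nat -> R -> R -> R) (tau : R).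
Hypotheses (hM : (0 < M)%N) (hL : 0 < L) (hV : hypV L V v) (hS0 : hypS0 M L lip S)
  (hS1 : hypS1 M L S) (htau : 0 < tau).
Local Notation F := (flux v).
Local Notation sol := (solution M L v S tau).
Variables (u0 : nat -> R -> R) (u : nat -> R -> R -> R).
Hypothesis (hu : sol u0 u).

Lemma flux_sum_le (t x : R) :
  `|\sum_(1 <= j < M.+1 | (1 <= j <= M)%N) F (ext (u j) (t, x))| <=
  V * \sum_(1 <= j < M.+1 | (1 <= j <= M)%N) ext (u j) (t, x).
Proof.
rewrite mulr_sumr; apply: le_trans (ler_norm_sum _ _ _) _; apply: ler_sum => j jM.
exact: (flux_norm hV (U_range hu (t, x) jM)).
Qed.

Lemma lanes_bounded (T : R) : exists2 B : R, 0 <= B & forall t, 0 <= t -> t <= T ->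
  \int[mu]_x (\sum_(1 <= j < M.+1 | (1 <= j <= M)%N) ext (u j) (t, x)) <= B.
Proof.
have [|d d0 hd] := @lanes_uniform R M
    (fun j h => forall t, 0 <= t -> t <= T -> \int[mu]_x ext (u j) (t, x) <= h^-1).
  move=> j jM; have [C C0 hC] := ext_bounded (sol_C0L1 hu jM) `|T|.
  have C1 : 0 < C + 1 by rewrite ltr_pwDr.
  exists (C + 1)^-1; rewrite ?invr_gt0// => h h0 hh t t0 tT.
  apply: (le_trans (hC t _)); first by rewrite ger0_norm ?(le_trans tT (ler_norm T)).
  apply: (@le_trans _ _ (C + 1)); first by rewrite lerDl.
  by rewrite -[C + 1]invrK lef_pV2// posrE invr_gt0.
exists (M%:R * d^-1); first by rewrite mulr_ge0// invr_ge0 ltW.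
move=> t t0 tT.
rewrite Int_sum; last by move=> j jM; exact: (L1_ext (sol_C0L1 hu jM)).
rewrite -sum_lanes_const; apply: ler_sum => j jM; exact: (hd d d0 (lexx _) j jM t t0 tT).
Qed.

Lemma L1_flux_dbump (N a t : R) : 0 < N ->
  L1 mu (fun x => \sum_(1 <= j < M.+1 | (1 <= j <= M)%N) F (ext (u j) (t, x)) * dbump N (x - a)).
Proof.
move=> N0.
apply: L1_sum => j jM; apply: (L1_dom _ (L1Z (V * (4 / N)) (L1_ext (sol_C0L1 hu jM) t))).
  apply: measurable_funM; last first.
    by apply: (measurableT_comp (measurable_dbump N)); exact: measurable_funB.
  apply: (measurable_flux hL hV); first exact: L1_measurable (L1_ext (sol_C0L1 hu jM) t).
  by move=> x; exact: (U_range hu).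
move=> x; rewrite normrM (mulrAC V); apply: ler_pM => //; last exact: dbump_le.
exact: (flux_norm hV (U_range hu (t, x) jM)).
Qed.

Lemma flux_bump_le (N a t B : R) : 0 < N ->
  \int[mu]_x (\sum_(1 <= j < M.+1 | (1 <= j <= M)%N) ext (u j) (t, x)) <= B ->
  `|\int[mu]_x (\sum_(1 <= j < M.+1 | (1 <= j <= M)%N) F (ext (u j) (t, x)) * dbump N (x - a))|
    <= V * B * (4 / N).
Proof.
move=> N0 hB.
have lU : L1 mu (fun x => \sum_(1 <= j < M.+1 | (1 <= j <= M)%N) ext (u j) (t, x)).
  by apply: L1_sum => j jM; exact: (L1_ext (sol_C0L1 hu jM)).
have V0 := V_ge0 hL hV.
have N4 : 0 <= 4 / N by rewrite divr_ge0// ltW.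
have bd x : `|\sum_(1 <= j < M.+1 | (1 <= j <= M)%N) F (ext (u j) (t, x)) * dbump N (x - a)| <=
    V * (4 / N) * \sum_(1 <= j < M.+1 | (1 <= j <= M)%N) ext (u j) (t, x).
  rewrite -mulr_suml normrM (mulrAC V); apply: ler_pM => //; first exact: flux_sum_le.
  exact: dbump_le.
have lf := L1_flux_dbump a t N0.
apply: (le_trans (Int_norm lf)).
apply: (le_trans (Int_le (L1_norm lf) (L1Z _ lU) bd)).
by rewrite IntZ// (mulrAC V B) ler_wpM2l// mulr_ge0.
Qed.

Lemma mass_eq (s : R) : 0 < s ->
  \sum_(1 <= j < M.+1 | (1 <= j <= M)%N) \int[mu]_x ext (u j) (s, x) =
  \sum_(1 <= j < M.+1 | (1 <= j <= M)%N) \int[mu]_x u0 j x.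
Proof.
move=> s0.
have [B B0 hB] := lanes_bounded (s + 1).
have V0 := V_ge0 hL hV.
have cv (f : nat -> R -> R) (lf : forall j, (1 <= j <= M)%N -> L1 mu (f j)) :
    \sum_(1 <= j < M.+1 | (1 <= j <= M)%N) \int[mu]_x (f j x * bump n.+1%:R x) @[n --> \oo] -->
    \sum_(1 <= j < M.+1 | (1 <= j <= M)%N) \int[mu]_x f j x.
  rewrite -(Int_sum _ lf).
  have -> : (fun n => \sum_(1 <= j < M.+1 | (1 <= j <= M)%N) \int[mu]_x (f j x * bump n.+1%:R x)) =
     (fun n => \int[mu]_x ((\sum_(1 <= j < M.+1 | (1 <= j <= M)%N) f j x) * bump n.+1%:R x)).
    apply/funext => n; rewrite -Int_sum.
      by apply: Int_eq => x; rewrite mulr_suml.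
    move=> j jM; have := L1_mul_bump n.+1%:R 0 (lf j jM).
    by under eq_fun do rewrite subr0.
  by apply: Int_bump_cvg; exact: L1_sum.
have d := cvgB (cv (fun j x => ext (u j) (s, x)) (fun j jM => L1_ext (sol_C0L1 hu jM) s))
  (cv u0 (fun j jM => sol_data_L1 hu jM)).
apply/eqP; rewrite -subr_eq0 -normr_eq0.
have d1 := cvg_norm (d _).
have d2 : s * (V * B * 4) * n.+1%:R^-1 @[n --> \oo] --> (s * (V * B * 4) * 0 : R).
  by apply: cvgM; [exact: cvg_cst|exact: cvg_harmonic].
rewrite mulr0 in d2.
rewrite eq_le normr_ge0 andbT.
apply: (ler_cvg_to (d1 _ _) d2); apply: nearW => n /=.
have n0 : 0 < n.+1%:R :> R by [].
have hg := C1c_bump n0 (lexx (`|0| + n.+1%:R)).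
have := @weak_mass R M L V lip v S tau hM hL hV hS0 hS1 htau u0 u hu _ _ _ hg s (s + 1)
  (V * B * (4 / n.+1%:R)) s0 _ _ _.
rewrite ltrDl ltr01 mulr_ge0 ?divr_ge0 ?mulr_ge0//.
move=> /(_ isT isT).
under eq_bigr do (under eq_Rintegral do rewrite subr0).
under [X in _ - X]eq_bigr do (under eq_Rintegral do rewrite subr0).
rewrite -(mulrA s) -(mulrA (V * B)); apply.
by move=> t t0 ts; apply: flux_bump_le => //; exact: hB.
Qed.

Lemma weak_close (N a s : R) : 0 < N -> 0 < s ->
  `|\sum_(1 <= j < M.+1 | (1 <= j <= M)%N) \int[mu]_x (ext (u j) (s, x) * bump N (x - a)) -
    \sum_(1 <= j < M.+1 | (1 <= j <= M)%N) \int[mu]_x (u0 j x * bump N (x - a))| <=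
  s * (8 * (M%:R * V * L)).
Proof.
move=> N0 s0; have V0 := V_ge0 hL hV.
apply: (weak_mass hM hL hV hS0 hS1 htau hu (C1c_bump N0 (lexx (`|a| + N))) s0 (T := s + 1)).
- by rewrite ltrDl.
- by rewrite !mulr_ge0// ltW.
move=> t _ _.
pose c := M%:R * V * L * (4 / N).
have c0 : 0 <= c by rewrite !mulr_ge0// ?invr_ge0 ltW.
have N4 : 0 <= 4 / N by rewrite divr_ge0// ltW.
pose b x := c * \1_(`[a - N, a + N]%classic : set R) x.
have lb : L1 mu b.
  apply: (@L1_compact_support _ _ (`|a| + N) c).
  - by apply: measurable_funM => //; exact: measurable_indic.
  - move=> x; rewrite /b normrM (ger0_norm c0) -[leRHS]mulr1; apply: ler_wpM2l => //.
    by rewrite indicE; case: (_ \in _); rewrite ?normr1 ?normr0.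
  move=> x xa; rewrite /b indicE memNset ?mulr0//= in_itv/= => /andP[h1 h2].
  move: xa; rewrite ltNge => /negP; apply.
  have -> : x = a + (x - a) by rewrite addrC subrK.
  by apply: le_trans (ler_normD _ _) _; rewrite lerD2l ler_norml lerBrDr lerBlDr (addrC (- N)) (addrC N) h1 h2.
have bd x : `|\sum_(1 <= j < M.+1 | (1 <= j <= M)%N) F (ext (u j) (t, x)) * dbump N (x - a)| <= b x.
  rewrite -mulr_suml normrM /b.
  have [xa|xa] := leP N `|x - a|.
    by rewrite (bump_supp N0 xa).2 normr0 mulr0 mulr_ge0.
  rewrite indicE mem_set; last first.
    move: xa; rewrite ltr_norml => /andP[h1 h2] /=; rewrite in_itv/=.
    by apply/andP; split; apply: ltW; [rewrite -ltrBrDl|rewrite -ltrBlDl].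
  rewrite mulr1; apply: ler_pM => //; last exact: dbump_le.
  apply: (le_trans (flux_sum_le t x)); rewrite -mulrA (mulrCA M%:R) ler_wpM2l//.
  rewrite -sum_lanes_const; apply: ler_sum => j jM.
  by have := U_range hu (t, x) jM; rewrite in_itv/= => /andP[].
have lf : L1 mu (fun x => \sum_(1 <= j < M.+1 | (1 <= j <= M)%N) F (ext (u j) (t, x)) * dbump N (x - a)).
  exact: L1_flux_dbump.
apply: (le_trans (Int_norm lf)).
apply: (le_trans (Int_le (L1_norm lf) lb bd)).
rewrite /b Int_itv_cst; last by rewrite lerBlDr -addrA lerDl addr_ge0// ltW.
rewrite /c opprB addrACA [X in _ * X](_ : _ = 2 * N); last by ring.
by rewrite -!mulrA le_eqVlt; apply/orP; left; apply/eqP; field; rewrite gt_eqF.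
Qed.

End MassLanes.

Section Mollify.
Context {R : realType}.
Local Notation mu := (@lebesgue_measure R).
Local Notation RT := (measurableTypeR R).
Local Notation mu2 := (@plane R).
Variable (e : R).
Hypothesis e0 : 0 < e.

Lemma spread_sum (s : seq nat) (P : pred nat) (f : nat -> R -> R) :
  (forall j, P j -> L1 mu (f j)) ->
  spread e (fun x => \sum_(j <- s | P j) f j x) (fun x => \sum_(j <- s | P j) f j x) <=
  \sum_(j <- s | P j) spread e (f j) (f j).
Proof.
move=> lf; have ls : L1 mu (fun x => \sum_(j <- s | P j) f j x) by exact: L1_sum.
have lj j : P j -> L1 mu2 (fun p : RT * RT => `|f j p.1 - f j p.2| * bump e (p.1 - p.2)).
  by move=> Pj; have [] := L1_spread e0 (lf j Pj) (lf j Pj).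
rewrite /spread -Int_sum//; apply: Int_le.
- by have [] := L1_spread e0 ls ls.
- exact: L1_sum.
move=> p; rewrite -mulr_suml ler_wpM2r ?bump_ge0// -sumrB; exact: ler_norm_sum.
Qed.

Lemma mollify_dist (f g : R -> R) (N C : R) : 0 < N -> L1 mu f -> L1 mu g ->
  (forall x, `|\int[mu]_y (f y * bump e (y - x)) - \int[mu]_y (g y * bump e (y - x))| <= C) ->
  mass e * \int[mu]_x (`|f x - g x| * bump N x) <=
  spread e f f + spread e g g + C * mass N.
Proof.
move=> N0 lf lg hC.
have [lff sff] := L1_spread e0 lf lf; have [lgg sgg] := L1_spread e0 lg lg.
have C0 : 0 <= C by apply: le_trans (hC 0).
have lb := L1_bump N0.
have la : L1 mu (fun x => `|f x - g x| * bump N x).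
  have := L1_mul_bump N 0 (L1_norm (L1B lf lg)); by under eq_fun do rewrite subr0.
rewrite -IntZ// /spread (Int_prod lff sff) (Int_prod lgg sgg).
have lF := L1_Int_prod lff sff; have lG := L1_Int_prod lgg sgg.
rewrite -IntD// /mass -IntZ// -IntD//; [|exact: L1D|exact: L1Z].
apply: Int_le; [exact: L1Z|by apply: L1D; [exact: L1D|exact: L1Z]|move=> x /=].
set A := \int[mu]_y (`|f x - f y| * _); set B := \int[mu]_y (`|g x - g y| * _).
have A0 : 0 <= A by apply: Int_ge0 => y; rewrite mulr_ge0 ?bump_ge0.
have B0 : 0 <= B by apply: Int_ge0 => y; rewrite mulr_ge0 ?bump_ge0.
have bx y : bump e (x - y) = bump e (y - x) by rewrite -bumpN opprB.
suff h : mass e * `|f x - g x| <= A + B + C.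
  rewrite mulrA; apply: (le_trans (ler_wpM2r (bump_ge0 _ _) h)).
  rewrite [leLHS]mulrDl lerD2r ler_piMr ?addr_ge0//; exact: bump_le1.
have lfx : L1 mu (fun y => f y * bump e (y - x)) by exact: L1_mul_bump.
have lgx : L1 mu (fun y => g y * bump e (y - x)) by exact: L1_mul_bump.
have lbx : L1 mu (fun y => bump e (y - x)).
  have := C1c_measurable (C1c_bump e0 (lexx (`|x| + e))) => -[mb _].
  apply: (@L1_compact_support _ _ (`|x| + e) 1) => //; first by move=> y; exact: norm_bump.
  by move=> y /(C1c_out (C1c_bump e0 (lexx (`|x| + e))))[].
have dev (h : R -> R) : L1 mu (fun y => h y * bump e (y - x)) ->
    L1 mu (fun y => `|h x - h y| * bump e (x - y)) ->
    `|mass e * h x - \int[mu]_y (h y * bump e (y - x))| <=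
    \int[mu]_y (`|h x - h y| * bump e (x - y)).
  move=> l1 l2; rewrite -(Int_bump_shift x e0) mulrC -IntZ// -IntB//; last exact: L1Z.
  have l3 : L1 mu (fun y => h x * bump e (y - x) - h y * bump e (y - x)).
    by apply: L1B => //; exact: L1Z.
  apply: (le_trans (Int_norm l3)); apply: Int_le => //; first exact: L1_norm.
  by move=> y; rewrite -mulrBl normrM (ger0_norm (bump_ge0 _ _)) bx.
have dA := dev _ lfx (sff x); have dB := dev _ lgx (sgg x); have dC := hC x.
rewrite -{1}(ger0_norm (ltW (mass_gt0 e0))) -normrM mulrBr.
move: dA dB dC; rewrite -/A -/B.
move: (\int[mu]_y (f y * _)) (\int[mu]_y (g y * _)) => p q dA dB dC.
have -> : mass e * f x - mass e * g x = (mass e * f x - p) - (mass e * g x - q) + (p - q) by ring.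
by apply: le_trans (ler_normD _ _) _; apply: lerD => //; apply: le_trans (ler_normB _ _) _; exact: lerD.
Qed.
End Mollify.

Section TotalDensity.
Context {R : realType}.
Local Notation mu := (@lebesgue_measure R).
Variables (M : nat) (L V lip : R) (v : R -> R) (S : nat -> R -> R -> R) (tau : R).
Hypotheses (hM : (0 < M)%N) (hL : 0 < L) (hV : hypV L V v) (hS0 : hypS0 M L lip S)
  (hS1 : hypS1 M L S) (htau : 0 < tau).
Local Notation sol := (solution M L v S tau).
Variables (u0 : nat -> R -> R) (u : nat -> R -> R -> R).
Hypothesis (hu : sol u0 u).

Lemma total_close (e N s : R) : 0 < e -> 0 < N -> 0 < s ->
  mass e * \int[mu]_x (`|\sum_(1 <= j < M.+1 | (1 <= j <= M)%N) ext (u j) (s, x) -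
      \sum_(1 <= j < M.+1 | (1 <= j <= M)%N) u0 j x| * bump N x) <=
  2 * \sum_(1 <= j < M.+1) spread e (u0 j) (u0 j) + s * (16 * (M%:R * V * L) * N).
Proof.
move=> e0 N0 s0; have V0 := V_ge0 hL hV.
have lU j (jM : (1 <= j <= M)%N) := L1_ext (sol_C0L1 hu jM) s.
have l0 j (jM : (1 <= j <= M)%N) := sol_data_L1 hu jM.
have hC x : `|\int[mu]_y ((\sum_(1 <= j < M.+1 | (1 <= j <= M)%N) ext (u j) (s, y)) * bump e (y - x)) -
    \int[mu]_y ((\sum_(1 <= j < M.+1 | (1 <= j <= M)%N) u0 j y) * bump e (y - x))| <=
    s * (8 * (M%:R * V * L)).
  have := weak_close hM hL hV hS0 hS1 htau hu x e0 s0.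
  rewrite -Int_sum; last by move=> j jM; exact: (L1_mul_bump e x (lU j jM)).
  rewrite -Int_sum; last by move=> j jM; exact: (L1_mul_bump e x (l0 j jM)).
  by under eq_Rintegral do rewrite -mulr_suml;
     under [X in _ - X]eq_Rintegral do rewrite -mulr_suml.
apply: (le_trans (mollify_dist e0 N0 (L1_sum _ lU) (L1_sum _ l0) hC)).
apply: lerD; last first.
  have m2 := mass_le N0.
  have -> : s * (16 * (M%:R * V * L) * N) = s * (8 * (M%:R * V * L)) * (2 * N) by ring.
  by apply: ler_wpM2l => //; rewrite !mulr_ge0// ltW.
rewrite mulr2n mulrDl !mul1r; apply: lerD; last first.
  by rewrite sum_lanes_cond; exact: (spread_sum e0).
apply: (@le_trans _ _ (spreads M u u e s)).
  by rewrite /spreads sum_lanes_cond; exact: (spread_sum e0).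
apply: le_trans (initial_spread hM hL hV hS0 htau hu e0).
by apply: (spreads_le hM hL hV hS0 htau hu hu e0 (ltW s0)) => //; exact: ltW.
Qed.

End TotalDensity.

Section SmallSpread.
Context {R : realType}.
Local Notation mu := (@lebesgue_measure R).
Local Notation RT := (measurableTypeR R).

Lemma heine_itv (h : R -> R) (A eta : R) : continuous h -> 0 < eta ->
  exists2 d : R, 0 < d & forall x y, `|x| <= A -> `|x - y| <= d -> `|h x - h y| <= eta.
Proof.
move=> ch eta0.
have eta2 : 0 < eta / 2 by rewrite divr_gt0.
have := @segment_compact R (- A) A; rewrite compact_near_coveringP.
move=> /(_ R (0^'+) (fun d x => forall y, `|x - y| <= d -> `|h x - h y| <= eta) _).
case.
  move=> x _; have /cvgrPdist_le/(_ _ eta2)[r /= r0 hr] := ch x.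
  exists (ball x (r / 2), [set d | d <= r / 2]) => /=.
    split; first by apply: nbhsx_ballx; rewrite divr_gt0.
    by apply: nbhs_right_le; rewrite divr_gt0.
  move=> [x' d] /= [bx dr] y xy.
  have xr : `|x - x'| < r / 2 by exact: bx.
  have h1 : `|h x - h x'| <= eta / 2 by apply: hr => /=; apply: lt_le_trans xr _; rewrite ler_pdivrMr// ler_pMr// ler1n.
  have h2 : `|h x - h y| <= eta / 2.
    apply: hr => /=; rewrite [X in _ < X](splitr r).
    have -> : x - y = (x - x') + (x' - y) by ring.
    by apply: le_lt_trans (ler_normD _ _) _; apply: ltr_leD => //; exact: le_trans dr.
  have -> : h x' - h y = (h x - h y) - (h x - h x') by ring.
  by apply: le_trans (ler_normB _ _) _; rewrite [leRHS](splitr eta); exact: lerD.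
move=> r /= r0 hr; exists (r / 2); first by rewrite divr_gt0.
move=> x y xA xy; apply: (hr (r / 2) _ _ x) => //=.
- by rewrite sub0r normrN gtr0_norm ?divr_gt0// ltr_pdivrMr// ltr_pMr// ltr1n.
- by rewrite divr_gt0.
- by rewrite /= in_itv/= -ler_norml.
Qed.

Lemma L1_approx (f : R -> R) (eta : R) : L1 mu f -> 0 < eta ->
  exists (h : R -> R) (A : R), [/\ 0 <= A, continuous h, L1 mu h,
    (forall x, A <= `|x| -> h x = 0) & \int[mu]_x `|f x - h x| <= eta].
Proof.
move=> lf eta0; have eta2 : 0 < eta / 2 by rewrite divr_gt0.
have [N N1 hN] := Int_bump_tail (L1_norm lf) eta2.
have N0 : 0 < N by exact: lt_le_trans N1.
pose E : set R := `[- N, N]%classic.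
have mE : measurable E by exact: measurable_itv.
have muE : (mu E < +oo)%E.
  by rewrite lebesgue_measure_itv/=; case: ifP => _; rewrite -?EFinD ltry.
have lfE : mu.-integrable E (EFin \o f) by apply: integrableS lf.
have [g_ [cg lg cv]] := approximation_continuous_integrable mE muE lfE.
have [g [cgg lgg hg]] : exists g : R -> R, [/\ continuous g, mu.-integrable E (EFin \o g) &
    (\int[mu]_(z in E) `|(f z - g z)%:E| <= (eta / 2)%:E)%E].
  move/fine_cvgP: cv => [fn /cvgrPdist_le/(_ _ eta2) hn].
  have [n _ /(_ n (leqnn n))[nf]] := filterI fn hn.
  rewrite /= sub0r normrN => le; exists (g_ n); split=> //.
  by rewrite -(fineK nf) lee_fin (le_trans (ler_norm _) le).
pose h x := g x * bump N x.
have ch : continuous h by move=> x; apply: cvgM; [exact: cgg|exact: continuous_bump].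
have h0 x : N <= `|x| -> h x = 0 by move=> /(bump_supp N0)[b0 _]; rewrite /h b0 mulr0.
have E1 x : `|x| <= N -> \1_E x = 1 :> R.
  by move=> xN; rewrite indicE mem_set// /E/= in_itv/= -ler_norml.
have LE (k : R -> R) : mu.-integrable E (EFin \o k) -> L1 mu (fun x => k x * \1_E x).
  move=> lk; have := (proj1 (@integrable_mkcond _ RT R mu E (EFin \o k) mE) lk).
  by rewrite restrict_EFin patch_indic.
have lgE := LE _ lgg.
have lfg : L1 mu (fun x => `|f x - g x| * \1_E x).
  have := L1_norm (L1B (LE _ lfE) lgE); apply: L1_eq => x.
  by rewrite -mulrBl normrM (ger0_norm (_ : 0 <= \1_E x))// indicE.
have lh : L1 mu h.
  apply: (L1_dom _ (L1_norm lgE)); first by apply: continuous_measurable_fun.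
  move=> x; have [xN|xN] := leP `|x| N; last by rewrite h0 ?normr0// ltW.
  by rewrite E1// mulr1 normrM ler_piMr// norm_bump.
have lfb := L1_mul_bump N 0 (L1_norm lf).
have {}lfb : L1 mu (fun x => `|f x| * bump N x).
  by move: lfb; under eq_fun do rewrite subr0.
exists h, N; split=> //; first exact: ltW.
have bd x : `|f x - h x| <= (`|f x| - `|f x| * bump N x) + `|f x - g x| * \1_E x.
  have -> : f x - h x = f x * (1 - bump N x) + (f x - g x) * bump N x by rewrite /h; ring.
  apply: le_trans (ler_normD _ _) _; rewrite (normrM (f x)) (normrM (f x - g x)).
  have b1 : 0 <= 1 - bump N x by rewrite subr_ge0 bump_le1.
  rewrite (ger0_norm b1) mulrBr mulr1 lerD2l; apply: ler_wpM2l => //.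
  have [xN|xN] := leP `|x| N; first by rewrite E1 ?xN//; exact: norm_bump.
  by rewrite (bump_supp N0 (ltW xN)).1 normr0 indicE.
apply: (le_trans (Int_le (L1_norm (L1B lf lh)) (L1D (L1B (L1_norm lf) lfb) lfg) bd)).
rewrite IntD//; last exact: L1B (L1_norm lf) lfb.
rewrite IntB//; last exact: L1_norm.
rewrite [leRHS](splitr eta); apply: lerD; first by rewrite lerBlDr addrC -lerBlDr.
rewrite -lee_fin EFin_Int//; apply: le_trans hg.
rewrite [leRHS]integral_mkcond le_eqVlt; apply/orP; left; apply/eqP.
apply: eq_integral => x _; rewrite /= /patch indicE.
by case: ifP => _; rewrite ?mulr1 ?mulr0// -[in RHS]abse_EFin.
Qed.

Lemma spread_small (f : R -> R) (eta : R) : L1 mu f -> 0 < eta ->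
  exists2 d : R, 0 < d & forall e, 0 < e -> e <= d -> spread e f f <= mass e * eta.
Proof.
move=> lf eta0.
have [h [A [A0 ch lh hA hfh]]] := L1_approx lf (divr_gt0 eta0 (ltr0n _ 4)).
have A1 : 0 < A + 1 by rewrite ltr_wpDl.
have z0 : 0 < eta / (4 * (A + 1)) by rewrite divr_gt0// mulr_gt0.
have [d d0 hd] := heine_itv (A + 1) ch z0.
exists (Num.min d 1); first by rewrite lt_min d0 ltr01.
move=> e e0; rewrite le_min => /andP[ed e1].
have tri := spread_tri e0 lf lf lh lh.
have sh : spread e h h <= mass e * (eta / 2).
  have [l1 E1] := spread_l e0 (L1Z (eta / (4 * (A + 1))) (L1_box1 (A + 1))).
  have [l2 _] := L1_spread e0 lh lh.
  apply: (@le_trans _ _ (mass e * \int[mu]_x `|eta / (4 * (A + 1)) * box1 (A + 1) x|)).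
    rewrite -E1 /spread; apply: Int_le => // -[x y] /=.
    have [xy|xy] := leP e `|x - y|; first by rewrite (bump_supp e0 xy).1 !mulr0.
    apply: ler_wpM2r; first exact: bump_ge0.
    rewrite normrM (ger0_norm (ltW z0)) (ger0_norm (box1_ge0 _ _)) box1E.
    have [xA|xA] := leP `|x| (A + 1).
      by rewrite mulr1; apply: hd => //; exact: le_trans (ltW xy) ed.
    rewrite mulr0 (hA x) ?(hA y) ?subrr ?normr0//.
      rewrite -(lerD2r 1); apply: (le_trans (ltW xA)).
      rewrite -[x](subrK y) addrC (le_trans (ler_normD _ _))// lerD2l.
      exact: le_trans (ltW xy) e1.
    by apply: le_trans (ltW xA); rewrite lerDl.
  apply: ler_wpM2l; first exact: ltW (mass_gt0 e0).
  have -> : (fun x => `|eta / (4 * (A + 1)) * box1 (A + 1) x|) = (fun x => eta / (4 * (A + 1)) * box1 (A + 1) x).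
    by apply/funext => x; rewrite ger0_norm// mulr_ge0 ?box1_ge0// ltW.
  rewrite IntZ; last exact: L1_box1.
  rewrite Int_itv; last by rewrite lerNl (le_trans _ (ltW A1))// oppr_le0 ltW.
  by rewrite le_eqVlt; apply/orP; left; apply/eqP; field; rewrite gt_eqF.
apply: (le_trans tri); rewrite (splitr eta) [leRHS]mulrDr; apply: lerD => //.
apply: ler_wpM2l; first exact: ltW (mass_gt0 e0).
apply: (le_trans (lerD hfh hfh)).
by rewrite le_eqVlt; apply/orP; left; apply/eqP; field.
Qed.

End SmallSpread.

(** * Relaxation *)

Section Relaxation.
Context {R : realType}.
Local Notation mu := (@lebesgue_measure R).
Local Notation RT := (measurableTypeR R).
Local Notation mu2 := (@plane R).
Variables (M : nat) (L V lip : R) (v : R -> R) (S : nat -> R -> R -> R).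
Hypotheses (hM : (0 < M)%N) (hL : 0 < L) (hV : hypV L V v) (hS0 : hypS0 M L lip S)
  (hS1 : hypS1 M L S).
Local Notation sol := (solution M L v S).
Variables (A D : R) (f f' g g' : R -> R) (hf : C1c A f f') (hg : C1c A g g').
Hypotheses (hfD : forall x, `|f x| <= D /\ `|f' x| <= D)
  (hgD : forall x, `|g x| <= D /\ `|g' x| <= D) (A0 : 0 <= A).

Let D0 : 0 <= D. Proof. by apply: le_trans (hfD 0).1. Qed.

Lemma L1_window (h : RT * RT -> R) (C : R) : measurable_fun setT h ->
  (forall p, `|h p| <= C) -> L1 mu2 (fun p => past p.1 * (f p.1 * g p.2 * h p)) /\
  forall t, L1 mu (fun x => past t * (f t * g x * h (t, x))).
Proof.
move=> mh hC.
have [mf _] := C1c_measurable hf; have [mg _] := C1c_measurable hg.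
have C0 : 0 <= C by apply: le_trans (hC (0, 0)).
have [||| //] := @L1_box _ (fun p => past p.1 * (f p.1 * g p.2 * h p)) A (D * D * C).
- apply: measurable_funM; first exact: (measurableT_comp measurable_past measurable_fst).
  apply: measurable_funM => //; apply: measurable_funM.
    exact: (measurableT_comp mf measurable_fst).
  exact: (measurableT_comp mg measurable_snd).
- move=> p; rewrite pastE; case: ifP => _; last first.
    by rewrite mul0r normr0; apply: mulr_ge0 => //; exact: mulr_ge0.
  rewrite mul1r normrM; apply: ler_pM => //; rewrite normrM.
  by apply: ler_pM => //; [exact: (hfD _).1|exact: (hgD _).1].
- by move=> p [/(C1c_out hf)[-> _]|/(C1c_out hg)[-> _]]; rewrite ?(mul0r, mulr0).
Qed.

Definition jumps (a : nat -> R) (k : R) : R :=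
  \sum_(1 <= j < M | (1 <= j < M)%N) `|S j (a j) (a j.+1)| *
    `|Num.sg (a j - k) - Num.sg (a j.+1 - k)|.

Definition gaps (a : nat -> R) : R :=
  \sum_(1 <= j < M | (1 <= j < M)%N) `|a j - a j.+1|.

Section OneTau.
Variables (tau : R) (u0 : nat -> R -> R) (u : nat -> R -> R -> R).
Hypotheses (htau : 0 < tau) (hu : sol tau u0 u).
Let U p j := ext (u j) p.

Let inM j : (1 <= j < M)%N -> (1 <= j <= M)%N /\ (1 <= j.+1 <= M)%N.
Proof. by move=> /andP[j1 jM]; rewrite j1 jM (ltnW jM). Qed.

Lemma measurable_jumps k : k \in `[0, L] -> measurable_fun setT (fun p => jumps (U p) k).
Proof.
move=> kL; apply: measurable_bigsum => j jM; have [j1 j2] := inM jM.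
have m1 := measurable_U hu j1; have m2 := measurable_U hu j2.
apply: measurable_funM; apply: measurableT_comp => //.
  by apply: (measurable_S hL hS0) => // p; exact: (U_range hu).
by apply: measurable_funB; apply: measurable_sgr; exact: measurable_funB.
Qed.

Lemma jumps_le p k : k \in `[0, L] ->
  `|jumps (U p) k| <= \sum_(1 <= j < M | (1 <= j < M)%N) (`|lip| * (L + L) * 2).
Proof.
move=> kL; apply: le_trans (ler_norm_sum _ _ _) _; apply: ler_sum => j jM.
have [j1 j2] := inM jM; have r1 := U_range hu p j1; have r2 := U_range hu p j2.
rewrite normrM !normr_id; apply: ler_pM => //.
  have := exchange_le hS0 jM r1 r2; rewrite /exchange jM => h; apply: (le_trans h).
  move: r1 r2; rewrite !in_itv/= => /andP[_ r1] /andP[_ r2].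
  by apply: ler_wpM2l => //; exact: lerD.
by apply: le_trans (ler_normB _ _) _; rewrite -[leRHS]/(1 + 1); apply: lerD; exact: norm_sgr_le.
Qed.

Lemma jumps_bound k : k \in `[0, L] ->
  \int[mu2]_p (past p.1 * (f p.1 * g p.2 * jumps (U p) k)) <=
  tau * (M%:R * ((L + V * (L + L)) * D ^+ 2 * (2 * A) ^+ 2 + L * D ^+ 2 * (2 * A))).
Proof.
move=> kL; have V0 := V_ge0 hL hV.
have [lJ _] := L1_window (measurable_jumps kL) (fun p => jumps_le p kL).
have D2 : 0 <= D ^+ 2 by rewrite exprn_ge0.
have [l0 E0] := tensor (L1_box1 A) (L1_box1 A).
have IA : \int[mu]_x box1 A x = 2 * A.
  by rewrite Int_itv ?opprK ?mulr2n ?mulrDl ?mul1r// -subr_ge0 opprK addr_ge0.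
pose EI j (p : RT * RT) := past p.1 * entropy_integrand M v S tau (fun i => ext (u i)) j k f f' g g' p.
pose J (p : RT * RT) := past p.1 * (f p.1 * g p.2 * jumps (U p) k).
pose C1 := M%:R * ((L + V * (L + L)) * D ^+ 2).
have C10 : 0 <= C1.
  apply: mulr_ge0 => //; apply: mulr_ge0 => //; apply: addr_ge0; first exact: ltW.
  by apply: mulr_ge0 => //; apply: addr_ge0; exact: ltW.
have C1B (p : RT * RT) : 0 <= C1 * (box1 A p.1 * box1 A p.2).
  by apply: mulr_ge0 => //; apply: mulr_ge0; exact: box1_ge0.
have lE j : (1 <= j <= M)%N -> L1 mu2 (EI j).
  by move=> jM; exact: (entropy_X hL hV hS0 hu hf hg jM kL).1.
have DD a b : `|a| <= D -> `|b| <= D -> `|a * b| <= D ^+ 2.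
  by move=> ha hb; rewrite normrM expr2; exact: ler_pM.
have bd p : \sum_(1 <= j < M.+1 | (1 <= j <= M)%N) EI j p <=
    C1 * (box1 A p.1 * box1 A p.2) - tau^-1 * J p.
  rewrite /EI /J -mulr_sumr pastE; case: ifP => _; last first.
    by rewrite !mul0r mulr0 subr0; exact: C1B.
  rewrite !mul1r /entropy_integrand !big_split/=; apply: lerD; last first.
    have hJ : \sum_(1 <= j < M.+1) Num.sg (ext (u j) p - k) * rhs M S (fun i => ext (u i) p) j =
        - jumps (U p) k.
      rewrite /jumps -big_nat.
      exact: (rhs_relax hL hS0 hS1 hM kL (fun j jM => U_range hu p jM)).
    rewrite -mulr_suml le_eqVlt; apply/orP; left; apply/eqP.
    have -> : \sum_(1 <= j < M.+1 | (1 <= j <= M)%N)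
        Num.sg (ext (u j) p - k) * (tau^-1 * rhs M S (fun i => ext (u i) p) j) =
        tau^-1 * - jumps (U p) k.
      rewrite -hJ mulr_sumr [RHS]sum_lanes_cond; apply: eq_bigr => j _.
      by rewrite mulrCA.
    by ring.
  have [out|inn] := pselect (A < `|p.1| \/ A < `|p.2|).
    have [z1 z2] : f' p.1 * g p.2 = 0 /\ f p.1 * g' p.2 = 0.
      by case: out => [/(C1c_out hf)[-> ->]|/(C1c_out hg)[-> ->]]; rewrite ?mul0r ?mulr0.
    rewrite z1 z2 big1 ?big1 ?addr0; last by move=> j _; rewrite mulr0.
      exact: C1B.
    by move=> j _; rewrite mulr0.
  have [p1 p2] : `|p.1| <= A /\ `|p.2| <= A.
    by split; rewrite leNgt; apply/negP => h; apply: inn; [left|right].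
  rewrite !box1E p1 p2 !mulr1 -big_split/= /C1 -sum_lanes_const; apply: ler_sum => j jM.
  have rj := U_range hu p jM.
  apply: le_trans (ler_norm _) _; apply: le_trans (ler_normD _ _) _.
  rewrite [leRHS]mulrDl; apply: lerD; rewrite normrM; apply: ler_pM => //.
  - by rewrite normr_id; exact: (norm_itv rj kL).
  - by apply: DD; [exact: (hfD _).2|exact: (hgD _).1].
  - apply: (le_trans (kflux_norm hV rj kL)); apply: ler_wpM2l => //.
    by move: rj kL; rewrite !in_itv/= => /andP[_ ?] /andP[_ ?]; exact: lerD.
  - by apply: DD; [exact: (hfD _).1|exact: (hgD _).2].
have init j : (1 <= j <= M)%N -> \int[mu]_x (`|u0 j x - k| * (f 0 * g x)) <= L * D ^+ 2 * (2 * A).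
  move=> jM.
  have le x : `|u0 j x - k| * (f 0 * g x) <= L * D ^+ 2 * box1 A x.
    have [xA|xA] := ltP A `|x|.
      rewrite (C1c_out hg xA).1 !mulr0; apply: mulr_ge0 (box1_ge0 _ _).
      by apply: mulr_ge0 => //; exact: ltW.
    rewrite box1E xA mulr1; apply: le_trans (ler_norm _) _; rewrite (normrM (`| u0 j x - k |)).
    apply: ler_pM => //; last by apply: DD; [exact: (hfD _).1|exact: (hgD _).1].
    by rewrite normr_id; exact: (norm_itv (sol_data_range hu jM x) kL).
  have [mg _] := C1c_measurable hg.
  have l1 : L1 mu (fun x => `|u0 j x - k| * (f 0 * g x)).
    apply: (L1_dom _ (L1Z (L * D ^+ 2) (L1_box1 A))).
      apply: measurable_funM; last exact: measurable_funM.
      apply: measurableT_comp => //; apply: measurable_funB => //.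
      exact: L1_measurable (sol_data_L1 hu jM).
    move=> x; rewrite ger0_norm// mulr_ge0// mulr_ge0//; [exact: C1c_ge0 hf _|exact: C1c_ge0 hg _].
  by apply: (le_trans (Int_le l1 (L1Z _ (L1_box1 A)) le)); rewrite IntZ ?IA//; exact: L1_box1.
have tot : 0 <= \sum_(1 <= j < M.+1 | (1 <= j <= M)%N)
    (\int[mu2]_p EI j p + L * D ^+ 2 * (2 * A)).
  apply: sumr_ge0 => j jM; apply: (le_trans (entropy_X hL hV hS0 hu hf hg jM kL).2).
  by rewrite lerD2l; exact: init.
move: tot; rewrite big_split/= sum_lanes_const -Int_sum// => tot.
have : \int[mu2]_p (\sum_(1 <= j < M.+1 | (1 <= j <= M)%N) EI j p) <=
    C1 * (2 * A) ^+ 2 - tau^-1 * \int[mu2]_p J p.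
  have lR : L1 mu2 (fun p => C1 * (box1 A p.1 * box1 A p.2)) by exact: L1Z.
  have lJ' : L1 mu2 (fun p => tau^-1 * J p) by exact: L1Z.
  have -> : C1 * (2 * A) ^+ 2 - tau^-1 * \int[mu2]_p J p =
      \int[mu2]_p (C1 * (box1 A p.1 * box1 A p.2) - tau^-1 * J p).
    by rewrite IntB// !IntZ// E0 IA.
  by apply: Int_le; [exact: L1_sum|exact: L1B|].
move=> up; rewrite -/(J) -ler_pdivrMl//.
move: up tot; rewrite /C1.
move: (\int[mu2]_p \sum_(_ <= _ < _ | _) _) (tau^-1 * \int[mu2]_p J p) => X Y up tot.
have {up tot} h := le_trans tot (lerD up (lexx _)).
rewrite -subr_ge0; apply: (le_trans h).
by rewrite le_eqVlt; apply/orP; left; apply/eqP; ring.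
Qed.

Lemma L1_gaps : L1 mu2 (fun p => past p.1 * (f p.1 * g p.2 * gaps (U p))) /\
  forall t, L1 mu (fun x => past t * (f t * g x * gaps (U (t, x)))).
Proof.
apply: (@L1_window _ (\sum_(1 <= j < M | (1 <= j < M)%N) L)).
  apply: measurable_bigsum => j jM; have [j1 j2] := inM jM.
  by apply: measurableT_comp => //; apply: measurable_funB; exact: (measurable_U hu).
move=> p; apply: le_trans (ler_norm_sum _ _ _) _; apply: ler_sum => j jM.
have [j1 j2] := inM jM; rewrite normr_id.
exact: (norm_itv (U_range hu p j1) (U_range hu p j2)).
Qed.

Lemma gaps_bound (e K : R) (n : nat) : 0 <= e -> 0 <= K ->
  (forall i, (i <= n)%N -> L / n%:R * i%:R \in `[0, L]) ->
  (forall j a b, (1 <= j < M)%N -> a \in `[0, L] -> b \in `[0, L] ->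
  `|a - b| <= e + K * \sum_(0 <= i < n.+1)
     `|S j a b| * `|Num.sg (a - L / n%:R * i%:R) - Num.sg (b - L / n%:R * i%:R)|) ->
  \int[mu2]_p (past p.1 * (f p.1 * g p.2 * gaps (U p))) <=
  M%:R * e * D ^+ 2 * (2 * A) ^+ 2 + K * (n.+1%:R * (tau *
    (M%:R * ((L + V * (L + L)) * D ^+ 2 * (2 * A) ^+ 2 + L * D ^+ 2 * (2 * A))))).
Proof.
move=> e0 K0 kL hp.
have [l0 E0] := tensor (L1_box1 A) (L1_box1 A).
have IA : \int[mu]_x box1 A x = 2 * A.
  by rewrite Int_itv ?opprK ?mulr2n ?mulrDl ?mul1r// -subr_ge0 opprK addr_ge0.
pose k i := L / n%:R * i%:R.
pose J i (p : RT * RT) := past p.1 * (f p.1 * g p.2 * jumps (U p) (k i)).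
have lJ i : (0 <= i < n.+1)%N -> L1 mu2 (J i).
  move=> /andP[_ i_n]; have kiL := kL i i_n.
  exact: (L1_window (measurable_jumps kiL) (fun p => jumps_le p kiL)).1.
have c0 : 0 <= M%:R * e * D ^+ 2 by rewrite mulr_ge0 ?exprn_ge0// mulr_ge0.
have bd p : past p.1 * (f p.1 * g p.2 * gaps (U p)) <=
    M%:R * e * D ^+ 2 * (box1 A p.1 * box1 A p.2) +
    K * \sum_(0 <= i < n.+1 | (0 <= i < n.+1)%N) J i p.
  have fg0 : 0 <= f p.1 * g p.2 by rewrite mulr_ge0//; [exact: C1c_ge0 hf _|exact: C1c_ge0 hg _].
  have -> : \sum_(0 <= i < n.+1 | (0 <= i < n.+1)%N) J i p =
      past p.1 * (f p.1 * g p.2 * \sum_(0 <= i < n.+1) jumps (U p) (k i)).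
    by rewrite -big_nat /J -mulr_sumr -mulr_sumr.
  have hgap : gaps (U p) <= M%:R * e + K * \sum_(0 <= i < n.+1) jumps (U p) (k i).
    apply: (@le_trans _ _ (\sum_(1 <= j < M | (1 <= j < M)%N) (e + K * \sum_(0 <= i < n.+1)
       `|S j (U p j) (U p j.+1)| * `|Num.sg (U p j - k i) - Num.sg (U p j.+1 - k i)|))).
      apply: ler_sum => j jM; have [j1 j2] := inM jM.
      by apply: hp => //; exact: (U_range hu).
    rewrite big_split/=; apply: lerD.
      rewrite -big_nat sumr_const_nat -[leLHS]mulr_natl; apply: ler_wpM2r => //.
      by rewrite ler_nat leq_subr.
    rewrite -mulr_sumr; apply: ler_wpM2l => //.
    by rewrite /jumps exchange_big/=.
  rewrite pastE; case: ifP => _; last first.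
    rewrite !mul0r mulr0 addr0; apply: mulr_ge0 => //; apply: mulr_ge0; exact: box1_ge0.
  rewrite !mul1r; apply: (le_trans (ler_wpM2l fg0 hgap)); rewrite mulrDr.
  rewrite (mulrCA (f p.1 * g p.2) K) lerD2r.
  have [out|inn] := pselect (A < `|p.1| \/ A < `|p.2|).
    have -> : f p.1 * g p.2 = 0.
      by case: out => [/(C1c_out hf)[-> _]|/(C1c_out hg)[-> _]]; rewrite ?mul0r ?mulr0.
    rewrite mul0r; apply: mulr_ge0 => //; apply: mulr_ge0; exact: box1_ge0.
  have [p1 p2] : `|p.1| <= A /\ `|p.2| <= A.
    by split; rewrite leNgt; apply/negP => h; apply: inn; [left|right].
  rewrite !box1E p1 p2 !mulr1 mulrC; apply: ler_wpM2l; first by rewrite mulr_ge0.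
  apply: le_trans (ler_norm _) _; rewrite normrM expr2; apply: ler_pM => //.
    exact: (hfD _).1.
  exact: (hgD _).1.
have lR : L1 mu2 (fun p => M%:R * e * D ^+ 2 * (box1 A p.1 * box1 A p.2)) by exact: L1Z.
have lS : L1 mu2 (fun p => \sum_(0 <= i < n.+1 | (0 <= i < n.+1)%N) J i p) by exact: L1_sum.
apply: (le_trans (Int_le L1_gaps.1 (L1D lR (L1Z K lS)) bd)).
rewrite IntD//; last exact: L1Z.
rewrite !IntZ// E0 IA; apply: lerD => //; apply: ler_wpM2l => //.
rewrite Int_sum//.
apply: (@le_trans _ _ (\sum_(0 <= i < n.+1 | (0 <= i < n.+1)%N) (tau * (M%:R * ((L + V * (L + L)) * D ^+ 2 * (2 * A) ^+ 2 + L * D ^+ 2 * (2 * A)))))).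
  apply: ler_sum => i /andP[_ i_n]; apply: jumps_bound; exact: kL.
by rewrite -big_nat sumr_const_nat subn0 -[leLHS]mulr_natl.
Qed.

End OneTau.

Lemma relaxation (eta : R) : 0 < eta -> exists2 tau0 : R, 0 < tau0 &
  forall tau u0 u, 0 < tau -> tau <= tau0 -> sol tau u0 u ->
  \int[mu2]_p (past p.1 * (f p.1 * g p.2 * gaps (fun j => ext (u j) p))) <= eta.
Proof.
move=> eta0; have V0 := V_ge0 hL hV.
pose c := M%:R * D ^+ 2 * (2 * A) ^+ 2.
have c0 : 0 <= c by rewrite /c !mulr_ge0 ?exprn_ge0// mulr_ge0.
have c1 : 0 < c + 1 by rewrite ltr_pwDr.
have e0 : 0 < eta / 2 / (c + 1) by rewrite !divr_gt0.
have [n [K [K0 [kL hp]]]] := relax_pointwise hL hS0 hS1 e0.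
pose B := M%:R * ((L + V * (L + L)) * D ^+ 2 * (2 * A) ^+ 2 + L * D ^+ 2 * (2 * A)).
have L0 := ltW hL.
have B0 : 0 <= B.
  apply: mulr_ge0 => //; apply: addr_ge0; last first.
    by apply: mulr_ge0; [apply: mulr_ge0 => //; exact: exprn_ge0|exact: mulr_ge0].
  apply: mulr_ge0; last by apply: exprn_ge0; exact: mulr_ge0.
  apply: mulr_ge0; last exact: exprn_ge0.
  by apply: addr_ge0 => //; apply: mulr_ge0 => //; exact: addr_ge0.
have d0 : 0 <= K * (n.+1%:R * B) by apply: mulr_ge0 => //; exact: mulr_ge0.
have d1 : 0 < K * (n.+1%:R * B) + 1 by rewrite ltr_pwDr.
exists (eta / 2 / (K * (n.+1%:R * B) + 1)); first by rewrite !divr_gt0.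
move=> tau u0 u tau0 le hu.
apply: (le_trans (gaps_bound tau0 hu (ltW e0) K0 kL hp)).
rewrite [leRHS](splitr eta) -/B; apply: lerD.
  have -> : M%:R * (eta / 2 / (c + 1)) * D ^+ 2 * (2 * A) ^+ 2 = eta / 2 * (c / (c + 1)).
    by rewrite /c; ring.
  rewrite ler_piMr ?divr_ge0// ?(ltW eta0)// ler_pdivrMr// mul1r lerDl; exact: ler01.
have -> : K * (n.+1%:R * (tau * B)) = tau * (K * (n.+1%:R * B)) by ring.
apply: (le_trans (ler_wpM2r d0 le)).
rewrite mulrAC -mulrA ler_piMr ?divr_ge0// ?(ltW eta0)// ler_pdivrMr// mul1r lerDl; exact: ler01.
Qed.

End Relaxation.

Section Scale.
Context d (T : measurableType d) (R : realType) (m : {measure set T -> \bar R}).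

Lemma ge0_integral_scale_le (k : R) (f : T -> \bar R) : 0 < k -> (forall x, 0 <= f x)%E ->
  (k%:E * \int[m]_x f x <= \int[m]_x (k%:E * f x))%E.
Proof.
move=> k0 f0.
have kf0 x : (0 <= k%:E * f x)%E by rewrite mule_ge0// lee_fin ltW.
rewrite (ge0_integralTE _ f0) (ge0_integralTE _ kf0).
rewrite -lee_pdivlMl//; apply: ge_ereal_sup => _ [h /= hf <-].
rewrite lee_pdivlMl// -sintegralrM; apply: ereal_sup_ubound.
exists (scale_nnsfun h (ltW k0)) => //= x.
by rewrite EFinM lee_pmul2l// hf.
Qed.

Lemma ge0_integral_scale (k : R) (f : T -> \bar R) : 0 < k -> (forall x, 0 <= f x)%E ->
  (\int[m]_x (k%:E * f x) = k%:E * \int[m]_x f x)%E.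
Proof.
move=> k0 f0; apply/eqP; rewrite eq_le ge0_integral_scale_le// andbT.
have kf0 x : (0 <= k%:E * f x)%E by rewrite mule_ge0// lee_fin ltW.
have kV : 0 < k^-1 by rewrite invr_gt0.
have := ge0_integral_scale_le kV kf0.
under [X in (_ <= X)%E]eq_integral do rewrite muleA -EFinM mulVf ?gt_eqF// mul1e.
by rewrite lee_pdivrMl.
Qed.

Lemma Rintegral_scale (D : set T) (k : R) (f : T -> R) : 0 < k ->
  \int[m]_(x in D) (k * f x) = k * \int[m]_(x in D) f x.
Proof.
move=> k0; rewrite /Rintegral integral_mkcond [in RHS]integral_mkcond.
set F := _ \_ D; set G := _ \_ D.
have -> : F = (fun x => k%:E * G x)%E.
  apply/funext => x; rewrite /F /G /patch; case: ifP => _; by rewrite ?mule0 -?EFinM.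
rewrite integralE [in RHS]integralE ge0_funeposM ?ge0_funenegM ?(ltW k0)//.
rewrite !ge0_integral_scale//.
move: (\int[m]_x (G^\+) x)%E (\int[m]_x (G^\-) x)%E => A B.
by case: A B => [a| |] [b| |]; rewrite ?(gt0_muley, gt0_muleNy) ?lte_fin//= ?mulr0 ?mulrBr.
Qed.
End Scale.

Section Scalar.
Context {R : realType}.
Local Notation mu := (@lebesgue_measure R).
Variables (M : nat) (L V lip : R) (v : R -> R) (S : nat -> R -> R -> R).
Hypotheses (hM : (0 < M)%N) (hL : 0 < L) (hV : hypV L V v) (hS0 : hypS0 M L lip S)
  (hS1 : hypS1 M L S).
Local Notation F := (flux v).

Lemma equal_lanes_solution (tau : R) (rho0 : nat -> R -> R) (r : R -> R -> R) :
  (forall j, (1 <= j <= M)%N -> forall x, rho0 j x \in `[0, L]) ->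
  (forall j, (1 <= j <= M)%N -> L1 mu (rho0 j)) ->
  scalar_entropy_solution (M%:R * L) (fun y => M%:R * F (y / M%:R))
    (fun x => \sum_(1 <= j < M.+1) rho0 j x) r ->
  solution M L v S tau (fun _ x => (\sum_(1 <= j < M.+1) rho0 j x) / M%:R)
    (fun _ t x => r t x / M%:R).
Proof.
move=> h01 h02 [[mr rr ir cr] er].
have m0 : 0 < M%:R :> R by rewrite ltr0n.
have m1 : M%:R != 0 :> R by rewrite gt_eqF.
have int0 (D : set R) : \int[mu]_(x in D) 0 = 0 :> R by rewrite /Rintegral integral0.
have mV : 0 < M%:R^-1 :> R by rewrite invr_gt0.
have range a : a \in `[0, M%:R * L] -> a / M%:R \in `[0, L].
  by rewrite !in_itv/= => /andP[a0 aL]; rewrite (divr_ge0 a0 (ler0n _ _))/= ler_pdivrMr// mulrC.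
split.
- move=> j jM; split.
    split.
    + by apply: measurable_funM => //; exact: measurable_cst.
    + by move=> t x t0; apply: range; exact: rr.
    + move=> t t0; have := L1Z M%:R^-1 (ir t t0); apply: L1_eq => x.
      by rewrite mulrC.
    + move=> t t0.
      have -> : (fun s => \int[mu]_x `|r s x / M%:R - r t x / M%:R|) =
          (fun s => M%:R^-1 * \int[mu]_x `|r s x - r t x|).
        apply/funext => s; rewrite -Rintegral_scale//; apply: Int_eq => x.
        by rewrite -mulrBl normrM mulrC (gtr0_norm mV).
      rewrite -[X in _ --> X](mulr0 (M%:R^-1)); apply: cvgM; [exact: cvg_cst|exact: cr].
  move=> k phi hphi; have := er (M%:R * k) phi hphi.
  have dE t x : r t x - M%:R * k = M%:R * (r t x / M%:R - k).
    by rewrite mulrBr mulrCA divff// mulr1.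
  have E1 : \int[mu]_(t in `[0, +oo[) \int[mu]_x
         (`|r t x - M%:R * k| * 'D_(1, 0) phi (t, x) +
          Num.sg (r t x - M%:R * k) * (M%:R * F (r t x / M%:R) - M%:R * F (M%:R * k / M%:R)) *
            'D_(0, 1) phi (t, x)) =
      M%:R * \int[mu]_(t in `[0, +oo[) \int[mu]_x
         (`|r t x / M%:R - k| * 'D_(1, 0) phi (t, x) +
          Num.sg (r t x / M%:R - k) * (F (r t x / M%:R) - F k) * 'D_(0, 1) phi (t, x)).
    rewrite -Rintegral_scale//; apply: eq_Rintegral => t _.
    rewrite -Rintegral_scale//; apply: eq_Rintegral => x _.
    rewrite dE normrM sgrM (gtr0_norm m0) (gtr0_sg m0) (mulrAC M%:R k) divff// !mul1r.
    by ring.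
  have E2 : \int[mu]_x (`|\sum_(1 <= j < M.+1) rho0 j x - M%:R * k| * phi (0, x)) =
      M%:R * \int[mu]_x (`|(\sum_(1 <= j < M.+1) rho0 j x) / M%:R - k| * phi (0, x)).
    rewrite -Rintegral_scale//; apply: eq_Rintegral => x _.
    have -> : \sum_(1 <= j < M.+1) rho0 j x - M%:R * k =
        M%:R * ((\sum_(1 <= j < M.+1) rho0 j x) / M%:R - k).
      by rewrite mulrBr mulrCA divff// mulr1.
    by rewrite normrM (gtr0_norm m0) mulrA.
  have E3 : \int[mu]_(t in `[0, +oo[) \int[mu]_x
         (Num.sg (r t x - M%:R * k) * 0 * phi (t, x)) = 0.
    rewrite -[RHS](int0 `[0, +oo[%classic).
    apply: eq_Rintegral => t _; rewrite -[RHS](int0 setT).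
    by apply: eq_Rintegral => x _; rewrite mulr0 mul0r.
  have E4 : \int[mu]_(t in `[0, +oo[) \int[mu]_x
         (Num.sg (r t x / M%:R - k) * (tau^-1 *
       (exchange M S j.-1 (r t x / M%:R) (r t x / M%:R) -
        exchange M S j (r t x / M%:R) (r t x / M%:R))) * phi (t, x)) = 0.
    rewrite -[RHS](int0 `[0, +oo[%classic).
    apply: eq_Rintegral => t; rewrite inE/= in_itv/= andbT => t0.
    rewrite -[RHS](int0 setT).
    apply: eq_Rintegral => x _; rewrite !(exchange_diag hL hS0 hS1) ?subrr ?mulr0 ?mul0r//;
      by apply: range; exact: rr.
  by rewrite E1 E2 E3 E4 !addr0 -mulrDr pmulr_rge0.
- move=> j jM x; apply: range; rewrite in_itv/= sum_lanes_cond; apply/andP; split.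
    by apply: sumr_ge0 => i iM; have := h01 i iM x; rewrite in_itv/= => /andP[].
  rewrite -sum_lanes_const; apply: ler_sum => i iM.
  by have := h01 i iM x; rewrite in_itv/= => /andP[].
- move=> j jM.
  have ls : L1 mu (fun x => \sum_(1 <= j < M.+1 | (1 <= j <= M)%N) rho0 j x) by exact: L1_sum.
  have := L1Z M%:R^-1 ls; apply: L1_eq => x.
  by rewrite mulrC sum_lanes_cond.
Qed.

End Scalar.

Lemma gaps_le (R : realType) (M : nat) (a : nat -> R) i j :
  (1 <= i <= M)%N -> (1 <= j <= M)%N -> `|a i - a j| <= gaps M a.
Proof.
wlog ij : i j / (i <= j)%N => [hw iM jM|/andP[i1 iM] /andP[j1 jM]].
  by case/orP: (leq_total i j) => h; [exact: hw|rewrite distrC; exact: hw].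
rewrite /gaps -big_nat (big_cat_nat i1 iM)/= (big_cat_nat ij jM)/=.
have tel : a i - a j = \sum_(i <= k < j) (a k - a k.+1).
  rewrite -[RHS]opprK -sumrN; under eq_bigr do rewrite opprB.
  by rewrite telescope_sumr// opprB.
rewrite tel; apply: (le_trans (ler_norm_sum _ _ _)).
by rewrite addrCA lerDl addr_ge0 ?sumr_ge0.
Qed.

Lemma gaps_ge0 (R : realType) (M : nat) (a : nat -> R) : 0 <= gaps M a.
Proof. by rewrite /gaps sumr_ge0. Qed.

Lemma pos_part_le (R : realFieldType) (a b c : R) : 0 <= a -> 0 <= b -> 0 <= c -> c <= 1 ->
  `|a - b| <= a - b + 2 * (`|b - a| * c + (b - b * c)).
Proof.
move=> a0 b0 c0 c1; have [ab|ab] := leP b a.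
  rewrite ger0_norm ?subr_ge0// lerDl mulr_ge0// addr_ge0 ?mulr_ge0//.
  by rewrite subr_ge0 ler_piMr.
rewrite ltr0_norm ?subr_lt0// gtr0_norm ?subr_gt0// -subr_ge0.
have -> : a - b + 2 * ((b - a) * c + (b - b * c)) - - (a - b) = 2 * (a * (1 - c)) by ring.
by rewrite !mulr_ge0// subr_ge0.
Qed.

Section RelaxedTime.
Context {R : realType}.
Local Notation mu := (@lebesgue_measure R).
Variables (M : nat) (L V lip : R) (v : R -> R) (S : nat -> R -> R -> R).
Hypotheses (hM : (0 < M)%N) (hL : 0 < L) (hV : hypV L V v) (hS0 : hypS0 M L lip S)
  (hS1 : hypS1 M L S).
Local Notation sol := (solution M L v S).

Lemma C1c_bump0 (e A : R) : 0 < e -> e <= A -> C1c A (bump e) (dbump e).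
Proof.
move=> e0 eA; have := @C1c_bump R e 0 A e0; rewrite normr0 add0r => /(_ eA).
have -> : (fun x : R => bump e (x - 0)) = bump e by apply/funext => x; rewrite subr0.
by have -> : (fun x : R => dbump e (x - 0)) = dbump e by apply/funext => x; rewrite subr0.
Qed.

Lemma relaxed_time (h N eta : R) : 0 < h -> 0 < N -> 0 < eta ->
  exists2 tau0 : R, 0 < tau0 & forall tau u0 u, 0 < tau -> tau <= tau0 -> sol tau u0 u ->
  exists s : R, [/\ 0 < s, s <= h &
    \int[mu]_x (gaps M (fun j => ext (u j) (s, x)) * bump N x) <= eta].
Proof.
move=> h0 N0 eta0.
have hf : C1c (h + N) (bump h) (dbump h) by apply: C1c_bump0; rewrite // lerDl ltW.
have hg : C1c (h + N) (bump N) (dbump N) by apply: C1c_bump0; rewrite // lerDr ltW.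
have [D1 D10 hD1] := C1c_bounded hf; have [D2 D20 hD2] := C1c_bounded hg.
have hfD x : `|bump h x| <= D1 + D2 /\ `|dbump h x| <= D1 + D2.
  by have [a b] := hD1 x; rewrite (le_trans a) ?(le_trans b) ?lerDl.
have hgD x : `|bump N x| <= D1 + D2 /\ `|dbump N x| <= D1 + D2.
  by have [a b] := hD2 x; rewrite (le_trans a) ?(le_trans b) ?lerDr.
have A0 : 0 <= h + N by rewrite addr_ge0// ltW.
have z0 : 0 < eta * h / 32 by rewrite divr_gt0// mulr_gt0.
have [tau0 t0 ht] := relaxation hM hL hV hS0 hS1 hf hg hfD hgD A0 z0.
exists tau0 => // tau u0 u tp tle hu; have {ht}ht := ht tau u0 u tp tle hu.
apply: contrapT => nex.
have gt s : 0 < s -> s <= h ->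
    eta < \int[mu]_x (gaps M (fun j => ext (u j) (s, x)) * bump N x).
  by move=> s0 sh; rewrite ltNge; apply/negP => le; apply: nex; exists s.
have [l1 sl] := L1_gaps hf hg hfD hgD hu.
have lo : \int[mu]_t (eta / 4 * \1_(`[h / 4, h / 2]%classic : set R) t) <=
    \int[mu]_t \int[mu]_x (past t * (bump h t * bump N x * gaps M (fun j => ext (u j) (t, x)))).
  apply: Int_le; first by apply: L1Z; exact: integrable_indic_itv.
    exact: (L1_Int_prod l1 sl).
  move=> t; rewrite indicE; case: (boolP (t \in _)) => tI; last first.
    rewrite mulr0; apply: Int_ge0 => x; rewrite pastE; case: ifP => _; rewrite ?mul0r// mul1r.
    by apply: mulr_ge0; [apply: mulr_ge0; exact: bump_ge0|exact: gaps_ge0].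
  move: tI; rewrite inE/= in_itv/= mulr1 => /andP[t1 t2].
  have tpos : 0 < t by apply: lt_le_trans t1; rewrite divr_gt0.
  have b4 : 1 / 4 <= bump h t by apply: bump_ge => //; rewrite gtr0_norm.
  have bp : 0 < bump h t by apply: lt_le_trans b4; rewrite divr_gt0.
  have -> : \int[mu]_x (past t * (bump h t * bump N x * gaps M (fun j => ext (u j) (t, x)))) =
      bump h t * \int[mu]_x (gaps M (fun j => ext (u j) (t, x)) * bump N x).
    rewrite -Rintegral_scale//; apply: Int_eq => x.
    by rewrite pastE (ltW tpos) mul1r -mulrA (mulrC (bump N x)).
  have th : t <= h by apply: (le_trans t2); rewrite ler_pdivrMr// ler_pMr// ler1n.
  apply: (@le_trans _ _ (bump h t * eta)); last first.
    by apply: ler_wpM2l; [exact: bump_ge0|exact: ltW (gt t tpos th)].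
  by rewrite mulrC -(mul1r 4^-1); apply: ler_wpM2r => //; exact: ltW.
move: lo; rewrite -(Int_prod l1 sl) Int_itv_cst; last first.
  by apply: ler_wpM2l; [exact: ltW|rewrite lef_pV2// ?posrE// ler_nat].
move=> lo; have := le_trans lo ht.
have -> : eta / 4 * (h / 2 - h / 4) = eta * h / 16 by field.
by apply/negP; rewrite -ltNge ltr_pM2l ?mulr_gt0// ltf_pV2 ?posrE// ltr_nat.
Qed.

End RelaxedTime.

(** * Comparison of the two solutions *)

Section Comparison.
Context {R : realType}.
Local Notation mu := (@lebesgue_measure R).
Variables (M : nat) (L V lip : R) (v : R -> R) (S : nat -> R -> R -> R) (tau : R).
Hypotheses (hM : (0 < M)%N) (hL : 0 < L) (hV : hypV L V v) (hS0 : hypS0 M L lip S)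
  (hS1 : hypS1 M L S) (htau : 0 < tau).
Local Notation sol := (solution M L v S tau).
Variables (rho0 : nat -> R -> R) (rho : nat -> R -> R -> R).
Variables (W0 : R -> R) (W : R -> R -> R).
Hypotheses (hrho : sol rho0 rho) (hW : sol (fun=> W0) (fun=> W)).
Hypothesis hW0 : forall x, M%:R * W0 x = \sum_(1 <= j < M.+1 | (1 <= j <= M)%N) rho0 j x.

Definition gap_L1 (t : R) : R := \sum_(1 <= j < M.+1 | (1 <= j <= M)%N)
  \int[mu]_x `|ext (rho j) (t, x) - ext W (t, x)|.

Let m0 : 0 < M%:R :> R. Proof. by rewrite ltr0n. Qed.
Let one : (1 <= 1 <= M)%N. Proof. by rewrite hM. Qed.
Let lr j t (jM : (1 <= j <= M)%N) := L1_ext (sol_C0L1 hrho jM) t.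
Let lw t : L1 mu (fun x => ext W (t, x)). Proof. exact: (L1_ext (sol_C0L1 hW one)). Qed.
Let lW0 : L1 mu W0. Proof. exact: (sol_data_L1 hW one). Qed.

Lemma spreads_equal (e t : R) : 0 < e -> 0 <= t ->
  spreads M (fun=> W) (fun=> W) e t <= M%:R * spread e W0 W0.
Proof.
move=> e0 t0; apply: (le_trans (spreads_le hM hL hV hS0 htau hW hW e0 t0 (lexx 0) t0)).
apply: (le_trans (initial_spread hM hL hV hS0 htau hW e0)).
by rewrite sum_lanes_cond sum_lanes_const.
Qed.

Lemma gap_L1_le (e s t : R) : 0 < e -> 0 <= s -> s <= t ->
  mass e * gap_L1 t <= mass e * gap_L1 s + 2 * (M%:R * spread e W0 W0).
Proof.
move=> e0 s0 st; have t0 := le_trans s0 st.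
have me := mass_gt0 e0.
have h1 : mass e * gap_L1 t <= spreads M rho (fun=> W) e t + spreads M (fun=> W) (fun=> W) e t.
  rewrite /spreads !sum_lanes_cond -big_split/= mulr_sumr; apply: ler_sum => j jM.
  exact: (dist_le_spread e0 (lr t jM) (lw t) (lw t)).
have h2 : spreads M rho (fun=> W) e s <= spreads M (fun=> W) (fun=> W) e s + mass e * gap_L1 s.
  rewrite /spreads !sum_lanes_cond /gap_L1 mulr_sumr -big_split/=; apply: ler_sum => j jM.
  apply: (le_trans (spread_tri e0 (lr s jM) (lw s) (lw s) (lw s))).
  rewrite lerD2l; apply: ler_wpM2l; first exact: ltW.
  have -> : \int[mu]_x `|ext W (s, x) - ext W (s, x)| = 0.
    by rewrite -(@Int0 _ _ _ mu); apply: Int_eq => x; rewrite subrr normr0.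
  by rewrite addr0.
have h3 := spreads_le hM hL hV hS0 htau hrho hW e0 t0 s0 st.
have h4 := spreads_equal e0 t0; have h5 := spreads_equal e0 s0.
apply: (le_trans h1); apply: (le_trans (lerD (le_trans h3 h2) h4)).
rewrite addrAC addrC lerD2l mulr2n mulrDl !mul1r; exact: lerD.
Qed.

Lemma gap_L1_split (N s : R) : 0 < N -> 0 < s ->
  gap_L1 s <= 2 * (\sum_(1 <= j < M.+1 | (1 <= j <= M)%N)
      \int[mu]_x (`|ext W (s, x) - ext (rho j) (s, x)| * bump N x) +
    (M%:R * (\int[mu]_x W0 x - \int[mu]_x (W0 x * bump N x)) + s * (8 * (M%:R * V * L)))).
Proof.
move=> N0 s0.
have mulb (f : R -> R) : L1 mu f -> L1 mu (fun x => f x * bump N x).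
  by move=> /(L1_mul_bump N 0); under eq_fun do rewrite subr0.
have lwr j (jM : (1 <= j <= M)%N) := L1_norm (L1B (lw s) (lr s jM)).
have lrw j (jM : (1 <= j <= M)%N) := L1B (lr s jM) (lw s).
have pos j x (jM : (1 <= j <= M)%N) : 0 <= ext (rho j) (s, x).
  by have := U_range hrho (s, x) jM; rewrite in_itv => /andP[].
have wpos x : 0 <= ext W (s, x).
  by have := U_range hW (s, x) one; rewrite in_itv => /andP[].
have each j (jM : (1 <= j <= M)%N) :
    \int[mu]_x `|ext (rho j) (s, x) - ext W (s, x)| <=
    (\int[mu]_x ext (rho j) (s, x) - \int[mu]_x ext W (s, x)) +
    2 * (\int[mu]_x (`|ext W (s, x) - ext (rho j) (s, x)| * bump N x) +
         (\int[mu]_x ext W (s, x) - \int[mu]_x (ext W (s, x) * bump N x))).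
  have l1 := mulb _ (lwr j jM); have l2 := L1B (lw s) (mulb _ (lw s)).
  rewrite -(IntB (lr s jM) (lw s)) -(IntB (lw s) (mulb _ (lw s))) -(IntD l1 l2).
  rewrite -(IntZ 2 (L1D l1 l2)) -(IntD (lrw j jM) (L1Z 2 (L1D l1 l2))).
  apply: Int_le; [exact: L1_norm (lrw j jM)|exact: L1D (lrw j jM) (L1Z 2 (L1D l1 l2))|].
  move=> x; apply: pos_part_le; [exact: pos|exact: wpos|exact: bump_ge0|exact: bump_le1].
have massE : \sum_(1 <= j < M.+1 | (1 <= j <= M)%N)
    (\int[mu]_x ext (rho j) (s, x) - \int[mu]_x ext W (s, x)) = 0.
  rewrite sumrB (mass_eq hM hL hV hS0 hS1 htau hrho s0) (mass_eq hM hL hV hS0 hS1 htau hW s0).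
  rewrite sum_lanes_const -IntZ// -Int_sum; last by move=> j jM; exact: (sol_data_L1 hrho jM).
  by apply/eqP; rewrite subr_eq0; apply/eqP; apply: Int_eq => x; rewrite hW0.
apply: (le_trans (ler_sum _ each)); rewrite big_split/= massE add0r -mulr_sumr.
apply: ler_wpM2l => //; rewrite big_split/= lerD2l sum_lanes_const.
have mw : M%:R * \int[mu]_x ext W (s, x) = M%:R * \int[mu]_x W0 x.
  by rewrite -!sum_lanes_const; exact: (mass_eq hM hL hV hS0 hS1 htau hW s0).
have := weak_close hM hL hV hS0 hS1 htau hW 0 N0 s0.
rewrite !sum_lanes_const.
under eq_Rintegral do rewrite subr0.
under [X in _ - _ * X]eq_Rintegral do rewrite subr0.
rewrite ler_norml => /andP[+ _]; rewrite !mulrBr mw => wk.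
rewrite -addrA lerD2l -lerBlDl opprK.
by move: wk; rewrite lerNl opprB addrC.
Qed.

Lemma gap_local (e N s : R) : 0 < e -> 0 < N -> 0 < s ->
  mass e * \sum_(1 <= j < M.+1 | (1 <= j <= M)%N)
      \int[mu]_x (`|ext W (s, x) - ext (rho j) (s, x)| * bump N x) <=
  (2 * (M%:R * spread e W0 W0) + s * (16 * (M%:R * V * L) * N)) +
  (2 * \sum_(1 <= j < M.+1) spread e (rho0 j) (rho0 j) + s * (16 * (M%:R * V * L) * N)) +
  mass e * (M%:R * \int[mu]_x (gaps M (fun j => ext (rho j) (s, x)) * bump N x)).
Proof.
move=> e0 N0 s0; have me := mass_gt0 e0.
have mulb (f : R -> R) : L1 mu f -> L1 mu (fun x => f x * bump N x).
  by move=> /(L1_mul_bump N 0); under eq_fun do rewrite subr0.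
have c1 := total_close hM hL hV hS0 hS1 htau hW e0 N0 s0.
have c2 := total_close hM hL hV hS0 hS1 htau hrho e0 N0 s0.
rewrite [X in 2 * X]sum_lanes_cond sum_lanes_const in c1.
apply: le_trans (lerD (lerD c1 c2) (lexx _)).
set I1 := \int[mu]_x _; set I2 := \int[mu]_x _; set G := \int[mu]_x _.
rewrite -!mulrDr; apply: ler_wpM2l; first exact: ltW.
rewrite -(ler_pM2l m0) mulr_sumr -sum_lanes_const; apply: ler_sum => j jM.
have lwr := mulb _ (L1_norm (L1B (lw s) (lr s jM))).
have l1 : L1 mu (fun x => `|\sum_(1 <= j < M.+1 | (1 <= j <= M)%N) ext W (s, x) -
    \sum_(1 <= j < M.+1 | (1 <= j <= M)%N) W0 x| * bump N x).
  apply: mulb; apply: L1_norm; apply: L1B; apply: L1_sum => i iM; [exact: lw|exact: lW0].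
have l2 : L1 mu (fun x => `|\sum_(1 <= j < M.+1 | (1 <= j <= M)%N) ext (rho j) (s, x) -
    \sum_(1 <= j < M.+1 | (1 <= j <= M)%N) rho0 j x| * bump N x).
  apply: mulb; apply: L1_norm; apply: L1B; apply: L1_sum => i iM; first exact: lr.
  exact: (sol_data_L1 hrho iM).
have l3 : L1 mu (fun x => gaps M (fun j => ext (rho j) (s, x)) * bump N x).
  apply: mulb; apply: L1_sum => i /andP[i1 iM]; apply: L1_norm; apply: L1B; apply: lr.
    by rewrite i1 ltnW.
  by [].
rewrite -(IntZ M%:R lwr) /I1 /I2 /G -(IntZ M%:R l3) -(IntD l1 l2) -(IntD (L1D l1 l2) (L1Z _ l3)).
apply: Int_le; [exact: L1Z|exact: L1D (L1D l1 l2) (L1Z _ l3)|move=> x].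
rewrite mulrA (mulrA M%:R (gaps _ _)) -2!mulrDl; apply: ler_wpM2r; first exact: bump_ge0.
rewrite !sum_lanes_const hW0 -{1}(ger0_norm (ltW m0)) -normrM mulrBr.
set w := M%:R * _; set a := \sum_(_ <= _ < _ | _) rho0 _ x.
set b := \sum_(_ <= _ < _ | _) ext _ _.
have -> : w - M%:R * ext (rho j) (s, x) = (w - a) - (b - a) + (b - M%:R * ext (rho j) (s, x)) by ring.
apply: le_trans (ler_normD _ _) _; apply: lerD; first exact: ler_normB.
rewrite /b -!sum_lanes_const -sumrB; apply: le_trans (ler_norm_sum _ _ _) _.
apply: ler_sum => i iM; exact: (gaps_le (fun j => ext (rho j) (s, x)) iM jM).
Qed.

End Comparison.

Lemma gap_arith (R : realFieldType) (m a y z gt gs I p q sk sc d : R) :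
  0 < m -> m * gt <= m * gs + 2 * p -> gs <= 2 * (I + (z + sc)) ->
  m * I <= (2 * p + m * sk) + (2 * q + m * sk) + m * y ->
  p <= m * a -> q <= m * a -> a <= d / 50 -> 4 * sk + 2 * sc <= d / 5 ->
  y <= d / 10 -> z <= d / 10 -> 0 <= d -> gt <= d.
Proof.
move=> m0 h1 h2 h3 hp hq ha hs hy hz d0.
have {h1} h1 : gt <= gs + 2 * a by rewrite -(ler_pM2l m0) mulrDr (mulrCA m 2); lra.
have {h3} h3 : I <= 4 * a + 2 * sk + y.
  by rewrite -(ler_pM2l m0) !mulrDr (mulrCA m 4) (mulrCA m 2); lra.
lra.
Qed.

Section Conclusion.
Context {R : realType}.
Local Notation mu := (@lebesgue_measure R).
Variables (M : nat) (L V lip : R) (v : R -> R) (S : nat -> R -> R -> R).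
Hypotheses (hM : (0 < M)%N) (hL : 0 < L) (hV : hypV L V v) (hS0 : hypS0 M L lip S)
  (hS1 : hypS1 M L S).
Local Notation sol := (solution M L v S).
Variables (rho0 : nat -> R -> R) (W0 : R -> R).
Hypothesis hW0 : forall x, M%:R * W0 x = \sum_(1 <= j < M.+1 | (1 <= j <= M)%N) rho0 j x.
Hypotheses (lrho0 : forall j, (1 <= j <= M)%N -> L1 mu (rho0 j)) (lW0 : L1 mu W0).

Lemma gap_L1_small (t delta : R) : 0 < t -> 0 < delta ->
  exists2 tau0 : R, 0 < tau0 & forall tau rho W, 0 < tau -> tau <= tau0 ->
  sol tau rho0 rho -> sol tau (fun=> W0) (fun=> W) -> gap_L1 M rho W t <= delta.
Proof.
move=> t0 d0; have V0 := V_ge0 hL hV.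
have m0 : 0 < M%:R :> R by rewrite ltr0n.
pose eps := delta / (50 * M%:R).
have eps0 : 0 < eps by rewrite divr_gt0// mulr_gt0.
have [dW dW0 hdW] := spread_small lW0 eps0.
have [|dr dr0 hdr] := @lanes_uniform R M
    (fun j e => spread e (rho0 j) (rho0 j) <= mass e * eps).
  by move=> j jM; exact: (spread_small (lrho0 jM) eps0).
pose e := Num.min dW dr.
have e0 : 0 < e by rewrite lt_min dW0.
have me := mass_gt0 e0.
have hW1 : spread e W0 W0 <= mass e * eps by apply: hdW => //; rewrite ge_min lexx.
have hr1 j (jM : (1 <= j <= M)%N) : spread e (rho0 j) (rho0 j) <= mass e * eps.
  by apply: hdr => //; rewrite ge_min lexx orbT.
have z10 : 0 < delta / (10 * M%:R) by rewrite divr_gt0// mulr_gt0.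
have [N N1 hN] := Int_bump_tail lW0 z10.
have N0 : 0 < N by exact: lt_le_trans N1.
pose C := M%:R * V * L.
have C0 : 0 <= C by rewrite /C !mulr_ge0// ltW.
pose K := 16 * C * N / mass e.
have K0 : 0 <= K by rewrite /K divr_ge0 ?(ltW me)// mulr_ge0 ?(ltW N0)// mulr_ge0.
pose B := 4 * K + 2 * (8 * C) + 1.
have B0 : 0 < B.
  apply: ltr_pwDr => //; apply: addr_ge0; first exact: mulr_ge0.
  by apply: mulr_ge0 => //; exact: mulr_ge0.
pose h := Num.min t (delta / 5 / B).
have h0 : 0 < h by rewrite lt_min t0/= !divr_gt0.
have [tau0 tau00 htau0] := relaxed_time hM hL hV hS0 hS1 h0 N0 z10.
exists tau0 => // tau rho W tp tle hrho hW.
have [s [s0 sh hG]] := htau0 tau rho0 rho tp tle hrho.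
have st : s <= t by apply: (le_trans sh); rewrite ge_min lexx.
have sB : s <= delta / 5 / B by apply: (le_trans sh); rewrite ge_min lexx orbT.
have h1 := gap_L1_le hM hL hV hS0 tp hrho hW e0 (ltW s0) st.
have h2 := gap_L1_split hM hL hV hS0 hS1 tp hrho hW hW0 N0 s0.
have h3 := gap_local hM hL hV hS0 hS1 tp hrho hW hW0 e0 N0 s0.
have sK : s * (16 * (M%:R * V * L) * N) = mass e * (s * K).
  by rewrite /K -/C; field; rewrite gt_eqF.
rewrite sK in h3.
apply: (gap_arith (a := M%:R * eps) (d := delta) me h1 h2 h3).
- by rewrite mulrCA; apply: ler_wpM2l => //; exact: ltW.
- rewrite sum_lanes_cond mulrCA -sum_lanes_const; apply: ler_sum => j jM; exact: hr1.
- by rewrite /eps le_eqVlt; apply/orP; left; apply/eqP; field; rewrite gt_eqF.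
- apply: (@le_trans _ _ (s * B)).
    by rewrite /B -/C !mulrDr mulr1 (mulrCA s 4) (mulrCA s 2) lerDl ltW.
  by rewrite -ler_pdivlMr.
- apply: (@le_trans _ _ (M%:R * (delta / (10 * M%:R)))).
    exact: ler_wpM2l.
  by rewrite le_eqVlt; apply/orP; left; apply/eqP; field; rewrite gt_eqF.
- apply: (@le_trans _ _ (M%:R * (delta / (10 * M%:R)))).
    by apply: ler_wpM2l => //; rewrite lerBlDr addrC -lerBlDr.
  by rewrite le_eqVlt; apply/orP; left; apply/eqP; field; rewrite gt_eqF.
- exact: ltW.
Qed.

End Conclusion.

Lemma Rintegral_subset_le (R : realType) (K : set R) (f : R -> R) : compact K ->
  L1 (@lebesgue_measure R) f -> (forall x, 0 <= f x) ->
  \int[@lebesgue_measure R]_(x in K) f x <= \int[@lebesgue_measure R]_x f x.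
Proof.
move=> cK lf f0.
have mK : measurable (K : set (measurableTypeR R)).
  by apply: closed_measurable; apply: compact_closed => //; exact: Rhausdorff.
rewrite Rintegral_mkcond patch_indic.
have fK x : f x * \1_K x <= f x.
  by rewrite indicE; case: (_ \in _); rewrite ?mulr1 ?mulr0.
apply: Int_le => //; apply: (L1_dom _ lf).
  by apply: measurable_funM; [exact: L1_measurable lf|exact: measurable_indic].
by move=> x; rewrite ger0_norm ?fK// mulr_ge0.
Qed.

Theorem theorem2 (R : realType) (M : nat) (Rmax V lip : R)
    (v : R -> R) (S : nat -> R -> R -> R)
    (hM : (0 < M)%N) (hR : 0 < Rmax)
    (hV : hypV (Rmax / M%:R) V v)
    (hS0 : hypS0 M (Rmax / M%:R) lip S)
    (hS1 : hypS1 M (Rmax / M%:R) S)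
    (rho0 : nat -> R -> R)
    (hrho0 : forall j, (1 <= j <= M)%N -> L1BV (Rmax / M%:R) (rho0 j))
    (rho : R -> nat -> R -> R -> R)
    (hrho : forall tau, 0 < tau ->
      system_entropy_solution M (Rmax / M%:R) (flux v) S tau rho0 (rho tau))
    (r : R -> R -> R)
    (hr : scalar_entropy_solution Rmax (fun y => M%:R * flux v (y / M%:R))
      (fun x => \sum_(1 <= j < M.+1) rho0 j x) r) :
  forall (t : R) (j : nat), 0 < t -> (1 <= j <= M)%N ->
  cvg_L1loc (fun tau => rho tau j t) (fun x => r t x / M%:R).
Proof.
move=> t j t0 jM K cK.
have m0 : 0 < M%:R :> R by rewrite ltr0n.
have hL : 0 < Rmax / M%:R by rewrite divr_gt0.
have d01 i (iM : (1 <= i <= M)%N) := L1BV_range (hrho0 i iM).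
have d02 i (iM : (1 <= i <= M)%N) := L1BV_integrable (hrho0 i iM).
have ML : M%:R * (Rmax / M%:R) = Rmax by rewrite mulrCA divff ?mulr1// gt_eqF.
rewrite -[X in scalar_entropy_solution X]ML in hr.
have hW tau := equal_lanes_solution hM hL hS0 hS1 tau d01 d02 hr.
have hrho' tau (tp : 0 < tau) := IsSolution (hrho tau tp) d01 d02.
pose W0 x := (\sum_(1 <= i < M.+1) rho0 i x) / M%:R.
have hW0 x : M%:R * W0 x = \sum_(1 <= i < M.+1 | (1 <= i <= M)%N) rho0 i x.
  by rewrite /W0 mulrCA divff ?mulr1 ?gt_eqF// sum_lanes_cond.
apply/cvgrPdist_le => delta delta0.
have [tau0 tau00 small] := gap_L1_small hM hL hV hS0 hS1 hW0 d02 (sol_data_L1 (hW 1) jM) t0 delta0.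
near=> tau.
have tp : 0 < tau by near: tau; exact: nbhs_right_gt.
have tle : tau <= tau0 by near: tau; exact: nbhs_right_le.
have le := small tau (rho tau) _ tp tle (hrho' tau tp) (hW tau).
have ge0 : 0 <= \int[@lebesgue_measure R]_(x in K) `|rho tau j t x - r t x / M%:R|.
  exact: Rintegral_ge0.
rewrite sub0r normrN ger0_norm//.
have lu : L1 (@lebesgue_measure R) (fun x => `|rho tau j t x - r t x / M%:R|).
  apply: L1_norm; apply: L1B; first exact: (C0L1_integrable (hrho tau tp j jM).1 (ltW t0)).
  exact: (C0L1_integrable (sol_C0L1 (hW tau) jM) (ltW t0)).
apply: (le_trans (Rintegral_subset_le cK lu _)) => //; apply: le_trans le.
rewrite /gap_L1 -sum_lanes_cond (big_rem j) ?mem_index_iota//=.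
have -> : (fun x => `|rho tau j t x - r t x / M%:R|) =
    (fun x => `|ext (rho tau j) (t, x) - ext (fun t x => r t x / M%:R) (t, x)|).
  by apply/funext => x; rewrite !ext_ge0// ltW.
by rewrite lerDl sumr_ge0// => i _; exact: Int_ge0.
Unshelve. all: by end_near.
Qed.
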